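(* Let $W$ be a connected complex manifold, let $Z\subset W$ be an exceptional curve of codimension $n\ge2$ in $W$, and let $\pi\colon W\to W'$ be the contraction of $Z$ to a point $x\in W'$. Then for any reflexive sheaf $\mathcal F$ on $W$ we have $$h^0\bigl(W';\ (\pi_*\mathcal F)^{\vee\vee}/\pi_*\mathcal F\bigr)=0.$$
   Context: $Z$ is a compact, reduced, connected curve which is exceptional in $W$: there is a normal complex space $W'$ (possibly singular at $x$) and a proper holomorphic map $\pi\colon W\to W'$ with $\pi_*\mathcal O_W=\mathcal O_{W'}$, $\pi(Z)=\{x\}$ and $\pi|_{W\setminus Z}\colon W\setminus Z\to W'\setminus\{x\}$ an isomorphism. A coherent sheaf $\mathcal G$ is reflexive if the natural map $\mathcal G\to\mathcal G^{\vee\vee}$ to its double dual is an isomorphism; $(\pi_*\mathcal F)^{\vee\vee}/\pi_*\mathcal F$ denotes the cokernel of the natural map $\pi_*\mathcal F\to(\pi_*\mathcal F)^{\vee\vee}$. *)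

(* Defs.v *)
From HB Require Import structures.
From mathcomp Require Import all_boot all_order all_algebra.
From mathcomp Require Import all_classical all_reals all_analysis.
From mathcomp Require Import generic_quotient complex.

Set Implicit Arguments.
Unset Strict Implicit.
Unset Printing Implicit Defensive.

Import Order.TTheory GRing.Theory Num.Theory numFieldNormedType.Exports.

Local Open Scope classical_set_scope.
Local Open Scope ring_scope.
Local Open Scope quotient_scope.

(* Typed as a [numClosedFieldType] so that the generic norm topology of
   [numFieldNormedType] applies: differentiability below is over C. *)
Definition Cplx (R : realType) : numClosedFieldType := R[i].

(* A reduced complex space is determined by its underlying space and by which
   C-valued functions on its open sets are holomorphic.  [hol U f] says that f
   is holomorphic on U; only the values of f on U matter. *)
Record fspace (R : realType) := FSpace {
  fsp_top :> topologicalType;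
  hol : set fsp_top -> (fsp_top -> Cplx R) -> Prop;
  hol_ext : forall (U : set fsp_top) (f g : fsp_top -> Cplx R),
    (forall x, U x -> f x = g x) -> hol U f -> hol U g;
  hol_sub : forall (U V : set fsp_top) (f : fsp_top -> Cplx R),
    open U -> open V -> V `<=` U -> hol U f -> hol V f;
  hol_glue : forall (U : set fsp_top) (f : fsp_top -> Cplx R), open U ->
    (forall x, U x -> exists V, [/\ open V, V x, V `<=` U & hol V f]) ->
    hol U f;
  hol_cst : forall (U : set fsp_top) (c : Cplx R), open U -> hol U (cst c);
  hol_add : forall (U : set fsp_top) (f g : fsp_top -> Cplx R), open U ->
    hol U f -> hol U g -> hol U (f \+ g);
  hol_mul : forall (U : set fsp_top) (f g : fsp_top -> Cplx R), open U ->
    hol U f -> hol U g -> hol U (f \* g)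
}.

Record opens (X : topologicalType) := Opens {
  oset :> X -> Prop;
  oset_open : open oset
}.

Definition opensT (X : topologicalType) : opens X := Opens openT.

Definition opensI (X : topologicalType) (U V : opens X) : opens X :=
  Opens (openI (oset_open U) (oset_open V)).

Lemma opensTs (X : topologicalType) (U : opens X) : U `<=` opensT X.
Proof. by []. Qed.

Lemma opensIl (X : topologicalType) (U V : opens X) : opensI U V `<=` U.
Proof. by move=> x []. Qed.

Lemma opensIr (X : topologicalType) (U V : opens X) : opensI U V `<=` V.
Proof. by move=> x []. Qed.

Section StructureSheaf.
Context {R : realType} {X : fspace R}.
Local Notation C := (Cplx R).
Implicit Types U V W : opens X.

Definition ext0 (U : set X) (f : set_type U -> C) : X -> C := valL_ 0 f.

Lemma ext0E (U : set X) (f : set_type U -> C) (x : X) (Ux : U x) :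
  ext0 f x = f (SigSub (mem_set Ux)).
Proof. by rewrite -[in RHS](valLK 0 f). Qed.

Lemma ext0_val (U : set X) (f : set_type U -> C) (y : set_type U) :
  ext0 f (\val y) = f y.
Proof. by rewrite -[in RHS](valLK 0 f). Qed.

Definition holb U : {pred (set_type U -> C)} := fun f => `[< hol U (ext0 f) >].
Arguments holb : clear implicits.

Lemma holb_subring U : subring_closed (holb U).
Proof.
have oU := oset_open U.
split=> [|f g|f g]; rewrite /in_mem /=.
- by apply/asboolP; apply: hol_ext (hol_cst 1 oU) => x Ux; rewrite ext0E.
- move=> /asboolP hf /asboolP hg; apply/asboolP.
  apply: hol_ext (hol_add oU hf (hol_mul oU (hol_cst (-1) oU) hg)) => x Ux.
  by rewrite /= !(ext0E _ Ux) mulN1r.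
- move=> /asboolP hf /asboolP hg; apply/asboolP.
  apply: hol_ext (hol_mul oU hf hg) => x Ux.
  by rewrite /= !(ext0E _ Ux).
Qed.

Record osec U := OSec { oval :> set_type U -> C; ovalP : oval \in holb U }.

HB.instance Definition _ U := [isSub for (@oval U)].
HB.instance Definition _ U := [Choice of osec U by <:].
HB.instance Definition _ U :=
  GRing.SubChoice_isSubComPzRing.Build (set_type U -> C) (holb U) (osec U)
    (@holb_subring U).

Lemma osecP U (f g : osec U) : (forall y, f y = g y) -> f = g.
Proof. by move=> fg; apply/val_inj/funext. Qed.

Lemma osec_hol U (f : osec U) : hol U (ext0 f).
Proof. by have /asboolP := ovalP f. Qed.

Lemma osecD U (f g : osec U) y : (f + g) y = f y + g y. Proof. by []. Qed.
Lemma osecM U (f g : osec U) y : (f * g) y = f y * g y. Proof. by []. Qed.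
Lemma osec1 U y : (1 : osec U) y = 1. Proof. by []. Qed.

Lemma ores_subproof U V (VU : V `<=` U) (f : osec U) :
  sigL V (ext0 f) \in holb V.
Proof.
apply/asboolP; apply: (hol_ext (f := ext0 f)) => [x Vx|].
  by rewrite (ext0E _ Vx).
exact: hol_sub (oset_open U) (oset_open V) VU (osec_hol f).
Qed.

Definition ores U V (VU : V `<=` U) (f : osec U) : osec V :=
  OSec (ores_subproof VU f).

Lemma oresE U V (VU : V `<=` U) (f : osec U) (y : set_type V) :
  ores VU f y = ext0 f (\val y).
Proof. by []. Qed.

Lemma ext0_ores U V (VU : V `<=` U) (f : osec U) x :
  V x -> ext0 (ores VU f) x = ext0 f x.
Proof. by move=> Vx; rewrite ext0E. Qed.

Lemma ores_lin U V (VU : V `<=` U) (a b c : osec U) :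
  ores VU (a * b + c) = ores VU a * ores VU b + ores VU c.
Proof.
apply: osecP => y; rewrite osecD osecM !oresE.
by rewrite !(ext0E _ (VU _ (set_valP y))).
Qed.

Lemma ores_comp U V W (VU : V `<=` U) (WV : W `<=` V) (WU : W `<=` U)
  (a : osec U) : ores WV (ores VU a) = ores WU a.
Proof.
apply: osecP => y; rewrite !oresE ext0_ores //.
exact: WV (set_valP y).
Qed.

Lemma ores_id U (UU : U `<=` U) (a : osec U) : ores UU a = a.
Proof. by apply: osecP => y; rewrite oresE ext0_val. Qed.

Lemma ores1 U V (VU : V `<=` U) : ores VU 1 = 1.
Proof.
by apply: osecP => y; rewrite oresE (ext0E _ (VU _ (set_valP y))).
Qed.
Lemma oresN1 U V (VU : V `<=` U) : ores VU (-1) = -1.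
Proof.
by apply: osecP => y; rewrite oresE (ext0E _ (VU _ (set_valP y))).
Qed.
Lemma oresD U V (VU : V `<=` U) a b : ores VU (a + b) = ores VU a + ores VU b.
Proof. by rewrite -[a in LHS]mulr1 ores_lin ores1 mulr1. Qed.
Lemma oresM U V (VU : V `<=` U) a b : ores VU (a * b) = ores VU a * ores VU b.
Proof.
by apply: osecP => y; rewrite osecM !oresE !(ext0E _ (VU _ (set_valP y))).
Qed.

Lemma ocst_subproof U (c : C) : (cst c : set_type U -> C) \in holb U.
Proof.
apply/asboolP; apply: hol_ext (hol_cst c (oset_open U)) => x Ux.
by rewrite (ext0E _ Ux).
Qed.

Definition ocst U (c : C) : osec U := OSec (ocst_subproof U c).

End StructureSheaf.

Arguments holb {R X} U _.

(* Only a presheaf of O_X-modules; sheaves are singled out by [is_sheaf]. *)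
Record psmod (R : realType) (X : fspace R) := PsMod {
  sec :> forall U : opens X, lmodType (osec U);
  res : forall U V : opens X, V `<=` U -> sec U -> sec V;
  res_id : forall (U : opens X) (UU : U `<=` U) (s : sec U), res UU s = s;
  res_comp : forall (U V W : opens X) (VU : V `<=` U) (WV : W `<=` V)
    (WU : W `<=` U) (s : sec U), res WV (res VU s) = res WU s;
  res_lin : forall (U V : opens X) (VU : V `<=` U) (a : osec U) (s t : sec U),
    res VU (a *: s + t) = ores VU a *: res VU s + res VU t
}.

Record psmor (R : realType) (X : fspace R) (F G : psmod X) := PsMor {
  mor :> forall U : opens X, F U -> G U;
  mor_lin : forall (U : opens X) (a : osec U) (s t : F U),
    mor (a *: s + t) = a *: mor s + mor t;
  mor_res : forall (U V : opens X) (VU : V `<=` U) (s : F U),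
    mor (res VU s) = res VU (mor s)
}.

Section Presheaves.
Context {R : realType} {X : fspace R}.
Implicit Types (U V W : opens X) (F G : psmod X).

Definition is_sheaf F : Prop :=
  forall (U : opens X) (I : Type) (V : I -> opens X)
    (VU : forall i, V i `<=` U), U `<=` \bigcup_i V i ->
  (forall s t : F U, (forall i, res (VU i) s = res (VU i) t) -> s = t) /\
  (forall s : forall i, F (V i),
    (forall i j (W : opens X) (Wi : W `<=` V i) (Wj : W `<=` V j),
      res Wi (s i) = res Wj (s j)) ->
    exists t : F U, forall i, res (VU i) t = s i).

Definition finite_type F : Prop :=
  forall x : X, exists (U : opens X) (k : nat) (g : 'I_k -> F U), U x /\
    forall (V : opens X) (VU : V `<=` U) (t : F V) (y : X), V y ->
    exists (W : opens X) (WV : W `<=` V) (WU : W `<=` U)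
      (a : 'I_k -> osec W),
      W y /\ res WV t = \sum_i a i *: res WU (g i).

(* The kernel of the map O_U^k -> F|_U given by s is of finite type. *)
Definition finite_relations F (U : opens X) (k : nat) (s : 'I_k -> F U) :
    Prop :=
  forall x : X, U x ->
  exists (V : opens X) (VU : V `<=` U) (l : nat)
      (r : 'I_l -> 'I_k -> osec V),
    [/\ V x, forall j, \sum_i r j i *: res VU (s i) = 0 &
    forall (W : opens X) (WV : W `<=` V) (WU : W `<=` U)
        (a : 'I_k -> osec W) (y : X), W y ->
      \sum_i a i *: res WU (s i) = 0 ->
      exists (W' : opens X) (W'W : W' `<=` W) (W'V : W' `<=` V)
        (b : 'I_l -> osec W'), W' y /\
        forall i, ores W'W (a i) = \sum_j b j * ores W'V (r j i)].

Definition coherent F : Prop :=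
  [/\ is_sheaf F, finite_type F &
    forall (U : opens X) (k : nat) (s : 'I_k -> F U), finite_relations s].

Lemma res_irr F U V (p q : V `<=` U) (s : F U) : res p s = res q s.
Proof. by rewrite (Prop_irrelevance p q). Qed.

Lemma resD F U V (VU : V `<=` U) (s t : F U) :
  res VU (s + t) = res VU s + res VU t.
Proof.
by rewrite -[s in LHS]scale1r res_lin ores1 scale1r.
Qed.

Lemma res0 F U V (VU : V `<=` U) : res VU (0 : F U) = 0.
Proof. by apply: (addrI (res VU 0)); rewrite -resD !addr0. Qed.

Lemma resZ F U V (VU : V `<=` U) (a : osec U) (s : F U) :
  res VU (a *: s) = ores VU a *: res VU s.
Proof. by rewrite -[a *: s]addr0 res_lin res0 addr0. Qed.

Lemma resN F U V (VU : V `<=` U) (s : F U) : res VU (- s) = - res VU s.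
Proof. by apply: (addrI (res VU s)); rewrite -resD !subrr res0. Qed.

Lemma mor0 F G (m : psmor F G) U : m U 0 = 0.
Proof.
have := mor_lin m (1 : osec U) 0 0.
by rewrite !scale1r addr0 => /(congr1 (fun z => z - m U 0)); rewrite addrK subrr.
Qed.

Lemma morD F G (m : psmor F G) U (s t : F U) : m U (s + t) = m U s + m U t.
Proof. by rewrite -[s in LHS]scale1r mor_lin scale1r. Qed.

Lemma morZ F G (m : psmor F G) U (a : osec U) (s : F U) :
  m U (a *: s) = a *: m U s.
Proof. by rewrite -[a *: s]addr0 mor_lin mor0 addr0. Qed.

Lemma morN F G (m : psmor F G) U (s : F U) : m U (- s) = - m U s.
Proof. by apply: (addrI (m U s)); rewrite -morD !subrr mor0. Qed.

End Presheaves.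

Section Dual.
Context {R : realType} {X : fspace R}.
Variable F : psmod X.
Implicit Types U V W : opens X.

(* A section over U: a morphism of sheaves of modules from F|_U to O_U. *)
Record dsec U := DSec {
  dval :> forall V, V `<=` U -> F V -> osec V;
  dval_lin : forall V (VU : V `<=` U) (a : osec V) (s t : F V),
    dval VU (a *: s + t) = a * dval VU s + dval VU t;
  dval_res : forall V W (VU : V `<=` U) (WV : W `<=` V) (WU : W `<=` U)
    (s : F V), dval WU (res WV s) = ores WV (dval VU s)
}.

Lemma dsecP U (p q : dsec U) :
  (forall V (VU : V `<=` U) (s : F V), p V VU s = q V VU s) -> p = q.
Proof.
case: p q => [p pl pr] [q ql qr] /= pq.
have e : p = q.
  by apply: functional_extensionality_dep => V; apply: funext => VU; apply: funext.
by case: q / e ql qr pq => ql qr _; congr DSec; exact: Prop_irrelevance.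
Qed.

Lemma dval_irr U V (VU VU' : V `<=` U) (p : dsec U) (s : F V) :
  p V VU s = p V VU' s.
Proof. by rewrite (Prop_irrelevance VU VU'). Qed.

HB.instance Definition _ U := gen_eqMixin (dsec U).
HB.instance Definition _ U := gen_choiceMixin (dsec U).

Program Definition dzero U : dsec U := @DSec U (fun _ _ _ => 0) _ _.
Next Obligation. by move=> *; rewrite mulr0 addr0. Qed.
Next Obligation.
by move=> U V W VU WV WU s; apply: osecP => y; rewrite oresE (ext0E _ (WV _ (set_valP y))).
Qed.

Program Definition dual_add U (p q : dsec U) : dsec U :=
  @DSec U (fun V VU s => p V VU s + q V VU s) _ _.
Next Obligation.
by move=> U p q V VU a s t /=; rewrite !dval_lin mulrDr addrACA.
Qed.
Next Obligation.
move=> U p q V W VU WV WU s /=; rewrite !(dval_res _ VU WV).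
by apply: osecP => y; rewrite osecD !oresE !(ext0E _ (WV _ (set_valP y))) osecD.
Qed.

Program Definition dual_scale U (a : osec U) (p : dsec U) : dsec U :=
  @DSec U (fun V VU s => ores VU a * p V VU s) _ _.
Next Obligation.
by move=> U a p V VU b s t /=; rewrite dval_lin mulrDr !mulrA [_ * b]mulrC.
Qed.
Next Obligation.
move=> U a p V W VU WV WU s /=; rewrite (dval_res _ VU WV) -(ores_comp VU WV).
by apply: osecP => y; rewrite osecM !oresE !(ext0E _ (WV _ (set_valP y))) osecM.
Qed.

Definition dual_opp U (p : dsec U) : dsec U := dual_scale (-1) p.

Lemma daddA U : associative (@dual_add U).
Proof. by move=> p q r; apply: dsecP => *; rewrite /= addrA. Qed.
Lemma daddC U : commutative (@dual_add U).
Proof. by move=> p q; apply: dsecP => *; rewrite /= addrC. Qed.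
Lemma dadd0 U : left_id (dzero U) (@dual_add U).
Proof. by move=> p; apply: dsecP => *; rewrite /= add0r. Qed.
Lemma daddN U : left_inverse (dzero U) (@dual_opp U) (@dual_add U).
Proof. by move=> p; apply: dsecP => *; rewrite /= oresN1 mulN1r addNr. Qed.

HB.instance Definition _ U :=
  GRing.isZmodule.Build (dsec U) (@daddA U) (@daddC U) (@dadd0 U) (@daddN U).

Lemma dscaleA U (a b : osec U) (p : dsec U) :
  dual_scale a (dual_scale b p) = dual_scale (a * b) p.
Proof. by apply: dsecP => *; rewrite /= oresM mulrA. Qed.
Lemma dscale1 U : left_id 1 (@dual_scale U).
Proof. by move=> p; apply: dsecP => *; rewrite /= ores1 mul1r. Qed.
Lemma dscaleDr U : right_distributive (@dual_scale U) +%R.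
Proof. by move=> a p q; apply: dsecP => *; rewrite /= mulrDr. Qed.
Lemma dscaleDl U (p : dsec U) :
  {morph (fun a => dual_scale a p) : a b / a + b}.
Proof. by move=> a b; apply: dsecP => *; rewrite /= oresD mulrDl. Qed.

HB.instance Definition _ U := GRing.Zmodule_isLmodule.Build (osec U) (dsec U)
  (@dscaleA U) (@dscale1 U) (@dscaleDr U) (@dscaleDl U).

Program Definition dres U V (VU : V `<=` U) (p : dsec U) : dsec V :=
  @DSec V (fun W WV s => p W (subset_trans WV VU) s) _ _.
Next Obligation. by move=> *; exact: dval_lin. Qed.
Next Obligation. by move=> *; exact: dval_res. Qed.

Program Definition dual : psmod X := @PsMod R X (fun U => dsec U) dres _ _ _.
Next Obligation.
by move=> U UU p; apply: dsecP => V VU s /=; exact: dval_irr.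
Qed.
Next Obligation.
move=> U V W VU WV WU p; apply: dsecP => W' W'W s /=.
exact: dval_irr.
Qed.
Next Obligation.
move=> U V VU a p q; apply: dsecP => W WV s /=.
by rewrite (ores_comp VU WV (subset_trans WV VU)).
Qed.

End Dual.

Section Bidual.
Context {R : realType} {X : fspace R}.
Variable F : psmod X.
Implicit Types U V W : opens X.

Program Definition bidual_sec U (s : F U) : dual (dual F) U :=
  @DSec R X (dual F) U
    (fun V VU (p : dual F V) => dval p (@subset_refl _ V) (res VU s)) _ _.
Next Obligation.
move=> U s V VU a p q /=.
by rewrite ores_id.
Qed.
Next Obligation.
move=> U s V W VU WV WU p /=.
rewrite -(dval_res p _ WV WV) (res_comp VU WV WU); exact: dval_irr.
Qed.

Program Definition bidual_map : psmor F (dual (dual F)) :=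
  @PsMor R X F (dual (dual F)) bidual_sec _ _.
Next Obligation.
move=> U a s t; apply: dsecP => V VU p /=.
by rewrite res_lin dval_lin.
Qed.
Next Obligation.
move=> U V VU s; apply: dsecP => W WV p /=.
by rewrite (res_comp VU WV (subset_trans WV VU)).
Qed.

Definition reflexive_sheaf : Prop := forall U, bijective (bidual_map U).

End Bidual.

Record holmap (R : realType) (X Y : fspace R) := HolMap {
  hmap :> X -> Y;
  hmap_cont : continuous hmap;
  hmap_hol : forall (V : set Y) (f : Y -> Cplx R), open V ->
    hol V f -> hol (hmap @^-1` V) (f \o hmap)
}.

Section DirectImage.
Context {R : realType} {X Y : fspace R}.
Variable p : holmap X Y.
Implicit Types U V W : opens Y.

Lemma opreim_subproof V : open (p @^-1` V).
Proof. by apply: open_comp (oset_open V) => x _; exact: hmap_cont. Qed.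

Definition opreim V : opens X := Opens (opreim_subproof V).

Lemma opreimS U V : V `<=` U -> opreim V `<=` opreim U.
Proof. by move=> VU x; exact: VU. Qed.

Lemma opull_subproof V (f : osec V) :
  sigL (opreim V) (ext0 f \o p) \in holb (opreim V).
Proof.
apply/asboolP; apply: hol_ext (hmap_hol p (oset_open V) (osec_hol f)) => x Vx.
by rewrite (ext0E _ (Vx : opreim V x)).
Qed.

(* The comorphism O_Y(V) -> O_X(p^-1(V)), f |-> f o p. *)
Definition opull V (f : osec V) : osec (opreim V) := OSec (opull_subproof f).

Lemma opullE V (f : osec V) (y : set_type (opreim V)) :
  opull f y = ext0 f (p (\val y)).
Proof. by []. Qed.

Lemma opullD V (f g : osec V) : opull (f + g) = opull f + opull g.
Proof.
by apply: osecP => y; rewrite osecD !opullE !(ext0E _ (set_valP y : V _)).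
Qed.

Lemma opullM V (f g : osec V) : opull (f * g) = opull f * opull g.
Proof.
by apply: osecP => y; rewrite osecM !opullE !(ext0E _ (set_valP y : V _)).
Qed.

Lemma opull1 V : opull (1 : osec V) = 1.
Proof.
by apply: osecP => y; rewrite opullE (ext0E _ (set_valP y : V _)).
Qed.

Lemma opull_res U V (VU : V `<=` U) (f : osec U) :
  opull (ores VU f) = ores (opreimS VU) (opull f).
Proof.
apply: osecP => y; rewrite oresE opullE ext0_ores; last exact: (set_valP y).
by rewrite (ext0E _ (opreimS VU (set_valP y))).
Qed.

Variable F : psmod X.

Definition pfsec V : Type := F (opreim V).

HB.instance Definition _ V := GRing.Zmodule.copy (pfsec V) (F (opreim V)).

Definition pfscale V (a : osec V) (s : pfsec V) : pfsec V :=
  opull a *: (s : F (opreim V)).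

Lemma pfscaleA V (a b : osec V) (s : pfsec V) :
  pfscale a (pfscale b s) = pfscale (a * b) s.
Proof. by rewrite /pfscale opullM scalerA. Qed.
Lemma pfscale1 V : left_id 1 (@pfscale V).
Proof. by move=> s; rewrite /pfscale opull1 scale1r. Qed.
Lemma pfscaleDr V : right_distributive (@pfscale V) +%R.
Proof. by move=> a s t; exact: scalerDr. Qed.
Lemma pfscaleDl V (s : pfsec V) :
  {morph (fun a => pfscale a s) : a b / a + b}.
Proof. by move=> a b; rewrite /pfscale opullD; exact: scalerDl. Qed.

HB.instance Definition _ V := GRing.Zmodule_isLmodule.Build (osec V) (pfsec V)
  (@pfscaleA V) (@pfscale1 V) (@pfscaleDr V) (@pfscaleDl V).

Definition pfres U V (VU : V `<=` U) (s : pfsec U) : pfsec V :=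
  res (opreimS VU) (s : F (opreim U)).

Lemma pfres_lin U V (VU : V `<=` U) (a : osec U) (s t : pfsec U) :
  pfres VU (a *: s + t) = ores VU a *: pfres VU s + pfres VU t.
Proof.
rewrite [RHS](_ : _ = opull (ores VU a) *: res (opreimS VU) (s : F (opreim U)) +
  res (opreimS VU) (t : F (opreim U))) // opull_res -res_lin //.
Qed.

Program Definition direct_image : psmod Y :=
  @PsMod R Y (fun V => pfsec V) pfres _ _ pfres_lin.
Next Obligation. by move=> U UU s; exact: res_id. Qed.
Next Obligation. by move=> U V W VU WV WU s; exact: res_comp. Qed.

End DirectImage.

Section Cokernel.
Context {R : realType} {X : fspace R} {F G : psmod X}.
Variable h : psmor F G.
Implicit Types U V W : opens X.

Section Stalk.
Variable x : X.

Record germ := Germ { gdom : opens X; gdomP : gdom x; gsec : G gdom }.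

HB.instance Definition _ := gen_eqMixin germ.
HB.instance Definition _ := gen_choiceMixin germ.

(* Equality in colim_{x \in W} G(W) / h(F(W)). *)
Definition germ_eq (a b : germ) : Prop :=
  exists W (Wa : W `<=` gdom a) (Wb : W `<=` gdom b) (t : F W),
    W x /\ res Wa (gsec a) - res Wb (gsec b) = h W t.

Lemma germ_eq_equiv : equiv_class_of (fun a b => `[< germ_eq a b >]).
Proof.
split=> [a|a b|b a c].
- apply/asboolP; exists (gdom a), (@subset_refl _ _), (@subset_refl _ _), 0.
  by split; [exact: gdomP|rewrite subrr mor0].
- suff H c d : germ_eq c d -> germ_eq d c.
    by apply/idP/idP => /asboolP/H/asboolP.
  move=> [W [Wa [Wb [t [Wx e]]]]]; exists W, Wb, Wa, (- t); split=> //.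
  by rewrite morN -e opprB.
- move=> /asboolP[W [Wa [Wb [t [Wx e]]]]] /asboolP[W' [Wb' [Wc [t' [Wx' e']]]]].
  apply/asboolP.
  have l : opensI W W' `<=` W by move=> ? [].
  have r : opensI W W' `<=` W' by move=> ? [].
  exists (opensI W W'), (subset_trans l Wa), (subset_trans r Wc).
  exists (res l t + res r t'); split; first by split.
  rewrite morD !mor_res -e -e' !resD !resN.
  rewrite !(res_comp _ _ (subset_trans l Wa)) !(res_comp _ _ (subset_trans r Wc)).
  rewrite (res_comp Wb l (subset_trans l Wb)) (res_comp Wb' r (subset_trans l Wb)).
  by rewrite addrA subrK.
Qed.

Definition germ_rel : equiv_rel germ := EquivRelPack germ_eq_equiv.

Definition cstalk := {eq_quot germ_rel}.

HB.instance Definition _ := Choice.on cstalk.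

Definition cls U (Ux : U x) (s : G U) : cstalk := \pi_cstalk (Germ Ux s).

Lemma clsP (c : cstalk) : exists U (Ux : U x) (s : G U), c = cls Ux s.
Proof.
exists (gdom (repr c)), (gdomP (repr c)), (gsec (repr c)).
by rewrite /cls; case E: (repr c) => [U Ux s] /=; rewrite -E reprK.
Qed.

Lemma cls_eq U V (Ux : U x) (Vx : V x) (s : G U) (t : G V) :
  cls Ux s = cls Vx t <->
  exists W (WU : W `<=` U) (WV : W `<=` V) (r : F W),
    W x /\ res WU s - res WV t = h W r.
Proof.
split=> [/eqmodP/asboolP//|H].
by apply/eqmodP/asboolP.
Qed.

Lemma cls_res U V (VU : V `<=` U) (Ux : U x) (Vx : V x) (s : G U) :
  cls Vx (res VU s) = cls Ux s.
Proof.
apply/cls_eq; exists V, (@subset_refl _ _), VU, 0; split=> //.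
by rewrite (res_comp VU _ VU) subrr mor0.
Qed.

Definition cstalk_add (c d : cstalk) : cstalk :=
  cls (conj (gdomP (repr c)) (gdomP (repr d)) :
         opensI (gdom (repr c)) (gdom (repr d)) x)
    (res (@opensIl _ _ _) (gsec (repr c)) +
     res (@opensIr _ _ _) (gsec (repr d))).

Definition cstalk_scale U (Ux : U x) (a : osec U) (c : cstalk) : cstalk :=
  cls (conj Ux (gdomP (repr c)) : opensI U (gdom (repr c)) x)
    (ores (@opensIl _ _ _) a *: res (@opensIr _ _ _) (gsec (repr c))).

Lemma cls_repr U (Ux : U x) (s : G U) (c := cls Ux s) :
  exists W (Wc : W `<=` gdom (repr c)) (WU : W `<=` U) (t : F W),
    W x /\ res Wc (gsec (repr c)) = res WU s + h W t.
Proof.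
have : cls (gdomP (repr c)) (gsec (repr c)) = cls Ux s.
  by rewrite /cls; case E: (repr c) => [V Vx t] /=; rewrite -E reprK.
move=> /cls_eq[W [Wc [WU [t [Wx e]]]]]; exists W, Wc, WU, t; split=> //.
by rewrite -e addrC subrK.
Qed.

Lemma cls_add U (Ux : U x) (s t : G U) :
  cstalk_add (cls Ux s) (cls Ux t) = cls Ux (s + t).
Proof.
have [W [Wc [WU [r [Wx e]]]]] := cls_repr Ux s.
have [W' [Wc' [WU' [r' [Wx' e']]]]] := cls_repr Ux t.
apply/cls_eq.
have l : opensI W W' `<=` W by move=> ? [].
have m : opensI W W' `<=` W' by move=> ? [].
have A : opensI W W' `<=`
    opensI (gdom (repr (cls Ux s))) (gdom (repr (cls Ux t))).
  by move=> y [Wy W'y]; split; [exact: (Wc _ Wy)|exact: (Wc' _ W'y)].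
exists (opensI W W'), A, (subset_trans l WU), (res l r + res m r').
split; first by split.
rewrite !resD.
rewrite (res_comp _ _ (subset_trans l Wc)) (res_comp _ _ (subset_trans m Wc')).
rewrite -(res_comp Wc l) -(res_comp Wc' m) e e' !resD morD !mor_res.
rewrite (res_comp WU l (subset_trans l WU)) (res_comp WU' m (subset_trans l WU)).
by rewrite addrACA [LHS]addrC addKr.
Qed.

Lemma cls_scale U V (Ux : U x) (Vx : V x) (UV : V `<=` U) (a : osec U)
    (s : G V) :
  cstalk_scale Ux a (cls Vx s) = cls Vx (ores UV a *: s).
Proof.
have [W [Wc [WV [r [Wx e]]]]] := cls_repr Vx s.
apply/cls_eq.
have A : W `<=` opensI U (gdom (repr (cls Vx s))).
  by move=> y Wy; split; [exact/UV/WV|exact: (Wc _ Wy)].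
exists W, A, WV, (ores (subset_trans WV UV) a *: r); split=> //.
rewrite !resZ morZ (res_comp _ _ Wc) e.
rewrite (ores_comp _ _ (subset_trans WV UV)) (ores_comp _ _ (subset_trans WV UV)).
by rewrite scalerDr [LHS]addrC addKr.
Qed.

Lemma cls2P (c d : cstalk) :
  exists U (Ux : U x) (s t : G U), c = cls Ux s /\ d = cls Ux t.
Proof.
have [U [Ux [s ->]]] := clsP c; have [V [Vx [t ->]]] := clsP d.
pose W := opensI U V; have Wx : W x by [].
exists W, Wx, (res (@opensIl _ _ _) s), (res (@opensIr _ _ _) t).
by split; rewrite cls_res.
Qed.

Definition cstalk0 : cstalk := cls (I : opensT X x) 0.

Lemma cls0 U (Ux : U x) : cls Ux 0 = cstalk0.
Proof.
apply/cls_eq; exists U, (@subset_refl _ _), (@opensTs _ _), 0; split=> //.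
by rewrite !res0 subrr mor0.
Qed.

Definition cstalk_opp (c : cstalk) : cstalk := cstalk_scale (I : opensT X x) (-1) c.

Lemma caddC : commutative cstalk_add.
Proof.
by move=> c d; have [U [Ux [s [t [-> ->]]]]] := cls2P c d; rewrite !cls_add addrC.
Qed.

Lemma caddA : associative cstalk_add.
Proof.
move=> c d e; have [U [Ux [s [t [-> ->]]]]] := cls2P c d.
have [V [Vx [r ->]]] := clsP e.
pose W := opensI U V; have Wx : W x by [].
rewrite -(cls_res (@opensIl _ U V : W `<=` U) Ux Wx s).
rewrite -(cls_res (@opensIl _ U V : W `<=` U) Ux Wx t).
rewrite -(cls_res (@opensIr _ U V : W `<=` V) Vx Wx r).
by rewrite !cls_add addrA.
Qed.

Lemma cadd0 : left_id cstalk0 cstalk_add.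
Proof.
move=> c; have [U [Ux [s ->]]] := clsP c.
by rewrite -(cls0 Ux) cls_add add0r.
Qed.

Lemma caddN : left_inverse cstalk0 cstalk_opp cstalk_add.
Proof.
move=> c; have [U [Ux [s ->]]] := clsP c.
rewrite /cstalk_opp (cls_scale _ _ (@opensTs _ _)) cls_add oresN1 scaleN1r addNr.
exact: cls0.
Qed.

HB.instance Definition _ :=
  GRing.isZmodule.Build cstalk caddA caddC cadd0 caddN.

Lemma clsD U (Ux : U x) (s t : G U) : cls Ux (s + t) = cls Ux s + cls Ux t.
Proof. by rewrite -cls_add. Qed.

End Stalk.

Lemma cls_irr x U (p q : U x) (s : G U) : cls p s = cls q s.
Proof. by rewrite (Prop_irrelevance p q). Qed.

(* A section over U of the sheafification of V |-> G(V) / h(F(V)). *)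
Record csec U := CSec {
  cval :> forall x : X, U x -> cstalk x;
  cvalP : forall x, U x -> exists V (VU : V `<=` U) (t : G V),
    V x /\ forall y (Vy : V y) (Uy : U y), cval Uy = cls Vy t
}.

Lemma csecP U (c d : csec U) :
  (forall x (Ux : U x), c x Ux = d x Ux) -> c = d.
Proof.
case: c d => [c cP] [d dP] /= cd.
have e : c = d.
  by apply: functional_extensionality_dep => x; apply: funext => Ux.
by case: d / e dP cd => dP _; congr CSec; exact: Prop_irrelevance.
Qed.

HB.instance Definition _ U := gen_eqMixin (csec U).
HB.instance Definition _ U := gen_choiceMixin (csec U).

Program Definition cszero U : csec U := @CSec U (fun _ _ => 0) _.
Next Obligation.
move=> U x Ux; exists U, (@subset_refl _ _), 0; split=> // y Uy _.
by rewrite cls0.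
Qed.

Program Definition csadd U (c d : csec U) : csec U :=
  @CSec U (fun x Ux => c x Ux + d x Ux) _.
Next Obligation.
move=> U c d x Ux.
have [V [VU [s [Vx cs]]]] := cvalP c Ux.
have [W [WU [t [Wx dt]]]] := cvalP d Ux.
have l : opensI V W `<=` V by move=> ? [].
have r : opensI V W `<=` W by move=> ? [].
exists (opensI V W), (subset_trans l VU), (res l s + res r t).
split=> // y [Vy Wy] Uy.
by rewrite clsD (cls_res _ Vy) (cls_res _ Wy) (cs y Vy) (dt y Wy).
Qed.

Program Definition csscale U (a : osec U) (c : csec U) : csec U :=
  @CSec U (fun x Ux => cstalk_scale Ux a (c x Ux)) _.
Next Obligation.
move=> U a c x Ux; have [V [VU [s [Vx cs]]]] := cvalP c Ux.
exists V, VU, (ores VU a *: s); split=> // y Vy Uy.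
by rewrite (cs y Vy) (cls_scale _ _ VU).
Qed.

Lemma cscaleA x U (Ux : U x) (a b : osec U) (c : cstalk x) :
  cstalk_scale Ux a (cstalk_scale Ux b c) = cstalk_scale Ux (a * b) c.
Proof.
have [V [Vx [s ->]]] := clsP c; pose W := opensI U V; have Wx : W x by [].
have l : W `<=` U by move=> ? [].
rewrite -(cls_res (@opensIr _ U V : W `<=` V) Vx Wx s).
by rewrite !(cls_scale _ _ l) scalerA oresM.
Qed.

Lemma cscale1 x U (Ux : U x) (c : cstalk x) : cstalk_scale Ux 1 c = c.
Proof.
have [V [Vx [s ->]]] := clsP c; pose W := opensI U V; have Wx : W x by [].
have l : W `<=` U by move=> ? [].
rewrite -(cls_res (@opensIr _ U V : W `<=` V) Vx Wx s).
by rewrite (cls_scale _ _ l) ores1 scale1r.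
Qed.

Lemma cscaleDl x U (Ux : U x) (a b : osec U) (c : cstalk x) :
  cstalk_scale Ux (a + b) c = cstalk_scale Ux a c + cstalk_scale Ux b c.
Proof.
have [V [Vx [s ->]]] := clsP c; pose W := opensI U V; have Wx : W x by [].
have l : W `<=` U by move=> ? [].
rewrite -(cls_res (@opensIr _ U V : W `<=` V) Vx Wx s).
by rewrite !(cls_scale _ _ l) oresD scalerDl clsD.
Qed.

Lemma cscaleDr x U (Ux : U x) (a : osec U) (c d : cstalk x) :
  cstalk_scale Ux a (c + d) = cstalk_scale Ux a c + cstalk_scale Ux a d.
Proof.
have [V [Vx [s [t [-> ->]]]]] := cls2P c d.
pose W := opensI U V; have Wx : W x by [].
have l : W `<=` U by move=> ? [].
rewrite -(cls_res (@opensIr _ U V : W `<=` V) Vx Wx s).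
rewrite -(cls_res (@opensIr _ U V : W `<=` V) Vx Wx t).
by rewrite -clsD !(cls_scale _ _ l) scalerDr clsD.
Qed.

Definition csopp U (c : csec U) : csec U := csscale (-1) c.

Lemma csaddA U : associative (@csadd U).
Proof. by move=> b c d; apply: csecP => *; rewrite /= addrA. Qed.
Lemma csaddC U : commutative (@csadd U).
Proof. by move=> c d; apply: csecP => *; rewrite /= addrC. Qed.
Lemma csadd0 U : left_id (cszero U) (@csadd U).
Proof. by move=> c; apply: csecP => *; rewrite /= add0r. Qed.
Lemma csaddN U : left_inverse (cszero U) (@csopp U) (@csadd U).
Proof.
move=> c; apply: csecP => x Ux /=; rewrite -[X in _ + X](cscale1 Ux) -cscaleDl.
have [V [Vx [s ->]]] := clsP (c x Ux).
pose W := opensI U V; have Wx : W x by [].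
have l : W `<=` U by move=> ? [].
rewrite -(cls_res (@opensIr _ U V : W `<=` V) Vx Wx s).
rewrite (cls_scale _ _ l) addNr.
by rewrite -[ores l 0](addrK (ores l 0)) -oresD addr0 subrr scale0r cls0.
Qed.

HB.instance Definition _ U :=
  GRing.isZmodule.Build (csec U) (@csaddA U) (@csaddC U) (@csadd0 U) (@csaddN U).

Lemma csscaleA U (a b : osec U) (c : csec U) :
  csscale a (csscale b c) = csscale (a * b) c.
Proof. by apply: csecP => *; exact: cscaleA. Qed.
Lemma csscale1 U : left_id 1 (@csscale U).
Proof. by move=> c; apply: csecP => *; exact: cscale1. Qed.
Lemma csscaleDr U : right_distributive (@csscale U) +%R.
Proof. by move=> a c d; apply: csecP => *; exact: cscaleDr. Qed.
Lemma csscaleDl U (c : csec U) :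
  {morph (fun a => csscale a c) : a b / a + b}.
Proof. by move=> a b; apply: csecP => *; exact: cscaleDl. Qed.

HB.instance Definition _ U := GRing.Zmodule_isLmodule.Build (osec U) (csec U)
  (@csscaleA U) (@csscale1 U) (@csscaleDr U) (@csscaleDl U).

Program Definition csres U V (VU : V `<=` U) (c : csec U) : csec V :=
  @CSec V (fun x Vx => c x (VU x Vx)) _.
Next Obligation.
move=> U V VU c x Vx; have [W [WU [t [Wx ct]]]] := cvalP c (VU x Vx).
have l : opensI V W `<=` V by move=> ? [].
have r : opensI V W `<=` W by move=> ? [].
exists (opensI V W), l, (res r t); split=> // y [Vy Wy] Vy'.
by rewrite (cls_res _ Wy) (ct y Wy).
Qed.

Lemma csres_lin U V (VU : V `<=` U) (a : osec U) (c d : csec U) :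
  csres VU (a *: c + d) = ores VU a *: csres VU c + csres VU d.
Proof.
apply: csecP => x Vx /=; congr (_ + _).
have [W [Wx [s ->]]] := clsP (c x (VU x Vx)).
pose W' := opensI V W; have Wx' : W' x by [].
have l : W' `<=` V by move=> ? [].
rewrite -(cls_res (@opensIr _ V W : W' `<=` W) Wx Wx' s).
rewrite (cls_scale _ _ (subset_trans l VU)) (cls_scale _ _ l).
by rewrite (ores_comp VU l (subset_trans l VU)).
Qed.

Program Definition coker : psmod X :=
  @PsMod R X (fun U => csec U) csres _ _ csres_lin.
Next Obligation.
by move=> U UU c; apply: csecP => x Ux /=; congr (cval c); exact: Prop_irrelevance.
Qed.
Next Obligation.
by move=> U V W VU WV WU c; apply: csecP => x Wx /=; congr (cval c); exact: Prop_irrelevance.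
Qed.

End Cokernel.

(* dim_C H^0(X, G), as the supremum of the sizes of C-linearly independent
   families of global sections. *)
Definition h0 (R : realType) (X : fspace R) (G : psmod X) : \bar R :=
  ereal_sup [set k%:R%:E | k in [set k : nat |
    exists s : 'I_k -> G (opensT X), forall c : 'I_k -> Cplx R,
      \sum_i ocst (opensT X) (c i) *: s i = 0 -> forall i, c i = 0]].

(* For N open, this is holomorphy on N. *)
Definition holo (R : realType) (k : nat) (N : set 'rV[Cplx R]_k)
    (f : 'rV[Cplx R]_k -> Cplx R) : Prop :=
  forall z, N z -> differentiable f z.

(* f is locally on A the restriction of a holomorphic function of C^k. *)
Definition model_hol (R : realType) (k : nat) (A : set 'rV[Cplx R]_k)
    (f : 'rV[Cplx R]_k -> Cplx R) : Prop :=
  forall a, A a -> exists N g,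
    [/\ open N, N a, holo N g & forall z, N z -> A z -> f z = g z].

(* A is an analytic subset of an open set D of C^k, with equations on D. *)
Definition model_set (R : realType) (k : nat) (A : set 'rV[Cplx R]_k) : Prop :=
  exists (D : set 'rV[Cplx R]_k) (l : nat)
    (g : 'I_l -> 'rV[Cplx R]_k -> Cplx R),
  [/\ open D, forall i, holo D (g i) &
      A = [set z | D z /\ forall i, g i z = 0]].

(* p maps A homeomorphically onto B, and identifies the functions declared
   holomorphic by hS on the open subsets of A with those declared holomorphic
   by hT on their images. *)
Definition biholo (R : realType) (S T : topologicalType)
    (hS : set S -> (S -> Cplx R) -> Prop) (hT : set T -> (T -> Cplx R) -> Prop)
    (A : set S) (B : set T) (p : S -> T) : Prop :=
  exists q : T -> S,
    [/\ forall a, A a -> B (p a) /\ q (p a) = a,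
        forall b, B b -> A (q b) /\ p (q b) = b,
        {within A, continuous p}, {within B, continuous q} &
        forall (V : set S) (f : S -> Cplx R), open V -> V `<=` A ->
          (hS V f <-> hT (p @` V) (f \o q))].

Section ComplexSpaces.
Context {R : realType}.
Local Notation C := (Cplx R).

Definition complex_space (X : fspace R) : Prop :=
  hausdorff_space X /\
  forall x : X, exists (U : set X) (k : nat) (A : set 'rV[C]_k)
      (p : X -> 'rV[C]_k),
    [/\ open U, U x, model_set A & biholo (@hol R X) (@model_hol R k) U A p].

Definition complex_manifold (X : fspace R) (d : nat) : Prop :=
  hausdorff_space X /\
  forall x : X, exists (U : set X) (D : set 'rV[C]_d) (p : X -> 'rV[C]_d),
    [/\ open U, U x, open D & biholo (@hol R X) (@holo R d) U D p].

(* Every local ring O_{X,x} is an integrally closed domain.  A fraction f/g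
   integral over O_{X,x} satisfies, after clearing denominators,
   f^k + sum_(i < k) c_i f^i g^(k - i) = 0. *)
Definition normal_space (X : fspace R) : Prop :=
  complex_space X /\
  forall (x : X) (U : set X) (f g : X -> C), open U -> U x ->
    hol U f -> hol U g ->
  ((forall y, U y -> f y * g y = 0) ->
    exists V, [/\ open V, V x, V `<=` U &
      (forall y, V y -> f y = 0) \/ (forall y, V y -> g y = 0)]) /\
  (forall (k : nat) (c : 'I_k -> X -> C),
    (forall V, open V -> V x -> V `<=` U -> exists2 y, V y & g y != 0) ->
    (forall i, hol U (c i)) ->
    (forall y, U y ->
      f y ^+ k + \sum_(i < k) c i y * f y ^+ i * g y ^+ (k - i) = 0) ->
    exists V e, [/\ open V, V x, V `<=` U, hol V e &
      forall y, V y -> f y = e y * g y]).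

Section Subsets.
Variable X : fspace R.
Implicit Type Z : set X.

Definition analytic_subset Z : Prop :=
  forall x : X, exists (U : set X) (k : nat) (g : 'I_k -> X -> C),
    [/\ open U, U x, forall i, hol U (g i) &
        forall y, U y -> (Z y <-> forall i, g i y = 0)].

(* z is isolated in the zero set on Z of d holomorphic germs at z. *)
Definition cut_out Z (z : X) (d : nat) : Prop :=
  exists (U : set X) (g : 'I_d -> X -> C),
    [/\ open U, U z, forall i, hol U (g i) &
        forall y, (U y /\ Z y /\ forall i, g i y = 0) <-> y = z].

(* dim_z Z = d: the least number of germs cutting out z on Z. *)
Definition local_dim Z (z : X) (d : nat) : Prop :=
  cut_out Z z d /\ forall e, cut_out Z z e -> (d <= e)%N.

(* A reduced closed subspace is the same thing as an analytic subset. *)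
Definition compact_connected_curve Z : Prop :=
  [/\ analytic_subset Z, Z !=set0, compact Z, connected Z &
      forall z, Z z -> local_dim Z z 1].

(* n = dim_z X - dim_z Z, for X a manifold of dimension d. *)
Definition codim_in (d : nat) Z (n : nat) : Prop :=
  forall z, Z z -> exists2 e, local_dim Z z e & d = (e + n)%N.

End Subsets.

Definition proper_map (X Y : topologicalType) (p : X -> Y) : Prop :=
  forall K : set Y, compact K -> compact (p @^-1` K).

Definition contracts_to (X Y : fspace R) (Z : set X) (p : holmap X Y) (x : Y) :
    Prop :=
  [/\ normal_space Y, proper_map p,
      forall V : opens Y, bijective (@opull R X Y p V),
      p @` Z = [set x] &
      biholo (@hol R X) (@hol R Y) (~` Z) (~` [set x]) p].

End ComplexSpaces.

(* Main.v *)
From HB Require Import structures.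
Require Import Defs.
From mathcomp Require Import all_boot all_order all_algebra.
From mathcomp Require Import all_classical all_reals all_analysis.
From mathcomp Require Import complex ring lra.
Set Implicit Arguments.
Unset Strict Implicit.
Unset Printing Implicit Defensive.
Import Order.TTheory GRing.Theory Num.Theory numFieldNormedType.Exports.
Local Open Scope classical_set_scope.
Local Open Scope ring_scope.

(** The cokernel sheaf vanishes as soon as the bidual map of p_* F is onto over
    every open set ([coker_surj0]), and then so does its h^0.

    A section t of the bidual of p_* F over V acts on functionals of F off Z,
    because p is an isomorphism there, and returns functions off Z.  A curve of
    codimension at least 2 forces dim W >= 3, so that these functions extend
    uniquely over Z ([hol_eq_off], [hol_extend]) and t becomes a section of the
    bidual of F over p^-1(V) ([hat_sec]).  As F is reflexive, it comes from a
    section r of F over p^-1(V), that is, of p_* F over V.  The bidual map sends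
    r to t: both sides evaluate on a functional phi to functions that agree off
    Z, hence everywhere ([bidual_direct_image_surj]); passing between V and
    p^-1(V) uses O_W' = p_* O_W.

    The extension over Z is a Hartogs argument near a point z of Z.  Some
    equation g of Z does not vanish identically on a line z + C v
    ([direction]).  On that line a small closed contour around z misses g = 0,
    and so do its parallel translates near z; hence
      F(y) = average of f(y + b v) for b on the contour, weighted by db / b,
    is holomorphic near z ([avg_fdiff]).  By Cauchy's formula F = f at each y
    such that the whole disc y + b v misses Z, and those y are dense
    ([not_full_cut]), so F = f off Z ([local_extension]).

    Density is where dim Z = 1 < dim W - 1 enters.  If all lines parallel to v
    over an open set met Z, then at points where g vanishes along v to a fixed
    order j, the implicit function estimates ([graph_est]) for the j-th
    derivative of g along v would put the graph of a function of at least two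
    variables inside Z.  But near each of its points Z is cut down to this
    point by a single holomorphic function h, and a holomorphic function of two
    variables has no isolated zero ([no_isolated_zero]); this contradiction is
    [no_graph].

    The contour is the diamond |Re b| + |Im b| = r, because polygons need
    nothing beyond the theorem of Goursat for triangles ([goursat]) and an
    integral over [0,1].  That integral is the limit of dyadic midpoint
    averages ([mean]); only its linearity, its bounds, and its behaviour under
    halving and reversal of the interval are ever used.  Cauchy's formula
    ([cauchy_formula]) then gives Taylor expansions with explicit remainders
    ([taylor]), from which all later estimates follow. *)

(** * Real-valued norms and differentiability *)

Section RealNorm.
Context {R : realType}.
Local Notation C := (Cplx R).

Definition rc (x : R) : C := real_complex R x.

Lemma rcD x y : rc (x + y) = rc x + rc y. Proof. exact: rmorphD. Qed.
Lemma rcB x y : rc (x - y) = rc x - rc y. Proof. exact: rmorphB. Qed.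
Lemma rcM x y : rc (x * y) = rc x * rc y. Proof. exact: rmorphM. Qed.
Lemma rc0 : rc 0 = 0. Proof. by []. Qed.
Lemma rc1 : rc 1 = 1. Proof. by []. Qed.
Lemma rc_nat n : rc n%:R = n%:R. Proof. exact: rmorph_nat. Qed.
Lemma rcV x : rc x^-1 = (rc x)^-1. Proof. exact: fmorphV. Qed.
Lemma rc_le x y : (rc x <= rc y) = (x <= y). Proof. exact: lecR. Qed.
Lemma rc_lt x y : (rc x < rc y) = (x < y). Proof. exact: ltcR. Qed.
Lemma rc_eq0 x : (rc x == 0) = (x == 0). Proof. exact: fmorph_eq0. Qed.

(** Norms take their values in C, whose order is partial; their real parts live
    in the ordered field R, where inequalities can be decided by linear
    arithmetic. *)
Definition nr {V : normedZmodType C} (x : V) : R := complex.Re (`|x| : R[i]).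

Lemma nrE {V : normedZmodType C} (x : V) : rc (nr x) = `|x|.
Proof. by rewrite /rc /nr RRe_real ?ger0_real ?normr_ge0. Qed.

Section Zmod.
Context {V : normedZmodType C}.
Implicit Types x y : V.

Lemma nr_le x (r : R) : (nr x <= r) = (`|x| <= rc r).
Proof. by rewrite -nrE rc_le. Qed.
Lemma nr_lt x (r : R) : (nr x < r) = (`|x| < rc r).
Proof. by rewrite -nrE rc_lt. Qed.
Lemma nr_ge0 x : 0 <= nr x.
Proof. by rewrite -rc_le nrE; exact: normr_ge0. Qed.
Lemma nr0 : nr (0 : V) = 0.
Proof. by apply: complexI; rewrite -/(rc _) nrE normr0. Qed.
Lemma nr_eq0 x : (nr x == 0) = (x == 0).
Proof. by rewrite -rc_eq0 nrE normr_eq0. Qed.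
Lemma nr_gt0 x : (0 < nr x) = (x != 0).
Proof. by rewrite lt0r nr_eq0 nr_ge0 andbT. Qed.
Lemma nrD x y : nr (x + y) <= nr x + nr y.
Proof. by rewrite nr_le rcD !nrE ler_normD. Qed.
Lemma nrN x : nr (- x) = nr x.
Proof. by rewrite /nr normrN. Qed.
Lemma nrBC x y : nr (x - y) = nr (y - x).
Proof. by rewrite -nrN opprB. Qed.
Lemma nrB x y : nr (x - y) <= nr x + nr y.
Proof. by rewrite -(nrN y) nrD. Qed.
Lemma nr_tri z x y : nr (x - y) <= nr (x - z) + nr (z - y).
Proof. by apply: le_trans (nrD _ _); rewrite addrA subrK. Qed.
Lemma nr_sub_ge x y : nr x - nr y <= nr (x - y).
Proof. by have := nrD (x - y) y; rewrite subrK lerBlDr. Qed.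
End Zmod.

Lemma nrM (x y : C) : nr (x * y) = nr x * nr y.
Proof. by apply: complexI; rewrite -/(rc _) -/(rc _) rcM !nrE normrM. Qed.
Lemma nrV (x : C) : nr x^-1 = (nr x)^-1.
Proof. by apply: complexI; rewrite -/(rc _) -/(rc _) rcV !nrE normfV. Qed.
Lemma nr1 : nr (1 : C) = 1.
Proof. by apply: complexI; rewrite -/(rc _) nrE normr1. Qed.
Lemma nrX (x : C) n : nr (x ^+ n) = nr x ^+ n.
Proof. by elim: n => [|n IH]; rewrite ?expr0 ?nr1 // !exprS nrM IH. Qed.
Lemma nr_rc (x : R) : nr (rc x) = `|x|.
Proof.
apply: complexI; rewrite -/(rc _) nrE /rc normc_def /= expr0n /= addr0.
by rewrite sqrtr_sqr.
Qed.
Lemma nrZ (V : normedModType C) (a : C) (x : V) : nr (a *: x) = nr a * nr x.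
Proof. by apply: complexI; rewrite -/(rc _) -/(rc _) rcM !nrE normrZ. Qed.

Lemma nr_small (V : normedZmodType C) (x : V) :
  (forall e : R, 0 < e -> nr x <= e) -> x = 0.
Proof.
move=> H; apply/eqP; rewrite -nr_eq0 eq_le nr_ge0 andbT leNgt; apply/negP => x0.
by have := H (nr x / 2) (divr_gt0 x0 (ltr0Sn _ _)); have := x0; lra.
Qed.

Lemma nbhs_nr (V : normedModType C) (x : V) (P : set V) :
  nbhs x P <-> exists2 r : R, 0 < r & forall y, nr (y - x) < r -> P y.
Proof.
rewrite -nbhs_ballE; split=> -[r].
  rewrite /= => r0 H; exists (complex.Re (r : R[i])).
    by rewrite -rc_lt /rc RRe_real // gtr0_real.
  move=> y; rewrite nr_lt /rc RRe_real ?gtr0_real // => yr.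
  by apply: H; rewrite -ball_normE /ball_ /= distrC.
move=> r0 H; exists (rc r); first by rewrite /= -rc0 rc_lt.
by move=> y; rewrite -ball_normE /ball_ /= distrC -nr_lt; exact: H.
Qed.

Lemma open_nr (V : normedModType C) (A : set V) :
  open A <-> forall x, A x -> exists2 r : R, 0 < r & forall y, nr (y - x) < r -> A y.
Proof.
rewrite openE; split=> H x Ax; first by apply/nbhs_nr/H.
by rewrite /interior; apply/nbhs_nr/H.
Qed.

Lemma open_nball (V : normedModType C) (x : V) (r : R) : open [set y | nr (y - x) < r].
Proof.
apply/open_nr => y /= yr; exists (r - nr (y - x)); first lra.
by move=> w wy; have := nr_tri y w x; lra.
Qed.

(** Frechet differentiability with the derivative as a bare function and an
    epsilon-delta bound over R, the form in which derivatives are estimated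
    below. *)
Definition fdiff (V : normedModType C) (f : V -> C) (z : V) (L : V -> C) : Prop :=
  [/\ forall a x y, L (a *: x + y) = a * L x + L y,
      exists2 K : R, 0 <= K & forall x, nr (L x) <= K * nr x &
      forall e : R, 0 < e -> exists2 d : R, 0 < d &
        forall h, nr h < d -> nr (f (z + h) - f z - L h) <= e * nr h].

Lemma differentiable_fdiff (V : normedModType C) (f : V -> C) (z : V) :
  differentiable f z -> fdiff f z ('d f z).
Proof.
move=> df; split.
- by move=> a x y; rewrite linearP.
- have /linear_bounded_continuous/linear_boundedP[M [Mr HM]] := diff_continuous df.
  (* any real number above the given bound M *)
  have MM : M < rc (`|complex.Re (M : R[i])| + 1).
    rewrite -[M in M < _](RRe_real Mr) -/(rc _) rc_lt.
    by have := ler_norm (complex.Re (M : R[i])); lra.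
  exists (`|complex.Re (M : R[i])| + 1) => [|x].
    by have := normr_ge0 (complex.Re (M : R[i])); lra.
  by rewrite nr_le rcM nrE; exact: (HM _ MM x).
- move=> e e0; have /eqaddoP/(_ (rc e)) := diff_locally df.
  rewrite -{1}rc0 rc_lt => /(_ e0) /nbhs_nr[d d0 H]; exists d => // h hd.
  have := H h; rewrite subr0 => /(_ hd) /=.
  rewrite nr_le rcM nrE opprD addrA.
  by rewrite ![(_ - _) h]/(_ h - _ h) /= /cst /= [z + h]addrC.
Qed.

Lemma fdiff_differentiable (V : normedModType C) (f : V -> C) (z : V) L :
  fdiff f z L -> differentiable f z.
Proof.
move=> [Llin [K K0 LK] Lf].
pose L' : {linear V -> C} := HB.pack L (GRing.isLinear.Build _ _ _ _ L Llin).
have cL : continuous L'.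
  apply/linear_bounded_continuous/linear_boundedP; exists (rc K); split.
    by rewrite ger0_real // -rc0 rc_le.
  move=> M KM x; apply: le_trans (_ : rc (K * nr x) <= _).
    by rewrite -nr_le; exact: LK.
  by rewrite rcM nrE ler_wpM2r // ltW.
have oL : f \o shift z = cst (f z) + L' +o_ 0 id.
  apply/eqaddoP => e e0; have er : e = rc (complex.Re (e : R[i])).
    by rewrite /rc RRe_real // gtr0_real.
  have [|d d0 H] := Lf (complex.Re (e : R[i])); first by rewrite -rc_lt -er.
  apply/nbhs_nr; exists d => // h; rewrite subr0 => /H.
  rewrite nr_le rcM nrE -er => Hh /=.
  suff -> : (f \o shift z - (cst (f z) + L')) h = f (z + h) - f z - L h by [].
  by rewrite -[LHS]/(f (h + z) - (f z + L h)) [h + z]addrC opprD addrA.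
by apply/diff_locallyP; rewrite (diff_unique cL oL).
Qed.
End RealNorm.

(** * The mean of a continuous function on [0,1] *)

Section Mean.
Context {R : realType}.
Local Notation C := (Cplx R).
Implicit Types (g h : R -> C) (z : C) (t s : R).

Definition cRe (z : C) : R := complex.Re (z : R[i]).
Definition cIm (z : C) : R := complex.Im (z : R[i]).

Lemma cReD (x y : C) : cRe (x + y) = cRe x + cRe y.
Proof. by case: x y => a b [c d]. Qed.
Lemma cReB (x y : C) : cRe (x - y) = cRe x - cRe y.
Proof. by case: x y => a b [c d]. Qed.
Lemma cImB (x y : C) : cIm (x - y) = cIm x - cIm y.
Proof. by case: x y => a b [c d]. Qed.
Lemma cRe_rcM (x : R) (y : C) : cRe (rc x * y) = x * cRe y.
Proof. by case: y => c d; rewrite /cRe /rc /= mul0r subr0. Qed.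

Lemma cRe_le (z : C) : `|cRe z| <= nr z.
Proof. by rewrite -rc_le nrE; exact: (normc_ge_Re (z : R[i])). Qed.

Definition ci : C := Complex 0 1 : R[i].

Lemma ci2 : ci * ci = -1.
Proof. by rewrite -expr2; exact: sqr_i. Qed.

Lemma nr_ci : nr ci = 1.
Proof.
apply/eqP; rewrite -(@eqrXn2 _ 2) ?nr_ge0 //; apply/eqP.
by rewrite -nrX expr2 ci2 nrN nr1 expr1n.
Qed.

Lemma cReIm (z : C) : z = rc (cRe z) + ci * rc (cIm z).
Proof. exact: (complexE (z : R[i])). Qed.

Lemma cIm_le (z : C) : `|cIm z| <= nr z.
Proof.
have := cRe_le (- ci * z); rewrite nrM nrN nr_ci mul1r; congr (_ <= _); congr (`|_|).
by case: z => a b; rewrite /cRe /cIm /ci /=; ring.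
Qed.

Lemma nr_le_ReIm (z : C) : nr z <= `|cRe z| + `|cIm z|.
Proof.
by rewrite {1}(cReIm z); apply: le_trans (nrD _ _) _; rewrite nrM nr_ci mul1r !nr_rc.
Qed.

Lemma half_pow_small (e : R) : 0 < e -> exists n, (1 / 2) ^+ n < e.
Proof.
move=> e0; exists (Num.Def.archi_bound e^-1).
have := archi_boundP (ltW (_ : 0 < e^-1)); rewrite invr_gt0 => /(_ e0).
set n := Num.Def.archi_bound _ => en.
rewrite div1r exprVn invf_plt ?posrE ?exprn_gt0 //; apply: lt_trans en _.
by rewrite -natrX ltr_nat; exact: ltn_expl.
Qed.

Definition limc (u : nat -> C) (l : C) :=
  forall e : R, 0 < e -> exists N, forall n, (N <= n)%N -> nr (u n - l) <= e.

Lemma cauchyR (u : nat -> R) :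
  (forall e, 0 < e -> exists N, forall n m, (N <= n)%N -> (N <= m)%N -> `|u n - u m| <= e) ->
  exists l, forall e, 0 < e -> exists N, forall n, (N <= n)%N -> `|u n - l| <= e.
Proof.
move=> cu; pose S := [set x | exists N, forall n, (N <= n)%N -> x <= u n].
exists (sup S) => e e0; have e2 : 0 < e / 2 by lra.
have [N HN] := cu _ e2; exists N => n Nn.
have low m : (N <= m)%N -> u N - e / 2 <= u m <= u N + e / 2.
  by move=> /HN/(_ (leqnn N)); rewrite ler_distl.
have SN : S (u N - e / 2) by exists N => m /low/andP[].
have ubS : ubound S (u N + e / 2).
  move=> x [M HM]; have := HM (maxn N M); rewrite leq_maxr => /(_ isT) h.
  by have := low (maxn N M); rewrite leq_maxl => /(_ isT) /andP[_]; lra.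
have l1 : u N - e / 2 <= sup S by apply: ub_le_sup => //; exists (u N + e / 2).
have l2 : sup S <= u N + e / 2 by apply: ge_sup => //; exists (u N - e / 2).
by have /andP[] := low _ Nn; rewrite ler_distl; lra.
Qed.

Lemma cauchyC (u : nat -> C) :
  (forall e : R, 0 < e -> exists N, forall n m, (N <= n)%N -> (N <= m)%N -> nr (u n - u m) <= e) ->
  exists l, limc u l.
Proof.
move=> cu.
have [a Ha] : exists l, forall e, 0 < e -> exists N, forall n, (N <= n)%N -> `|cRe (u n) - l| <= e.
  apply: cauchyR => e /cu[N HN]; exists N => n m Nn Nm.
  by rewrite -cReB; apply: le_trans (cRe_le _) _; exact: HN.
have [b Hb] : exists l, forall e, 0 < e -> exists N, forall n, (N <= n)%N -> `|cIm (u n) - l| <= e.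
  apply: cauchyR => e /cu[N HN]; exists N => n m Nn Nm.
  by rewrite -cImB; apply: le_trans (cIm_le _) _; exact: HN.
exists (rc a + ci * rc b) => e e0; have e2 : 0 < e / 2 by lra.
have [N HN] := Ha _ e2; have [M HM] := Hb _ e2; exists (maxn N M) => n.
rewrite geq_max => /andP[/HN h1 /HM h2]; apply: le_trans (nr_le_ReIm _) _.
rewrite cReB cImB.
have -> : cRe (rc a + ci * rc b) = a by rewrite /cRe /=; ring.
have -> : cIm (rc a + ci * rc b) = b by rewrite /cIm /=; ring.
lra.
Qed.

Lemma limc_uniq u a b : limc u a -> limc u b -> a = b.
Proof.
move=> Ha Hb; apply/subr0_eq/nr_small => e e0; have e2 : 0 < e / 2 by lra.
have [N HN] := Ha _ e2; have [M HM] := Hb _ e2.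
have := HN (maxn N M) (leq_maxl _ _); have := HM (maxn N M) (leq_maxr _ _).
by have := nr_tri (u (maxn N M)) a b; rewrite (nrBC a (u _)); lra.
Qed.

Lemma limc_le u a (c : C) B : limc u a -> (forall n, nr (u n - c) <= B) -> nr (a - c) <= B.
Proof.
move=> Ha Hu; rewrite leNgt; apply/negP => h.
have [|N /(_ _ (leqnn N)) HN] := Ha ((nr (a - c) - B) / 2); first lra.
by have := nr_tri (u N) a c; have := Hu N; rewrite (nrBC a (u _)); lra.
Qed.

Lemma limc_ext u v a : (forall n, u n = v n) -> limc u a -> limc v a.
Proof. by move=> /funext ->. Qed.

Lemma limcD u v a b : limc u a -> limc v b -> limc (fun n => u n + v n) (a + b).
Proof.
move=> Ha Hb e e0; have e2 : 0 < e / 2 by lra.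
have [N HN] := Ha _ e2; have [M HM] := Hb _ e2; exists (maxn N M) => n.
rewrite geq_max => /andP[/HN h1 /HM h2].
by rewrite opprD addrACA; apply: le_trans (nrD _ _) _; lra.
Qed.

Lemma limcZ u a (k : C) : limc u a -> limc (fun n => k * u n) (k * a).
Proof.
move=> Ha e e0; have [|N HN] := Ha (e / (nr k + 1)).
  by rewrite divr_gt0 //; have := nr_ge0 k; lra.
exists N => n /HN; rewrite -mulrBr nrM => h.
have k0 := nr_ge0 k; apply: le_trans (_ : (nr k + 1) * nr (u n - a) <= _).
  by rewrite ler_wpM2r ?nr_ge0 //; lra.
by rewrite mulrC -ler_pdivlMr //; lra.
Qed.

Lemma limc_shift u a : limc u a -> limc (fun n => u n.+1) a.
Proof. by move=> Ha e /Ha[N HN]; exists N => n Nn; apply: HN; exact: leqW. Qed.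

(** Compactness of [0,1] as an induction principle: a property of intervals
    that holds for all short ones and survives gluing two halves holds for the
    whole.  Otherwise it would fail on nested halves, down to a point. *)
Lemma bisect (P : R -> R -> Prop) :
  (forall a b, P a ((a + b) / 2) -> P ((a + b) / 2) b -> P a b) ->
  (forall t, 0 <= t <= 1 -> exists2 d, 0 < d &
     forall a b, 0 <= a -> a <= t -> t <= b -> b <= 1 -> b - a < d -> P a b) ->
  P 0 1.
Proof.
move=> Pcat Ploc; apply: contrapT => nP.
pose step (ab : R * R) := let m := (ab.1 + ab.2) / 2 in
  if `[< P ab.1 m >] then (m, ab.2) else (ab.1, m).
pose s n := iter n step (0, 1).
have sS n : s n.+1 = step (s n) by [].
have Ps n : ~ P (s n).1 (s n).2.
  elim: n => [//|n IH]; rewrite sS /step; case: asboolP => //= H1 H2.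
  by apply: IH; exact: Pcat.
have sd n : (s n).2 - (s n).1 = (1 / 2) ^+ n.
  elim: n => [|n IH]; first by rewrite /= expr0 subr0.
  by rewrite exprS -IH sS /step; case: asboolP => _ /=; field.
have sle n : (s n).1 <= (s n).2 by rewrite -subr_ge0 sd exprn_ge0 //; lra.
have mono n k : (s n).1 <= (s (k + n)%N).1 /\ (s (k + n)%N).2 <= (s n).2.
  elim: k => [//|k [IH1 IH2]]; rewrite addSn sS /step; have := sle (k + n)%N.
  by case: asboolP => _ /=; lra.
have cross n m : (s n).1 <= (s m).2.
  have [h1 _] := mono n m; have [_ h2] := mono m n.
  by rewrite addnC in h2; have := sle (m + n)%N; lra.
pose A := [set (s n).1 | n in [set: nat]].
have A0 : A !=set0 by exists (s 0).1, 0%N.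
have t1 n : (s n).1 <= sup A.
  apply: ub_le_sup; last by exists n.
  by exists (s 0).2 => _ [m _ <-]; exact: cross.
have t2 n : sup A <= (s n).2 by apply: ge_sup => // _ [m _ <-]; exact: cross.
have [|d d0 H] := Ploc (sup A); first by rewrite (t1 0%N) (t2 0%N).
have [n Hn] := half_pow_small d0; apply: (Ps n); apply: H => //; last by rewrite sd.
- by have [] := mono 0%N n; rewrite addn0.
- by have [] := mono 0%N n; rewrite addn0.
Qed.

(** The midpoint rule on the 2^n dyadic subintervals, by recursion on the first
    subdivision so that all its properties are immediate inductions. *)
Fixpoint dyadic n g : C := if n is n'.+1 then
  rc (1 / 2) * (dyadic n' (fun t => g (t / 2)) + dyadic n' (fun t => g ((1 + t) / 2)))
  else g (1 / 2).

Lemma dyadic_ext n g h : (forall t, 0 <= t <= 1 -> g t = h t) -> dyadic n g = dyadic n h.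
Proof.
elim: n g h => [|n IH] g h gh /=; first by apply: gh; lra.
by congr (_ * (_ + _)); apply: IH => t t01; apply: gh; lra.
Qed.

Lemma dyadicD n g h : dyadic n (fun t => g t + h t) = dyadic n g + dyadic n h.
Proof. by elim: n g h => [|n IH] g h //=; rewrite !IH; ring. Qed.

Lemma dyadicZ n k g : dyadic n (fun t => k * g t) = k * dyadic n g.
Proof. by elim: n g => [|n IH] g //=; rewrite !IH; ring. Qed.

Lemma half_half : rc (1 / 2 : R) + rc (1 / 2) = 1.
Proof. by rewrite -rcD -rc1; congr rc; field. Qed.

Lemma dyadic_cst n k : dyadic n (fun=> k) = k.
Proof. by elim: n => [|n /= ->] //; rewrite mulrDr -mulrDl half_half mul1r. Qed.

Lemma dyadic_le n g (B : R) :
  (forall t, 0 <= t <= 1 -> nr (g t) <= B) -> nr (dyadic n g) <= B.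
Proof.
elim: n g => [|n IH] g gB /=; first by apply: gB; lra.
rewrite nrM nr_rc ger0_norm; last lra.
have h1 : nr (dyadic n (fun t => g (t / 2))) <= B by apply: IH => t t01; apply: gB; lra.
have h2 : nr (dyadic n (fun t => g ((1 + t) / 2))) <= B by apply: IH => t t01; apply: gB; lra.
by have := nrD (dyadic n (fun t => g (t / 2))) (dyadic n (fun t => g ((1 + t) / 2))); lra.
Qed.

Lemma dyadic_near n g c (B : R) :
  (forall t, 0 <= t <= 1 -> nr (g t - c) <= B) -> nr (dyadic n g - c) <= B.
Proof. by move=> /(dyadic_le n); rewrite (dyadicD _ g (fun=> - c)) dyadic_cst. Qed.

Lemma dyadic_Re_ge n g (m : R) :
  (forall t, 0 <= t <= 1 -> m <= cRe (g t)) -> m <= cRe (dyadic n g).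
Proof.
elim: n g => [|n IH] g gB /=; first by apply: gB; lra.
rewrite cRe_rcM cReD.
have h1 : m <= cRe (dyadic n (fun t => g (t / 2))) by apply: IH => t t01; apply: gB; lra.
have h2 : m <= cRe (dyadic n (fun t => g ((1 + t) / 2))) by apply: IH => t t01; apply: gB; lra.
lra.
Qed.

Lemma dyadic_rev n g : dyadic n (fun t => g (1 - t)) = dyadic n g.
Proof.
elim: n g => [|n IH] g /=; first by congr g; field.
rewrite -(IH (fun t => g (t / 2))) -(IH (fun t => g ((1 + t) / 2))) addrC.
by congr (_ * (_ + _)); apply: dyadic_ext => t _; congr g; field.
Qed.

(** Oscillation at most e on each of the 2^n dyadic subintervals. *)
Fixpoint osc n (e : R) g : Prop := if n is n'.+1 then
  osc n' e (fun t => g (t / 2)) /\ osc n' e (fun t => g ((1 + t) / 2))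
  else forall s t, 0 <= s <= 1 -> 0 <= t <= 1 -> nr (g s - g t) <= e.

Lemma osc_ext n e g h : (forall t, g t = h t) -> osc n e g -> osc n e h.
Proof. by move=> /funext ->. Qed.

Lemma oscS n e g : osc n e g -> osc n.+1 e g.
Proof.
elim: n g => [|n IH] g; first by move=> H; split=> s t s01 t01; apply: H; lra.
by move=> [H1 H2]; split; apply: IH.
Qed.

Lemma osc_leq n m e g : (n <= m)%N -> osc n e g -> osc m e g.
Proof.
by move=> /subnK <-; elim: (m - n)%N => [//|k IH] /IH; rewrite addSn; exact: oscS.
Qed.

(** Refining the subdivision moves each value by at most the oscillation; this
    makes the midpoint averages a Cauchy sequence. *)
Lemma osc_dyadic n e g : osc n e g -> forall m, (n <= m)%N -> nr (dyadic m g - dyadic n g) <= e.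
Proof.
move=> H m /subnK <-; move: (m - n)%N => {}m.
elim: n g H => [|n IH] g; first by move=> H; apply: dyadic_near => t t01; apply: H; lra.
move=> [H1 H2]; rewrite addnS /= -mulrBr nrM nr_rc ger0_norm; last lra.
have := IH _ H1; have := IH _ H2; rewrite opprD addrACA.
set a := _ - _; set b := _ - _ => hb ha.
by have := nrD b a; lra.
Qed.

Definition ctsI g := forall t, 0 <= t <= 1 -> forall e : R, 0 < e ->
  exists2 d : R, 0 < d & forall s, 0 <= s <= 1 -> `|s - t| < d -> nr (g s - g t) <= e.

Lemma ctsI_osc g : ctsI g -> forall e, 0 < e -> exists n, osc n e g.
Proof.
move=> cg e e0.
have : exists n, osc n e (fun t => g (0 + t * (1 - 0))).
  apply: (bisect (P := fun a b => exists n, osc n e (fun t => g (a + t * (b - a))))).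
    move=> a b [n Hn] [m Hm]; exists (maxn n m).+1; split.
      by apply: osc_ext (osc_leq (leq_maxl n m) Hn) => t; congr g; field.
    by apply: osc_ext (osc_leq (leq_maxr n m) Hm) => t; congr g; field.
  move=> t t01; have [|d d0 H] := cg t t01 (e / 2); first lra.
  exists d => // a b a0 at_ tb b1 bad; exists 0%N => s s' s01 s01'.
  have K x : 0 <= x <= 1 -> nr (g (a + x * (b - a)) - g t) <= e / 2.
    move=> x01; have h1 : 0 <= x * (b - a) by rewrite mulr_ge0 //; lra.
    have h2 : x * (b - a) <= b - a by rewrite ler_piMl //; lra.
    by apply: H; [lra|rewrite ltr_norml; lra].
  by have := nr_tri (g t) (g (a + s * (b - a))) (g (a + s' * (b - a)));
    have := K _ s01; have := K _ s01'; rewrite (nrBC (g t)); lra.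
by move=> [n Hn]; exists n; apply: osc_ext Hn => t; congr g; ring.
Qed.

(** The integral over [0,1]; the default 0 concerns only functions for which
    the midpoint averages diverge, which excludes continuous ones. *)
Definition mean g : C := xget 0 [set l | limc (fun n => dyadic n g) l].

Lemma mean_lim g : ctsI g -> limc (fun n => dyadic n g) (mean g).
Proof.
move=> cg; have [l Hl] : exists l, limc (fun n => dyadic n g) l.
  apply: cauchyC => e e0; have e2 : 0 < e / 2 by lra.
  have [n Hn] := ctsI_osc cg e2; exists n => p q np nq.
  have := osc_dyadic Hn np; have := osc_dyadic Hn nq.
  by have := nr_tri (dyadic n g) (dyadic p g) (dyadic q g); rewrite (nrBC (dyadic n g)); lra.
by rewrite /mean; case: xgetP => [y _ //|/(_ l)].
Qed.

Lemma mean_uniq g l : limc (fun n => dyadic n g) l -> mean g = l.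
Proof.
move=> Hl; rewrite /mean; case: xgetP => [y _ Hy|/(_ l) //]; exact: limc_uniq Hy Hl.
Qed.

Lemma mean_ext g h : (forall t, 0 <= t <= 1 -> g t = h t) -> mean g = mean h.
Proof.
move=> gh; rewrite /mean; congr xget; apply: funext => l; congr limc.
by apply: funext => n; exact: dyadic_ext.
Qed.

Lemma meanD g h : ctsI g -> ctsI h -> mean (fun t => g t + h t) = mean g + mean h.
Proof.
move=> cg ch; apply: mean_uniq; apply: limc_ext (limcD (mean_lim cg) (mean_lim ch)).
by move=> n; rewrite dyadicD.
Qed.

Lemma meanZ k g : ctsI g -> mean (fun t => k * g t) = k * mean g.
Proof.
move=> cg; apply: mean_uniq; apply: limc_ext (limcZ k (mean_lim cg)).
by move=> n; rewrite dyadicZ.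
Qed.

Lemma mean_cst k : mean (fun=> k) = k.
Proof. by apply: mean_uniq => e e0; exists 0%N => n _; rewrite dyadic_cst subrr nr0 ltW. Qed.

Lemma mean_le g (B : R) : ctsI g ->
  (forall t, 0 <= t <= 1 -> nr (g t) <= B) -> nr (mean g) <= B.
Proof.
move=> cg gB; rewrite -[mean g]subr0; apply: limc_le (mean_lim cg) _ => n.
by rewrite subr0; exact: dyadic_le.
Qed.

Lemma mean_Re_ge g (m : R) : ctsI g ->
  (forall t, 0 <= t <= 1 -> m <= cRe (g t)) -> m <= cRe (mean g).
Proof.
move=> cg gm; rewrite leNgt; apply/negP => h.
have [|N /(_ _ (leqnn N)) HN] := mean_lim cg (e := (m - cRe (mean g)) / 2); first lra.
have := le_trans (cRe_le _) HN; rewrite cReB; have := dyadic_Re_ge N gm.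
by rewrite ler_norml; lra.
Qed.

Lemma mean_rev g : mean (fun t => g (1 - t)) = mean g.
Proof.
by rewrite /mean; congr xget; apply: funext => l; congr limc; apply: funext => n; exact: dyadic_rev.
Qed.

Lemma ctsI_comp g (a b : R) : ctsI g -> (0 <= a) -> (0 <= b) -> (a + b <= 1) ->
  ctsI (fun t => g (a + b * t)).
Proof.
move=> cg a0 b0 ab1 t t01 e e0.
have aff x : 0 <= x <= 1 -> 0 <= a + b * x <= 1.
  move=> x01; have : 0 <= b * x by rewrite mulr_ge0 //; lra.
  by have : b * x <= b; [rewrite ler_piMr //; lra|lra].
have [d d0 H] := cg _ (aff t t01) e e0; exists d => // s s01 st.
apply: H; first exact: aff.
rewrite (_ : _ - _ = b * (s - t)); last ring.
by rewrite normrM ger0_norm //; apply: le_lt_trans st; rewrite ler_piMl //; lra.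
Qed.

Lemma mean_half g : ctsI g ->
  mean g = rc (1 / 2) * (mean (fun t => g (t / 2)) + mean (fun t => g ((1 + t) / 2))).
Proof.
have ctsI_ext h1 h2 : (forall t, h1 t = h2 t) -> ctsI h1 -> ctsI h2 by move=> /funext ->.
move=> cg; apply: limc_uniq (limc_shift (mean_lim cg)) _ => /=; apply: limcZ; apply: limcD.
  apply/mean_lim/(ctsI_ext (fun t => g (0 + 1 / 2 * t))) => [t|]; first by congr g; ring.
  by apply: ctsI_comp => //; lra.
apply/mean_lim/(ctsI_ext (fun t => g (1 / 2 + 1 / 2 * t))) => [t|]; first by congr g; field.
by apply: ctsI_comp => //; lra.
Qed.

Lemma ctsI_id : ctsI (fun t => rc t).
Proof. by move=> t t01 e e0; exists e => // s _ st; rewrite -rcB nr_rc ltW. Qed.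

Lemma ctsI_cst k : ctsI (fun=> k).
Proof. by move=> t t01 e e0; exists 1 => // s _ _; rewrite subrr nr0 ltW. Qed.

(** The symmetry t -> 1 - t determines this mean, with no computation. *)
Lemma mean_id : mean (fun t => rc t) = rc (1 / 2).
Proof.
have : mean (fun t => rc (1 - t)) = 1 - mean (fun t => rc t).
  rewrite -{1}(mean_cst 1) -mulN1r -(meanZ (-1) ctsI_id) -meanD; last 2 first.
  - exact: ctsI_cst.
  - move=> t t01 e e0; exists e => // s _ st.
    by rewrite -mulrBr nrM nrN nr1 mul1r -rcB nr_rc ltW.
  by apply: mean_ext => t _; rewrite rcB mulN1r.
rewrite mean_rev => e; have {}e : mean (fun t => rc t) + mean (fun t => rc t) = 1.
  by rewrite {1}e subrK.
by rewrite -[LHS]mul1r -half_half mulrDl -mulrDr e mulr1.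
Qed.
End Mean.

(** * Goursat's theorem for triangles *)

Section Goursat.
Context {R : realType}.
Local Notation C := (Cplx R).
Local Notation ci := (@ci R).
Implicit Types (f g : C -> C) (a b c z w : C) (O : C -> Prop).

Definition cts_on O f := forall z, O z -> forall e : R, 0 < e ->
  exists2 d : R, 0 < d & forall w, O w -> nr (w - z) < d -> nr (f w - f z) <= e.

(** The derivative relative to O: most of the sets O below are closed regions,
    whose boundary points must be allowed as base points. *)
Definition cdiff O f z (l : C) := forall e : R, 0 < e ->
  exists2 d : R, 0 < d &
    forall w, O w -> nr (w - z) < d -> nr (f w - f z - l * (w - z)) <= e * nr (w - z).

Definition holC O f := forall z, O z -> exists l, cdiff O f z l.

Definition convexO O := forall z w (t : R), O z -> O w -> 0 <= t <= 1 ->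
  O (z + rc t * (w - z)).

Definition closedO O := forall z,
  (forall e : R, 0 < e -> exists2 w, O w & nr (w - z) <= e) -> O z.

Definition mid a b : C := rc (1 / 2) * (a + b).

Definition seg a b f : C := (b - a) * mean (fun t => f (a + rc t * (b - a))).

Lemma cdiff_cts O f z l : cdiff O f z l -> forall e : R, 0 < e ->
  exists2 d : R, 0 < d & forall w, O w -> nr (w - z) < d -> nr (f w - f z) <= e.
Proof.
move=> Hf e e0; have [d d0 H] := Hf 1 ltr01; have l0 := nr_ge0 l.
exists (Num.min d (e / (nr l + 1))) => [|w Ow].
  by rewrite lt_min d0 divr_gt0 //; lra.
rewrite lt_min => /andP[/(H _ Ow)]; rewrite mul1r => h.
rewrite ltr_pdivlMr; last lra.
have := nrD (f w - f z - l * (w - z)) (l * (w - z)); rewrite subrK nrM; lra.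
Qed.

Lemma holC_cts O f : holC O f -> cts_on O f.
Proof. by move=> Hf z /Hf[l /cdiff_cts]. Qed.

Lemma path_ctsI O f (p : R -> C) (K : R) :
  cts_on O f -> (forall t, 0 <= t <= 1 -> O (p t)) ->
  (forall s t, nr (p s - p t) <= K * `|s - t|) -> ctsI (fun t => f (p t)).
Proof.
move=> cf Op Kp t t01 e e0; have [d d0 H] := cf _ (Op t t01) e e0.
have K0 : 0 <= K by have := le_trans (nr_ge0 _) (Kp 1 0); rewrite subr0 normr1 mulr1.
exists (d / (K + 1)) => [|s s01]; first by rewrite divr_gt0 //; lra.
rewrite ltr_pdivlMr; last lra.
move=> h; apply: H; [exact: Op|apply: le_lt_trans (Kp _ _) _].
by have := normr_ge0 (s - t); lra.
Qed.

Lemma ctsIZ k (g : R -> C) : ctsI g -> ctsI (fun t => k * g t).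
Proof.
move=> cg t t01 e e0; have k0 := nr_ge0 k.
have [|d d0 H] := cg t t01 (e / (nr k + 1)); first by rewrite divr_gt0 //; lra.
exists d => // s s01 /(H _ s01); rewrite -mulrBr nrM => h.
apply: le_trans (_ : (nr k + 1) * (e / (nr k + 1)) <= _); last first.
  by rewrite mulrC divfK //; lra.
by apply: ler_pM; rewrite ?nr_ge0 //; lra.
Qed.

Lemma seg_lip a b (s t : R) :
  nr (a + rc s * (b - a) - (a + rc t * (b - a))) <= nr (b - a) * `|s - t|.
Proof.
rewrite (_ : _ - _ = rc (s - t) * (b - a)); last by rewrite rcB; ring.
by rewrite nrM nr_rc mulrC.
Qed.

Lemma seg_ctsI O f a b : convexO O -> O a -> O b -> cts_on O f ->
  ctsI (fun t => f (a + rc t * (b - a))).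
Proof.
move=> cO Oa Ob cf; apply: path_ctsI cf _ (seg_lip a b) => t t01; exact: cO.
Qed.

Lemma seg_rev a b f : seg b a f = - seg a b f.
Proof.
rewrite /seg -mulNr opprB; congr (_ * _).
by rewrite -mean_rev; apply: mean_ext => t _; congr f; rewrite rcB; ring.
Qed.

Lemma rc_half : rc (1 / 2 : R) = 2^-1.
Proof. by rewrite mul1r rcV rc_nat. Qed.

Lemma seg_mid a b f : ctsI (fun t => f (a + rc t * (b - a))) ->
  seg a b f = seg a (mid a b) f + seg (mid a b) b f.
Proof.
move=> cf; rewrite /seg mean_half // mulrA [in LHS]mulrDr /mid; congr (_ * _ + _ * _).
- by rewrite rc_half; field.
- apply: mean_ext => t _; congr f; rewrite rcM rcV rc_nat rc_half; field => //.
- by rewrite rc_half; field.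
- apply: mean_ext => t _; congr f; rewrite rcM rcV rc_nat rcD rc_half; field => //.
Qed.

Lemma seg_le a b f (B : R) : ctsI (fun t => f (a + rc t * (b - a))) ->
  (forall t, 0 <= t <= 1 -> nr (f (a + rc t * (b - a))) <= B) ->
  nr (seg a b f) <= nr (b - a) * B.
Proof. by move=> cf fB; rewrite nrM ler_wpM2l ?nr_ge0 //; exact: mean_le. Qed.

Lemma segD a b f g : ctsI (fun t => f (a + rc t * (b - a))) ->
  ctsI (fun t => g (a + rc t * (b - a))) ->
  seg a b (fun z => f z + g z) = seg a b f + seg a b g.
Proof. by move=> cf cg; rewrite /seg meanD // mulrDr. Qed.

Lemma seg_affine a b p q : seg a b (fun z => p + q * z) = (b - a) * (p + q * mid a b).
Proof.
rewrite /seg; congr (_ * _).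
rewrite (@mean_ext _ _ (fun t => (p + q * a) + q * (b - a) * rc t)); last by move=> t _; ring.
rewrite meanD; last 2 first.
- exact: ctsI_cst.
- exact/ctsIZ/ctsI_id.
by rewrite mean_cst (meanZ _ (@ctsI_id R)) mean_id /mid rc_half; field.
Qed.

Definition tri a b c f := seg a b f + seg b c f + seg c a f.

Lemma tri_sub O a b c f : convexO O -> O a -> O b -> O c -> cts_on O f ->
  tri a b c f = tri a (mid a b) (mid c a) f + tri (mid a b) b (mid b c) f +
    tri (mid c a) (mid b c) c f + tri (mid a b) (mid b c) (mid c a) f.
Proof.
move=> cO Oa Ob Oc cf; rewrite /tri.
rewrite (seg_mid (a := a) (b := b)); last exact: seg_ctsI cf.
rewrite (seg_mid (a := b) (b := c)); last exact: seg_ctsI cf.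
rewrite (seg_mid (a := c) (b := a)); last exact: seg_ctsI cf.
rewrite (seg_rev (mid a b) (mid c a)) (seg_rev (mid a b) (mid b c)).
rewrite (seg_rev (mid b c) (mid c a)); ring.
Qed.

Lemma tri_affine a b c p q : tri a b c (fun z => p + q * z) = 0.
Proof. by rewrite /tri !seg_affine /mid; ring. Qed.

(** Nested triangles with halved sides shrink to a point at a known rate. *)
Lemma geo_limit (u : nat -> C) (s : R) :
  (forall n, nr (u n.+1 - u n) <= s * (1 / 2) ^+ n.+1) ->
  exists w, forall n, nr (u n - w) <= s * (1 / 2) ^+ n.
Proof.
move=> Hu.
have hp n : 0 < (1 / 2 : R) ^+ n by rewrite exprn_gt0 //; lra.
have s0 : 0 <= s by have := le_trans (nr_ge0 _) (Hu 0%N); rewrite pmulr_lge0.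
have step n k : nr (u (k + n)%N - u n) <= s * (1 / 2) ^+ n - s * (1 / 2) ^+ (k + n).
  elim: k => [|k IH]; first by rewrite add0n !subrr nr0.
  have := nr_tri (u (k + n)%N) (u (k.+1 + n)%N) (u n); have := Hu (k + n)%N.
  by rewrite -addSn exprS; lra.
have stepn n m : (n <= m)%N -> nr (u m - u n) <= s * (1 / 2) ^+ n.
  move=> /subnK <-; apply: le_trans (step _ _) _.
  by have := mulr_ge0 s0 (ltW (hp (m - n + n)%N)); lra.
have [w Hw] : exists w, limc u w.
  apply: cauchyC => e e0.
  have [|N HN] := half_pow_small (e := e / (2 * (s + 1))); first by rewrite divr_gt0 //; lra.
  exists N => n m Nn Nm.
  have := nr_tri (u N) (u n) (u m); have := stepn _ _ Nn; have := stepn _ _ Nm.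
  rewrite (nrBC (u N)); move: HN; rewrite ltr_pdivlMr; last lra.
  by have := hp N; nra.
exists w => n; rewrite leNgt; apply/negP => h.
have [|N HN] := Hw ((nr (u n - w) - s * (1 / 2) ^+ n) / 2); first lra.
have := HN (maxn N n) (leq_maxl _ _); have := stepn n (maxn N n) (leq_maxr _ _).
by have := nr_tri (u (maxn N n)) (u n) w; rewrite (nrBC (u n) (u (maxn _ _))); lra.
Qed.

Definition sides (s : R) (T : C * C * C) :=
  [/\ nr (T.1.2 - T.1.1) <= s, nr (T.2 - T.1.2) <= s & nr (T.1.1 - T.2) <= s].

Definition triT (T : C * C * C) f := tri T.1.1 T.1.2 T.2 f.

Lemma nr_half z : nr (rc (1 / 2) * z) = nr z / 2.
Proof. by rewrite nrM nr_rc ger0_norm; [field|lra]. Qed.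

Lemma mid_in O a b : convexO O -> O a -> O b -> O (mid a b).
Proof.
move=> cO Oa Ob; have -> : mid a b = a + rc (1 / 2) * (b - a).
  by rewrite /mid rc_half; field.
by apply: cO => //; lra.
Qed.

(** Of the four triangles of the midpoint subdivision, one carries at least a
    quarter of the integral. *)
Lemma tri_step O f (T : C * C * C) : convexO O -> cts_on O f ->
  [/\ O T.1.1, O T.1.2 & O T.2] -> exists T' : C * C * C,
  [/\ [/\ O T'.1.1, O T'.1.2 & O T'.2], nr (triT T f) <= 4 * nr (triT T' f) &
   forall s, sides s T -> sides (s / 2) T' /\ nr (T'.1.1 - T.1.1) <= s / 2].
Proof.
case: T => [[a b] c] /= cO cf [Oa Ob Oc].
have Om1 := mid_in cO Oa Ob; have Om2 := mid_in cO Ob Oc; have Om3 := mid_in cO Oc Oa.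
have dm1 : mid a b - a = rc (1 / 2) * (b - a) by rewrite /mid rc_half; field.
have dm3 : mid c a - a = - (rc (1 / 2) * (a - c)) by rewrite /mid rc_half; field.
have := tri_sub cO Oa Ob Oc cf.
set t1 := tri a (mid a b) (mid c a) f; set t2 := tri (mid a b) b (mid b c) f.
set t3 := tri (mid c a) (mid b c) c f; set t4 := tri (mid a b) (mid b c) (mid c a) f.
move=> E; have N : nr (tri a b c f) <= nr t1 + nr t2 + nr t3 + nr t4.
  rewrite E; have := nrD (t1 + t2 + t3) t4; have := nrD (t1 + t2) t3.
  by have := nrD t1 t2; lra.
have [h|h1] := leP (nr (tri a b c f)) (4 * nr t1).
  exists (a, mid a b, mid c a); split=> // s [/= s1 s2 s3]; rewrite subrr nr0.
  split; last by have := nr_ge0 (b - a); lra.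
  split=> /=.
  - by rewrite dm1 nr_half; lra.
  - rewrite (_ : _ - _ = rc (1 / 2) * (c - b)) ?nr_half; first lra.
    by rewrite /mid rc_half; field.
  - by rewrite -nrN opprB dm3 nrN nr_half; lra.
have [h|h2] := leP (nr (tri a b c f)) (4 * nr t2).
  exists (mid a b, b, mid b c); split=> // s [/= s1 s2 s3].
  split; last by rewrite dm1 nr_half; lra.
  split=> /=.
  - rewrite (_ : _ - _ = rc (1 / 2) * (b - a)) ?nr_half; first lra.
    by rewrite /mid rc_half; field.
  - rewrite (_ : _ - _ = rc (1 / 2) * (c - b)) ?nr_half; first lra.
    by rewrite /mid rc_half; field.
  - rewrite (_ : _ - _ = rc (1 / 2) * (a - c)) ?nr_half; first lra.
    by rewrite /mid rc_half; field.
have [h|h3] := leP (nr (tri a b c f)) (4 * nr t3).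
  exists (mid c a, mid b c, c); split=> // s [/= s1 s2 s3].
  split; last by rewrite dm3 nrN nr_half; lra.
  split=> /=.
  - rewrite (_ : _ - _ = - (rc (1 / 2) * (a - b))) ?nrN ?nr_half ?(nrBC a b); first lra.
    by rewrite /mid rc_half; field.
  - rewrite (_ : _ - _ = rc (1 / 2) * (c - b)) ?nr_half; first lra.
    by rewrite /mid rc_half; field.
  - rewrite (_ : _ - _ = rc (1 / 2) * (a - c)) ?nr_half; first lra.
    by rewrite /mid rc_half; field.
exists (mid a b, mid b c, mid c a); split=> //=; first by rewrite /triT /= -/t4; lra.
move=> s [/= s1 s2 s3].
split; last by rewrite dm1 nr_half; lra.
split=> /=.
- rewrite (_ : _ - _ = - (rc (1 / 2) * (a - c))) ?nrN ?nr_half; first lra.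
  by rewrite /mid rc_half; field.
- rewrite (_ : _ - _ = - (rc (1 / 2) * (b - a))) ?nrN ?nr_half; first lra.
  by rewrite /mid rc_half; field.
- rewrite (_ : _ - _ = - (rc (1 / 2) * (c - b))) ?nrN ?nr_half; first lra.
  by rewrite /mid rc_half; field.
Qed.

(** Halving repeatedly, the integral is at most 4^n times that over a triangle
    of size 2^-n.  At the limit point f is affine up to an error small with
    respect to the distance, and affine functions contribute nothing; so the
    n-th integral is small with respect to 4^-n. *)
Lemma goursat O f a b c : convexO O -> closedO O -> holC O f ->
  O a -> O b -> O c -> tri a b c f = 0.
Proof.
move=> cO clO hf Oa Ob Oc; have cf := holC_cts hf.
pose good (T : C * C * C) := [/\ O T.1.1, O T.1.2 & O T.2].
have /choice[F HF] : forall T, exists T', good T ->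
    [/\ good T', nr (triT T f) <= 4 * nr (triT T' f) &
      forall s, sides s T -> sides (s / 2) T' /\ nr (T'.1.1 - T.1.1) <= s / 2].
  move=> T.
  have [gT|nT] := pselect (good T); last by exists T.
  by have [T' HT'] := tri_step cO cf gT; exists T'.
pose T n := iter n F (a, b, c).
pose s0 := nr (b - a) + nr (c - b) + nr (a - c).
have gT n : good (T n) by elim: n => [//|n IH]; have [] := HF _ IH.
have hp n : 0 < (1 / 2 : R) ^+ n by rewrite exprn_gt0 //; lra.
have s00 : 0 <= s0 by rewrite !addr_ge0 ?nr_ge0.
have sT n : sides (s0 * (1 / 2) ^+ n) (T n).
  elim: n => [|n IH].
    by rewrite expr0 mulr1; split; rewrite /= /s0;
      have := nr_ge0 (b - a); have := nr_ge0 (c - b); have := nr_ge0 (a - c); lra.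
  have [_ _ /(_ _ IH)[]] := HF _ (gT n).
  by rewrite exprS (_ : s0 * (1 / 2 * _) = s0 * (1 / 2) ^+ n / 2); [|field].
have mT n : nr (tri a b c f) <= 4 ^+ n * nr (triT (T n) f).
  elim: n => [|n IH]; first by rewrite expr0 mul1r.
  have [_ h _] := HF _ (gT n); apply: le_trans IH _.
  by rewrite exprSr -mulrA ler_wpM2l // exprn_ge0.
have [|w Hw] := @geo_limit (fun n => (T n).1.1) s0.
  move=> n; have [_ _ /(_ _ (sT n))[_]] := HF _ (gT n).
  by rewrite exprS (_ : s0 * (1 / 2 * _) = s0 * (1 / 2) ^+ n / 2); [|field].
have Ow : O w.
  apply: clO => e e0; have [|n Hn] := half_pow_small (e := e / (s0 + 1)).
    by rewrite divr_gt0 //; lra.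
  exists (T n).1.1; first by have [] := gT n.
  apply: le_trans (Hw n) _; move: Hn; rewrite ltr_pdivlMr; last lra.
  by have := hp n; nra.
have [l Hl] := hf _ Ow; apply: nr_small => e e0.
(* three sides of length s at distance at most 3 s from w give 9 s^2; the
   1 keeps K positive for a degenerate triangle *)
pose K := 9 * s0 * s0 + 1.
have K0 : 0 < K by have := mulr_ge0 s00 s00; rewrite /K; lra.
have [|d d0 H] := Hl (e / K); first by rewrite divr_gt0.
have [|n Hn] := half_pow_small (e := d / (3 * s0 + 1)); first by rewrite divr_gt0 //; lra.
pose s := s0 * (1 / 2) ^+ n.
have sd : 3 * s < d.
  by move: Hn; rewrite ltr_pdivlMr; [have := hp n; rewrite /s; nra|lra].
have s_ge0 : 0 <= s by rewrite /s mulr_ge0 // ltW.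
pose g z := f z - f w - l * (z - w).
have gE z : g z = f z + ((l * w - f w) + (- l) * z) by rewrite /g; ring.
have [/= OA OB OD] := gT n; have [/= sA sB sD] := sT n; have wA := Hw n.
rewrite -/s in sA sB sD wA.
have caff : cts_on O (fun z => (l * w - f w) + (- l) * z).
  apply: holC_cts => z _; exists (- l) => e' e'0; exists 1 => // y _ _.
  by rewrite (_ : _ - _ = 0) ?nr0 ?mulr_ge0 ?nr_ge0 ?ltW //; ring.
have cg : cts_on O g.
  apply: holC_cts => z /hf[lz Hz]; exists (lz - l) => e' /Hz[d' d'0 H']; exists d' => // y Oy /(H' _ Oy).
  by congr (nr _ <= _); rewrite /g; ring.
have segE p q : O p -> O q -> seg p q g = seg p q f + seg p q (fun z => (l * w - f w) + (- l) * z).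
  move=> Op Oq; rewrite -segD; [congr seg; exact: funext|exact: seg_ctsI cf|exact: seg_ctsI caff].
have triE : triT (T n) f = triT (T n) g.
  rewrite /triT; rewrite -[LHS]addr0 -(tri_affine (T n).1.1 (T n).1.2 (T n).2 (l * w - f w) (- l)).
  by rewrite /tri !segE //; ring.
have ptb p q t : O p -> O q -> 0 <= t <= 1 -> nr (q - p) <= s -> nr (p - w) <= 2 * s ->
    nr (g (p + rc t * (q - p))) <= e / K * (3 * s).
  move=> Op Oq t01 pq pw.
  have zw : nr (p + rc t * (q - p) - w) <= 3 * s.
    rewrite addrAC; apply: le_trans (nrD _ _) _; rewrite nrM nr_rc ger0_norm; last lra.
    have : t * nr (q - p) <= nr (q - p) by rewrite ler_piMl ?nr_ge0 //; lra.
    lra.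
  apply: le_trans (H _ (cO _ _ _ Op Oq t01) _) _; first lra.
  by rewrite ler_wpM2l // divr_ge0 //; lra.
have segb p q : O p -> O q -> nr (q - p) <= s -> nr (p - w) <= 2 * s ->
    nr (seg p q g) <= s * (e / K * (3 * s)).
  move=> Op Oq pq pw; have B0 : 0 <= e / K * (3 * s) by rewrite mulr_ge0 ?divr_ge0 //; lra.
  apply: le_trans (seg_le (B := e / K * (3 * s)) _ _) _.
  - exact: seg_ctsI cg.
  - by move=> t t01; exact: ptb.
  - by rewrite ler_wpM2r.
have Bw : nr ((T n).1.2 - w) <= 2 * s by have := nr_tri (T n).1.1 (T n).1.2 w; lra.
have Dw : nr ((T n).2 - w) <= 2 * s.
  by have := nr_tri (T n).1.1 (T n).2 w; rewrite (nrBC (T n).2 (T n).1.1); lra.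
apply: le_trans (mT n) _; rewrite triE.
have tb : nr (triT (T n) g) <= 3 * (s * (e / K * (3 * s))).
  rewrite /triT /tri.
  have h1 := segb _ _ OA OB sA (le_trans wA (ltac:(lra) : s <= 2 * s)).
  have h2 := segb _ _ OB OD sB Bw; have h3 := segb _ _ OD OA sD Dw.
  have := nrD (seg (T n).1.1 (T n).1.2 g + seg (T n).1.2 (T n).2 g) (seg (T n).2 (T n).1.1 g).
  by have := nrD (seg (T n).1.1 (T n).1.2 g) (seg (T n).1.2 (T n).2 g); lra.
apply: le_trans (_ : 4 ^+ n * (3 * (s * (e / K * (3 * s)))) <= _).
  by rewrite ler_wpM2l // exprn_ge0.
(* s = s0 / 2^n, so the powers 4^n and 2^-n 2^-n cancel *)
have -> : 4 ^+ n * (3 * (s * (e / K * (3 * s)))) = (4 * (1 / 2) * (1 / 2)) ^+ n * (e / K * (9 * s0 * s0)).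
  by rewrite /s !exprMn; ring.
rewrite (_ : 4 * (1 / 2) * (1 / 2) = 1 :> R) ?expr1n ?mul1r; last by field.
by rewrite mulrAC ler_pdivrMr // ler_wpM2l ?ltW // /K; lra.
Qed.
End Goursat.

(** * Weighted averages over a diamond *)

Section Cauchy.
Context {R : realType}.
Local Notation C := (Cplx R).
Local Notation ci := (@ci R).
Implicit Types (f g : C -> C) (a b c z w u : C) (O : C -> Prop).

Lemma cts_cst O k : cts_on O (fun=> k).
Proof. by move=> z _ e e0; exists 1 => // w _ _; rewrite subrr nr0 ltW. Qed.

Lemma cts_id O : cts_on O (fun z => z).
Proof. by move=> z _ e e0; exists e => // w _ /ltW. Qed.

Lemma cts_ext O f g : (forall z, O z -> f z = g z) -> cts_on O f -> cts_on O g.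
Proof.
move=> fg cf z Oz e /(cf _ Oz)[d d0 H]; exists d => // w Ow wz.
by rewrite -!fg //; exact: H.
Qed.

Lemma ctsD O f g : cts_on O f -> cts_on O g -> cts_on O (fun z => f z + g z).
Proof.
move=> cf cg z Oz e e0; have e2 : 0 < e / 2 by lra.
have [d d0 H] := cf z Oz _ e2; have [d' d0' H'] := cg z Oz _ e2.
exists (Num.min d d') => [|w Ow]; first by rewrite lt_min d0.
rewrite lt_min => /andP[/(H _ Ow) h1 /(H' _ Ow) h2].
by rewrite opprD addrACA; apply: le_trans (nrD _ _) _; lra.
Qed.

Lemma ctsM O f g : cts_on O f -> cts_on O g -> cts_on O (fun z => f z * g z).
Proof.
move=> cf cg z Oz e e0.
have f0 := nr_ge0 (f z); have g0 := nr_ge0 (g z).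
pose K := nr (f z) + nr (g z) + 1.
have K0 : 0 < K by rewrite /K; lra.
pose e' := Num.min 1 (e / (2 * K)).
have e'0 : 0 < e' by rewrite lt_min ltr01 divr_gt0 //; lra.
have e'1 : e' <= 1 by rewrite ge_min lexx.
have e'K : e' * (2 * K) <= e by rewrite -ler_pdivlMr ?ge_min ?lexx ?orbT //; lra.
have [d d0 H] := cf z Oz _ e'0; have [d' d0' H'] := cg z Oz _ e'0.
exists (Num.min d d') => [|w Ow]; first by rewrite lt_min d0.
rewrite lt_min => /andP[/(H _ Ow) h1 /(H' _ Ow) h2].
have -> : f w * g w - f z * g z = (f w - f z) * (g w - g z) + f z * (g w - g z) + (f w - f z) * g z.
  by ring.
have n1 : nr ((f w - f z) * (g w - g z)) <= e'.
  by rewrite nrM -[leRHS]mulr1; apply: ler_pM; rewrite ?nr_ge0 //; lra.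
have n2 : nr (f z * (g w - g z)) <= nr (f z) * e' by rewrite nrM ler_wpM2l.
have n3 : nr ((f w - f z) * g z) <= e' * nr (g z) by rewrite nrM ler_wpM2r.
have := nrD ((f w - f z) * (g w - g z) + f z * (g w - g z)) ((f w - f z) * g z).
have := nrD ((f w - f z) * (g w - g z)) (f z * (g w - g z)).
by rewrite /K in e'K; nra.
Qed.

Lemma ctsV O f : cts_on O f -> (forall z, O z -> f z != 0) -> cts_on O (fun z => (f z)^-1).
Proof.
move=> cf fn0 z Oz e e0; have fz0 : 0 < nr (f z) by rewrite nr_gt0 fn0.
pose e' := Num.min (nr (f z) / 2) (e * nr (f z) * nr (f z) / 2).
have e'0 : 0 < e' by rewrite lt_min !divr_gt0 // !mulr_gt0.
have [d d0 H] := cf z Oz _ e'0; exists d => // w Ow /(H _ Ow) h.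
have h1 : nr (f w - f z) <= nr (f z) / 2 by apply: le_trans h _; rewrite ge_min lexx.
have h2 : nr (f w - f z) <= e * nr (f z) * nr (f z) / 2.
  by apply: le_trans h _; rewrite ge_min lexx orbT.
have fw : nr (f z) / 2 <= nr (f w) by have := nr_sub_ge (f z) (f w); rewrite nrBC; lra.
have -> : (f w)^-1 - (f z)^-1 = (f z - f w) * (f w * f z)^-1.
  by field; rewrite !fn0.
rewrite nrM nrV nrM nrBC ler_pdivrMr ?mulr_gt0 //; last lra.
apply: le_trans h2 _; rewrite (_ : _ / 2 = e * (nr (f z) / 2 * nr (f z))); last by field.
by apply: ler_wpM2l; [exact: ltW|rewrite ler_pM2r].
Qed.

Lemma ctsX O f n : cts_on O f -> cts_on O (fun z => f z ^+ n).
Proof.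
move=> cf; elim: n => [|n IH]; first by apply: cts_ext (@cts_cst O 1) => z _; rewrite expr0.
by apply: cts_ext (ctsM cf IH) => z _; rewrite exprS.
Qed.

(** The segment from 1 to i; its multiples by the powers of i are the four edges
    of the diamond with vertices 1, i, -1, -i. *)
Definition edge (t : R) : C := 1 + rc t * (ci - 1).

Lemma edge_ReIm t : cRe (edge t) = 1 - t /\ cIm (edge t) = t.
Proof. by rewrite /edge /cRe /cIm /rc /=; split; ring. Qed.

Lemma edge_le t : 0 <= t <= 1 -> nr (edge t) <= 1.
Proof.
move=> t01; apply: le_trans (nr_le_ReIm _) _; have [-> ->] := edge_ReIm t.
by rewrite !ger0_norm; lra.
Qed.

Lemma edge_ge t : 1 / 2 <= nr (edge t).
Proof.
have [e1 e2] := edge_ReIm t; have := cRe_le (edge t); have := cIm_le (edge t).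
by rewrite e1 e2; have := ler_norm t; have := ler_norm (1 - t); lra.
Qed.

Lemma edge_neq0 t : edge t != 0.
Proof. by rewrite -nr_gt0; have := edge_ge t; lra. Qed.

Lemma edge_lip s t : nr (edge s - edge t) <= 2 * `|s - t|.
Proof.
have := seg_lip (1 : C) ci s t; rewrite -/(edge s) -/(edge t) => /le_trans; apply.
by rewrite ler_wpM2r //; have := nrB ci 1; rewrite nr_ci nr1; lra.
Qed.

Definition ipow u := [\/ u = 1, u = ci, u = -1 | u = - ci].

Lemma ipow_nr u : ipow u -> nr u = 1.
Proof. by case=> ->; rewrite ?nrN ?nr1 ?nr_ci. Qed.

Definition diamond (r : R) z := exists u t, [/\ ipow u, 0 <= t <= 1 & z = rc r * u * edge t].

Lemma diamondI r u t : ipow u -> 0 <= t <= 1 -> diamond r (rc r * u * edge t).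
Proof. by exists u, t. Qed.

Lemma diamond_le r z : 0 <= r -> diamond r z -> r / 2 <= nr z <= r.
Proof.
move=> r0 [u [t [/ipow_nr u1 t01 ->]]]; rewrite !nrM u1 nr_rc ger0_norm // mulr1.
have := edge_le t01; have := edge_ge t => h1 h2; apply/andP; split.
  by rewrite [leLHS](_ : _ = r * (1 / 2)); [apply: ler_wpM2l|field].
by rewrite -[leRHS]mulr1; apply: ler_wpM2l.
Qed.

(** Continuity of a product along the edge is reduced to [ctsM] by reading
    functions of t as functions of Re z on the complex segment [0,1]. *)
Lemma diamond_ctsI r u f : 0 <= r -> ipow u -> cts_on (diamond r) f ->
  ctsI (fun t => f (rc r * u * edge t) / edge t).
Proof.
move=> r0 hu cf; have u1 := ipow_nr hu.
have c1 : ctsI (fun t => f (rc r * u * edge t)).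
  apply: (path_ctsI (O := diamond r) (p := fun t => rc r * u * edge t) (K := r * 2)) => //.
    by move=> t; exact: diamondI.
  move=> s t; rewrite -mulrBr !nrM u1 nr_rc ger0_norm // mulr1 -mulrA.
  by rewrite ler_wpM2l // edge_lip.
have c2 : ctsI (fun t => (edge t)^-1).
  apply: (path_ctsI (O := fun z => z != 0) (p := edge) (K := 2)) => [|t _|s t].
  - by apply: ctsV => //; exact: cts_id.
  - exact: edge_neq0.
  - exact: edge_lip.
move=> t t01 e e0.
(* g o Re on the segment [0,1] of C *)
have K (g : R -> C) : ctsI g -> cts_on (fun z => exists2 s, 0 <= s <= 1 & z = rc s) (fun z => g (cRe z)).
  move=> cg z [s s01 ->] e' e'0; have [d d0 H] := cg s s01 _ e'0; exists d => // w [s' s'01 ->].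
  by rewrite -rcB nr_rc => h; exact: H.
have [|d d0 H] := ctsM (K _ c1) (K _ c2) (z := rc t) _ e0; first by exists t.
exists d => // s s01 st; have := H (rc s); rewrite -rcB nr_rc; apply=> //; by exists s.
Qed.

(** The integral of dz / z over the diamond, up to the factor i - 1 common to
    the velocities of the four edges.  Its value 2 pi i / (i - 1) does not
    matter, only that it is not zero. *)
Definition avg_const : C := 4 * mean (fun t => (edge t)^-1).

Lemma edgeV_ctsI : ctsI (fun t => (edge t)^-1).
Proof.
have := @diamond_ctsI 1 1 (fun=> 1) ler01 (Or41 _ _ _ erefl) (cts_cst 1).
rewrite (_ : (fun t => 1 / edge t) = (fun t => (edge t)^-1)) //.
by apply: funext => t; rewrite mul1r.
Qed.

(** (1 + i) / [edge t] has real part 1 / |[edge t]|^2 >= 1. *)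
Lemma avg_const_neq0 : avg_const != 0.
Proof.
rewrite mulf_neq0 ?pnatr_eq0 //; apply/eqP => M0.
have := @mean_Re_ge R (fun t => (1 + ci) * (edge t)^-1) 1.
rewrite meanZ; last exact: edgeV_ctsI.
rewrite M0 mulr0 => h; suff : (1 : R) <= cRe 0 by rewrite /cRe /= ler10.
apply: h; first exact/ctsIZ/edgeV_ctsI.
move=> t t01; pose D := (1 - t) ^+ 2 + t ^+ 2.
have D0 : 0 < D by rewrite /D; nra.
have D1 : D <= 1 by rewrite /D; nra.
(* D = |edge t|^2 *)
have -> : (1 + ci) / edge t = rc D^-1 * (1 + ci * (rc (1 - t - t))).
  apply: (mulIf (edge_neq0 t)); rewrite divfK ?edge_neq0 //.
  rewrite -mulrA rcV; apply: (mulfI (_ : rc D != 0)); first by rewrite rc_eq0 gt_eqF.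
  rewrite mulrA mulfV ?mul1r; last by rewrite rc_eq0 gt_eqF.
  by apply/eqP; rewrite eq_complex; apply/andP; split; apply/eqP;
    rewrite /edge /D /rc /=; ring.
by rewrite cRe_rcM /cRe /= !mul0r !mul1r ?mulr0 ?subr0 ?addr0 mulr1 invf_ge1.
Qed.

(** 1 / (2 pi i) times the integral of f(z) dz / z over the diamond of radius
    r, normalized so that constants are fixed. *)
Definition avg r f : C := avg_const^-1 *
  (mean (fun t => f (rc r * 1 * edge t) / edge t) + mean (fun t => f (rc r * ci * edge t) / edge t) +
   mean (fun t => f (rc r * -1 * edge t) / edge t) + mean (fun t => f (rc r * - ci * edge t) / edge t)).

(** The norm of [avg] with respect to the supremum on the diamond is at most
    this constant.  It is locked because only its sign matters. *)
Definition Kc : R := locked (8 * (nr avg_const)^-1).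

Lemma Kc_gt0 : 0 < Kc.
Proof. by rewrite /Kc -lock mulr_gt0 // invr_gt0 nr_gt0 avg_const_neq0. Qed.
Lemma Kc_ge0 : 0 <= Kc.
Proof. exact/ltW/Kc_gt0. Qed.

Lemma ipow_1 : ipow 1. Proof. exact: Or41. Qed.
Lemma ipow_i : ipow ci. Proof. exact: Or42. Qed.
Lemma ipow_N1 : ipow (-1). Proof. exact: Or43. Qed.
Lemma ipow_Ni : ipow (- ci). Proof. exact: Or44. Qed.
#[local] Hint Resolve ipow_1 ipow_i ipow_N1 ipow_Ni : core.

Lemma avgD r f g : 0 <= r -> cts_on (diamond r) f -> cts_on (diamond r) g ->
  avg r (fun z => f z + g z) = avg r f + avg r g.
Proof.
move=> r0 cf cg.
have E u : ipow u -> mean (fun t => (f (rc r * u * edge t) + g (rc r * u * edge t)) / edge t) =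
    mean (fun t => f (rc r * u * edge t) / edge t) + mean (fun t => g (rc r * u * edge t) / edge t).
  move=> hu; rewrite -meanD; [|exact: diamond_ctsI..].
  by apply: mean_ext => t _; rewrite mulrDl.
by rewrite /avg !E //; ring.
Qed.

Lemma avgZ r k f : 0 <= r -> cts_on (diamond r) f ->
  avg r (fun z => k * f z) = k * avg r f.
Proof.
move=> r0 cf.
have E u : ipow u -> mean (fun t => (k * f (rc r * u * edge t)) / edge t) =
    k * mean (fun t => f (rc r * u * edge t) / edge t).
  move=> hu; rewrite -meanZ; last exact: diamond_ctsI.
  by apply: mean_ext => t _; rewrite mulrA.
by rewrite /avg !E //; ring.
Qed.

Lemma avg_ext r f g : 0 <= r -> (forall z, diamond r z -> f z = g z) -> avg r f = avg r g.
Proof.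
move=> r0 fg.
have E u : ipow u -> mean (fun t => f (rc r * u * edge t) / edge t) = mean (fun t => g (rc r * u * edge t) / edge t).
  by move=> hu; apply: mean_ext => t t01; rewrite fg //; exact: diamondI.
by rewrite /avg !E.
Qed.

Lemma avg_le r f (B : R) : 0 <= r -> cts_on (diamond r) f ->
  (forall z, diamond r z -> nr (f z) <= B) -> nr (avg r f) <= Kc * B.
Proof.
move=> r0 cf fB.
have E u : ipow u -> nr (mean (fun t => f (rc r * u * edge t) / edge t)) <= 2 * B.
  move=> hu; apply: mean_le; first exact: diamond_ctsI.
  move=> t t01; rewrite nrM nrV ler_pdivrMr; last by have := edge_ge t; lra.
  have h := fB _ (diamondI r hu t01); have B0 := le_trans (nr_ge0 _) h.
  by have := edge_ge t; nra.
rewrite /avg nrM nrV /Kc -lock mulrAC mulrC ler_wpM2r ?invr_ge0 ?nr_ge0 //.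
set a := mean _; set b := mean _; set c := mean _; set d := mean _.
have := E _ ipow_1; have := E _ ipow_i; have := E _ ipow_N1; have := E _ ipow_Ni.
have := nrD (a + b + c) d; have := nrD (a + b) c; have := nrD a b; rewrite -/a -/b -/c -/d; lra.
Qed.
End Cauchy.

(** * Cauchy's formula *)

Section CauchyFormula.
Context {R : realType}.
Local Notation C := (Cplx R).
Local Notation ci := (@ci R).
Implicit Types (f g : C -> C) (a b c z w u : C) (O : C -> Prop).
#[local] Hint Resolve ipow_1 ipow_i ipow_N1 ipow_Ni : core.

Lemma cdiff_ext O f g z l : O z -> (forall w, O w -> f w = g w) -> cdiff O f z l -> cdiff O g z l.
Proof.
move=> Oz fg Hf e /Hf[d d0 H]; exists d => // w Ow wz; rewrite -!fg //; exact: H.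
Qed.

Lemma cdiff_sub O O' f z l : (forall w, O' w -> O w) -> cdiff O f z l -> cdiff O' f z l.
Proof.
by move=> OO Hf e /Hf[d d0 H]; exists d => // w /OO; exact: H.
Qed.

Lemma holC_sub O O' f : (forall w, O' w -> O w) -> holC O f -> holC O' f.
Proof. by move=> OO hf z /OO/hf[l Hl]; exists l; exact: cdiff_sub Hl. Qed.

Lemma holC_ext O f g : (forall w, O w -> f w = g w) -> holC O f -> holC O g.
Proof. by move=> fg hf z Oz; have [l Hl] := hf _ Oz; exists l; exact: cdiff_ext fg Hl. Qed.

Lemma holC_affine O p q : holC O (fun z => p + q * z).
Proof.
move=> z _; exists q => e e0; exists 1 => // y _ _.
by rewrite (_ : _ - _ = 0) ?nr0 ?mulr_ge0 ?nr_ge0 ?ltW //; ring.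
Qed.

Lemma holC_cst O p : holC O (fun=> p).
Proof. by apply: holC_ext (holC_affine (O := O) p 0) => z _; rewrite mul0r addr0. Qed.

Lemma cdiffD O f g z l l' : cdiff O f z l -> cdiff O g z l' ->
  cdiff O (fun z => f z + g z) z (l + l').
Proof.
move=> Hf Hg e e0; have e2 : 0 < e / 2 by lra.
have [d d0 H] := Hf _ e2; have [d' d0' H'] := Hg _ e2.
exists (Num.min d d') => [|w Ow]; first by rewrite lt_min d0.
rewrite lt_min => /andP[/(H _ Ow) h1 /(H' _ Ow) h2].
have -> : f w + g w - (f z + g z) - (l + l') * (w - z) =
  (f w - f z - l * (w - z)) + (g w - g z - l' * (w - z)) by ring.
by have := nrD (f w - f z - l * (w - z)) (g w - g z - l' * (w - z)); lra.
Qed.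

Lemma cdiffM O f g z l l' : cdiff O f z l -> cdiff O g z l' ->
  cdiff O (fun z => f z * g z) z (l * g z + f z * l').
Proof.
move=> Hf Hg e e0.
have f0 := nr_ge0 (f z); have g0 := nr_ge0 (g z); have l0 := nr_ge0 l.
pose K := nr (g z) + 1 + nr l + nr (f z).
have K_gt0 : 0 < K by rewrite /K; lra.
have e'0 : 0 < e / K by rewrite divr_gt0.
have e''0 : 0 < Num.min 1 (e / K) by rewrite lt_min ltr01.
have [d d0 H] := Hf _ e'0; have [d' d0' H'] := Hg _ e'0.
have [d'' d0'' H''] := cdiff_cts Hg e''0.
exists (Num.min d (Num.min d' d'')) => [|w Ow]; first by rewrite !lt_min d0 d0'.
rewrite !lt_min => /and3P[/(H _ Ow) h1 /(H' _ Ow) h2 /(H'' _ Ow)].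
rewrite le_min => /andP[h3 h4].
have -> : f w * g w - f z * g z - (l * g z + f z * l') * (w - z) =
   (f w - f z - l * (w - z)) * g w + (l * (w - z)) * (g w - g z) + f z * (g w - g z - l' * (w - z)).
  by ring.
set A := f w - f z - _ in h1 *; set B := g w - g z - _ in h2 *; set s := nr (w - z) in h1 h2 *.
have s0 : 0 <= s := nr_ge0 _.
have gw : nr (g w) <= nr (g z) + 1 by have := nr_sub_ge (g w) (g z); lra.
have n1 : nr (A * g w) <= e / K * s * (nr (g z) + 1).
  by rewrite nrM; apply: ler_pM; rewrite ?nr_ge0.
have n2 : nr (l * (w - z) * (g w - g z)) <= nr l * s * (e / K).
  by rewrite !nrM -/s; apply: ler_pM; rewrite ?mulr_ge0 ?nr_ge0.
have n3 : nr (f z * B) <= nr (f z) * (e / K * s) by rewrite nrM ler_wpM2l.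
have -> : e * s = e / K * s * (nr (g z) + 1) + nr l * s * (e / K) + nr (f z) * (e / K * s).
  by rewrite /K; field; rewrite -/K gt_eqF.
have := nrD (A * g w + l * (w - z) * (g w - g z)) (f z * B).
by have := nrD (A * g w) (l * (w - z) * (g w - g z)); lra.
Qed.

Lemma cdiffV O f z l : O z -> cdiff O f z l -> f z != 0 ->
  cdiff O (fun z => (f z)^-1) z (- l / (f z) ^+ 2).
Proof.
move=> Oz Hf fz0 e e0; have a0 : 0 < nr (f z) by rewrite nr_gt0.
have l0 := nr_ge0 l; set a := nr (f z) in a0.
pose K := 2 * (a + nr l) / a ^+ 3.
have K_gt0 : 0 < K by rewrite divr_gt0 ?exprn_gt0 //; lra.
have e'0 : 0 < e / K by rewrite divr_gt0.
have e''0 : 0 < Num.min (a / 2) (e / K) by rewrite lt_min e'0 divr_gt0.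
have [d d0 H] := Hf _ e'0; have [d' d0' H'] := cdiff_cts Hf e''0.
exists (Num.min d d') => [|w Ow]; first by rewrite lt_min d0.
rewrite lt_min => /andP[/(H _ Ow) h1 /(H' _ Ow)]; rewrite le_min => /andP[h2 h3].
have fw : a / 2 <= nr (f w) by have := nr_sub_ge (f z) (f w); rewrite nrBC -/a; lra.
have fw0 : f w != 0 by rewrite -nr_gt0; lra.
have -> : (f w)^-1 - (f z)^-1 - (- l / f z ^+ 2) * (w - z) =
   (l * (w - z) * (f w - f z) - f z * (f w - f z - l * (w - z))) / (f w * f z ^+ 2).
  by field; rewrite fz0 fw0.
set A := f w - f z - _ in h1 *; set s := nr (w - z) in h1 *.
have s0 : 0 <= s := nr_ge0 _.
have n1 : nr (l * (w - z) * (f w - f z) - f z * A) <= (a + nr l) * (e / K * s).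
  have m1 : nr (l * (w - z) * (f w - f z)) <= nr l * s * (e / K).
    by rewrite !nrM -/s; apply: ler_pM; rewrite ?mulr_ge0 ?nr_ge0.
  have m2 : nr (f z * A) <= a * (e / K * s) by rewrite nrM ler_wpM2l // ltW.
  by have := nrB (l * (w - z) * (f w - f z)) (f z * A); lra.
rewrite nrM nrV nrM nrX -/a ler_pdivrMr; last by rewrite mulr_gt0 ?exprn_gt0 //; lra.
apply: le_trans n1 _.
have -> : (a + nr l) * (e / K * s) = e * s * (a / 2 * a ^+ 2).
  by rewrite /K; field; rewrite !gt_eqF //; lra.
apply: ler_wpM2l; first by rewrite mulr_ge0 // ltW.
by rewrite ler_wpM2r // exprn_ge0 // ltW.
Qed.

Lemma holCD O f g : holC O f -> holC O g -> holC O (fun z => f z + g z).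
Proof.
move=> hf hg z Oz; have [l Hl] := hf _ Oz; have [l' Hl'] := hg _ Oz.
by exists (l + l'); exact: cdiffD.
Qed.

Lemma holCM O f g : holC O f -> holC O g -> holC O (fun z => f z * g z).
Proof.
move=> hf hg z Oz; have [l Hl] := hf _ Oz; have [l' Hl'] := hg _ Oz.
by exists (l * g z + f z * l'); exact: cdiffM.
Qed.

Lemma holCV O f : holC O f -> (forall z, O z -> f z != 0) -> holC O (fun z => (f z)^-1).
Proof.
move=> hf f0 z Oz; have [l Hl] := hf _ Oz.
by exists (- l / (f z) ^+ 2); apply: cdiffV => //; exact: f0.
Qed.

(** The part of the disc |z| <= r beyond the line through w + h u and w + h i u.
    It is convex, misses w for h > 0, and contains the trapezoid between an edge
    of the diamond of radius r around 0 and the parallel edge of the diamond of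
    radius h around w. *)
Definition trap r w (h : R) u z := nr z <= r /\ h <= cRe ((z - w) * ((1 - ci) / u)).

Lemma trap_convex r w h u : convexO (trap r w h u).
Proof.
move=> z z' t [z1 z2] [z'1 z'2] t01; split.
  have -> : z + rc t * (z' - z) = rc (1 - t) * z + rc t * z' by rewrite rcB; ring.
  apply: le_trans (nrD _ _) _; rewrite !nrM !nr_rc !ger0_norm; try lra.
  by nra.
have -> : (z + rc t * (z' - z) - w) * ((1 - ci) / u) =
  rc (1 - t) * ((z - w) * ((1 - ci) / u)) + rc t * ((z' - w) * ((1 - ci) / u)).
  by rewrite rcB; ring.
by rewrite cReD !cRe_rcM; nra.
Qed.

Lemma trap_closed r w h u : ipow u -> closedO (trap r w h u).
Proof.
move=> hu z H; split; rewrite leNgt; apply/negP => lt.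
  have [|z' [z'1 _] zz'] := H ((nr z - r) / 2); first lra.
  by have := nr_sub_ge z z'; rewrite nrBC; lra.
set m := (1 - ci) / u in lt.
have m2 : nr m <= 2.
  by rewrite /m nrM nrV (ipow_nr hu) invr1 mulr1; have := nrB 1 ci; rewrite nr1 nr_ci; lra.
have [|z' [_ z'2] zz'] := H ((h - cRe ((z - w) * m)) / 4); first lra.
rewrite -/m in z'2; have : cRe ((z' - w) * m) - cRe ((z - w) * m) <= 2 * nr (z' - z).
  rewrite -cReB -mulrBl (_ : z' - w - (z - w) = z' - z); last by ring.
  apply: le_trans (ler_norm _) _; apply: le_trans (cRe_le _) _; rewrite nrM mulrC.
  by apply: ler_wpM2r; rewrite ?nr_ge0.
lra.
Qed.

Lemma ipow_neq0 u : ipow u -> u != 0.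
Proof. by move=> /ipow_nr u1; rewrite -nr_gt0 u1. Qed.

(** Two triangles make up the trapezoid.  The right-hand side consists of the
    integrals over its two legs, which cancel when the four trapezoids around w
    are added. *)
Lemma trap_seg r w (h : R) u f : ipow u -> 0 < h -> h <= r - 2 * nr w ->
  holC (fun z => nr z <= r /\ z != w) f ->
  seg (rc r * u) (rc r * (ci * u)) f - seg (w + rc h * u) (w + rc h * (ci * u)) f =
  seg (rc r * u) (w + rc h * u) f - seg (rc r * (ci * u)) (w + rc h * (ci * u)) f.
Proof.
move=> hu h0 hr hf; have u0 := ipow_neq0 hu; have u1 := ipow_nr hu.
have w0 := nr_ge0 w; have r0 : 0 <= r by lra.
pose O := trap r w h u.
have cO : convexO O := @trap_convex r w h u.
have clO : closedO O := trap_closed hu.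
have hfO : holC O f.
  apply: holC_sub hf => z [z1 z2]; split=> //; apply/eqP => zw.
  by move: z2; rewrite zw subrr mul0r /cRe /=; lra.
set m := (1 - ci) / u in hfO.
have m2 : nr m <= 2.
  by rewrite /m nrM nrV u1 invr1 mulr1; have := nrB 1 ci; rewrite nr1 nr_ci; lra.
have wm : cRe (w * m) <= 2 * nr w.
  apply: le_trans (ler_norm _) _; apply: le_trans (cRe_le _) _; rewrite nrM mulrC.
  by apply: ler_wpM2r.
have um (x : R) : cRe (rc x * u * m) = x.
  by rewrite /m (_ : _ * _ = rc x * (1 - ci)); [rewrite cRe_rcM /cRe /=; ring|field].
have cum (x : R) : cRe (rc x * (ci * u) * m) = x.
  rewrite /m (_ : _ * _ = rc x * (ci - ci * ci)); last by field.
  by rewrite ci2 cRe_rcM /cRe /=; ring.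
have cu1 : nr (ci * u) = 1 by rewrite nrM u1 nr_ci mulr1.
have P1 : O (rc r * u).
  by split; [rewrite nrM u1 mulr1 nr_rc ger0_norm|rewrite -/m mulrBl cReB um; lra].
have P2 : O (rc r * (ci * u)).
  by split; [rewrite nrM cu1 mulr1 nr_rc ger0_norm|rewrite -/m mulrBl cReB cum; lra].
have P3 : O (w + rc h * u).
  split; last by rewrite -/m addrAC subrr add0r um.
  by have := nrD w (rc h * u); rewrite nrM u1 mulr1 nr_rc ger0_norm; lra.
have P4 : O (w + rc h * (ci * u)).
  split; last by rewrite -/m addrAC subrr add0r cum.
  by have := nrD w (rc h * (ci * u)); rewrite nrM cu1 mulr1 nr_rc ger0_norm; lra.
have := goursat cO clO hfO P1 P2 P4; have := goursat cO clO hfO P1 P4 P3.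
rewrite /tri; set A := rc r * u; set B := rc r * (ci * u).
set a := w + rc h * u; set b := w + rc h * (ci * u).
rewrite (seg_rev A b) (seg_rev a b) (seg_rev A a) => E1 E2.
by apply/eqP; rewrite -subr_eq0 -[X in _ == X](addr0 0) -{1}E1 -E2; apply/eqP; ring.
Qed.

(** The four edges together are the contour integral of f(z) dz around w; the
    factor z on the right cancels the weight 1 / z in [avg]. *)
Lemma diamond_avg w (h : R) f : 0 < h -> cts_on (diamond h) (fun z => f (w + z)) ->
  seg (w + rc h * 1) (w + rc h * (ci * 1)) f + seg (w + rc h * ci) (w + rc h * (ci * ci)) f +
  seg (w + rc h * -1) (w + rc h * (ci * -1)) f + seg (w + rc h * - ci) (w + rc h * (ci * - ci)) f =
  (ci - 1) * avg_const * avg h (fun z => f (w + z) * z).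
Proof.
move=> h0 cf.
have E u : ipow u -> seg (w + rc h * u) (w + rc h * (ci * u)) f =
    (ci - 1) * mean (fun t => f (w + rc h * u * edge t) * (rc h * u * edge t) / edge t).
  move=> hu; have cfu : ctsI (fun t => f (w + rc h * u * edge t)).
    apply: (path_ctsI (O := diamond h) (p := fun t => rc h * u * edge t) (K := h * 2) cf).
      by move=> t; exact: diamondI.
    move=> s t; rewrite -mulrBr !nrM (ipow_nr hu) nr_rc (ger0_norm (ltW h0)) mulr1 -mulrA.
    by apply: ler_wpM2l; [exact: ltW|exact: edge_lip].
  rewrite /seg (_ : _ - _ = (ci - 1) * (rc h * u)); last by ring.
  rewrite -mulrA -meanZ.
    congr (_ * _); apply: mean_ext => t _.
    rewrite (_ : w + _ + _ = w + rc h * u * edge t); last by rewrite /edge; ring.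
    by field; exact: edge_neq0.
  move=> t t01 e e0; have [d d0 H] := cfu t t01 e e0; exists d => // s s01 st.
  rewrite (_ : w + _ + _ = w + rc h * u * edge s); last by rewrite /edge; ring.
  rewrite (_ : w + _ + _ = w + rc h * u * edge t); last by rewrite /edge; ring.
  exact: H.
rewrite !E // /avg -!mulrDr -mulrA; congr (_ * _).
by rewrite mulrA mulfV ?avg_const_neq0 // mul1r.
Qed.

(** Moving the contour to a small diamond around w, across the four trapezoids
    in between. *)
Lemma deform r w (h : R) f : 0 < h -> h <= r - 2 * nr w ->
  holC (fun z => nr z <= r /\ z != w) f ->
  avg r (fun z => f z * z) = avg h (fun z => f (w + z) * z).
Proof.
move=> h0 hr hf; have w0 := nr_ge0 w; have r0 : 0 < r by lra.
have cf := holC_cts hf.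
have c1 : cts_on (diamond r) (fun z => f (0 + z)).
  move=> z /(diamond_le (ltW r0))/andP[z1 z2] e e0; have [|d d0 H] := cf z _ e e0.
    by split=> //; apply/eqP => zw; move: z1; rewrite zw; lra.
  exists d => // y /(diamond_le (ltW r0))/andP[y1 y2]; rewrite !add0r; apply: H; split=> //.
  by apply/eqP => yw; move: y1; rewrite yw; lra.
have c2 : cts_on (diamond h) (fun z => f (w + z)).
  have K z : diamond h z -> nr (w + z) <= r /\ w + z != w.
    move=> /(diamond_le (ltW h0))/andP[z1 z2]; split; first by have := nrD w z; lra.
    by rewrite -subr_eq0 addrAC subrr add0r -nr_gt0; lra.
  move=> z /K hz e e0; have [d d0 H] := cf _ hz e e0.
  exists d => // y /K hy yz; apply: H => //.
  by rewrite opprD addrACA subrr add0r.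
have D1 := diamond_avg r0 c1; have D2 := diamond_avg h0 c2.
have ci10 : (ci - 1) * avg_const != 0 :> C.
  rewrite mulf_neq0 ?avg_const_neq0 // subr_eq0; apply/eqP => /(congr1 cRe).
  by rewrite /cRe /= => /esym/eqP; rewrite oner_eq0.
have -> : avg r (fun z => f z * z) = avg r (fun z => f (0 + z) * z).
  by apply: avg_ext => [|z _]; [exact: ltW|rewrite add0r].
apply: (mulfI ci10); rewrite -D2 -D1 !add0r.
have t1 := trap_seg ipow_1 h0 hr hf; have t2 := trap_seg ipow_i h0 hr hf.
have t3 := trap_seg ipow_N1 h0 hr hf; have t4 := trap_seg ipow_Ni h0 hr hf.
have E1 : ci * 1 = ci := mulr1 _; have E2 : ci * ci = -1 := @ci2 R.
have E3 : ci * -1 = - ci by rewrite mulrN1.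
have E4 : ci * - ci = 1 by rewrite mulrN E2 opprK.
move: t1 t2 t3 t4; rewrite E1 E2 E3 E4.
move=> /eqP; rewrite subr_eq => /eqP -> /eqP; rewrite subr_eq => /eqP ->.
move=> /eqP; rewrite subr_eq => /eqP -> /eqP; rewrite subr_eq => /eqP ->.
ring.
Qed.

Lemma avg1 (r : R) : avg r (fun=> 1 : C) = 1.
Proof.
rewrite /avg.
have E : mean (fun t => 1 / edge t) = mean (fun t => (edge t)^-1) :> C.
  by apply: mean_ext => t _; rewrite mul1r.
rewrite !E // (_ : _ + _ + _ + _ = avg_const); last by rewrite /avg_const; ring.
by rewrite mulVf ?avg_const_neq0.
Qed.

Definition disc (r : R) z := nr z <= r.

(** f(z) / (z - w) is the sum of the difference quotient of f at w and of
    f(w) / (z - w).  Both integrals can be moved to a diamond shrinking to w: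
    the first tends to 0, as the quotient is bounded, and the second is
    constant. *)
Lemma cauchy_formula r f w : holC (disc r) f -> nr w < r / 2 ->
  f w = avg r (fun z => f z * (z / (z - w))).
Proof.
move=> hf wr; have w0 := nr_ge0 w; have r0 : 0 < r by lra.
have cf := holC_cts hf.
have Ow : disc r w by rewrite /disc; lra.
have annw z : diamond r z -> z - w != 0.
  by move=> /(diamond_le (ltW r0))/andP[z1 _]; rewrite subr_eq0; apply/eqP => zw; move: z1; rewrite zw; lra.
have annD z : diamond r z -> disc r z by move=> /(diamond_le (ltW r0))/andP[].
have ck : cts_on (diamond r) (fun z => z / (z - w)).
  apply: ctsM; first exact: cts_id.
  by apply: ctsV => //; apply: ctsD; [exact: cts_id|exact: cts_cst].
have cfa : cts_on (diamond r) f.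
  by move=> z /annD /cf H e /H[d d0 H']; exists d => // y /annD; exact: H'.
have hq : holC (fun z => nr z <= r /\ z != w) (fun z => (z - w)^-1).
  apply: holCV => [|z [_ zw]]; last by rewrite subr_eq0.
  by apply: holC_ext (holC_affine (- w) 1) => z _; rewrite mul1r addrC.
(* 1 / (z - w) becomes 1 / z on the diamond centred at w *)
have e1 : avg r (fun z => z / (z - w)) = 1.
  rewrite -(avg1 (r - 2 * nr w)) -[RHS](avg_ext (f := fun z => (w + z - w)^-1 * z)).
  - rewrite -(deform _ _ hq) //; last lra.
    by apply: avg_ext => [|z _]; [exact: ltW|rewrite mulrC].
  - lra.
  - move=> z /diamond_le/andP[|z1 _]; [lra|]; rewrite addrAC subrr add0r mulVf // -nr_gt0; lra.
have e2 : avg r (fun z => (f z - f w) / (z - w) * z) = 0.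
  have [l Hl] := hf _ Ow; have l0 := nr_ge0 l.
  have hp : holC (fun z => nr z <= r /\ z != w) (fun z => (f z - f w) / (z - w)).
    apply: holCM hq; apply: holCD; last exact: holC_cst.
    by apply: holC_sub hf => z [].
  have [d d0 H] := Hl 1 ltr01.
  apply: nr_small => e e0.
  pose B := nr l + 1.
  have B0 : 0 < B by rewrite /B; lra.
  have KB : 0 < Kc * B :> R by rewrite mulr_gt0 // Kc_gt0.
  (* |f(z) - f(w)| <= B |z - w| near w, so the average is at most Kc B h *)
  pose h := Num.min (r - 2 * nr w) (Num.min (d / 2) (e / (Kc * B))).
  have h0 : 0 < h by rewrite !lt_min !divr_gt0 // subr_gt0; lra.
  have h1 : h <= r - 2 * nr w by rewrite ge_min lexx.
  have h2 : h <= d / 2 by rewrite !ge_min lexx orbT.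
  have h3 : h * (Kc * B) <= e by rewrite -ler_pdivlMr // !ge_min lexx !orbT.
  rewrite (deform h0 h1 hp).
  apply: le_trans (avg_le (B := B * h) _ _ _) _; first exact: ltW.
  - apply: ctsM; last exact: cts_id.
    have K z : diamond h z -> nr (w + z) <= r /\ w + z != w.
      move=> /(diamond_le (ltW h0))/andP[z1 z2]; split; first by have := nrD w z; lra.
      by rewrite -subr_eq0 addrAC subrr add0r -nr_gt0; lra.
    move=> z /K hz e' e'0; have [d' d'0 H'] := holC_cts hp hz e'0.
    exists d' => // y /K hy yz; apply: H' => //.
    by rewrite opprD addrACA subrr add0r.
  - move=> z /(diamond_le (ltW h0))/andP[z1 z2]; rewrite addrAC subrr add0r !nrM nrV.
    have z0 : 0 < nr z by lra.
    have := H (w + z); rewrite addrAC subrr add0r mul1r => /(_ _ _) Hz.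
    have {}Hz : nr (f (w + z) - f w - l * z) <= nr z.
      by apply: Hz; [rewrite /disc; have := nrD w z; lra|lra].
    have : nr (f (w + z) - f w) <= B * nr z.
      by have := nrD (f (w + z) - f w - l * z) (l * z); rewrite subrK nrM /B; lra.
    rewrite -ler_pdivrMr // => hh; apply: ler_pM => //; [|exact: ltW].
    by rewrite divr_ge0 ?nr_ge0.
  - by rewrite (_ : Kc * (B * h) = h * (Kc * B)) //; ring.
have -> : avg r (fun z => f z * (z / (z - w))) = avg r (fun z => (f z - f w) / (z - w) * z + f w * (z / (z - w))).
  by apply: avg_ext => [|z _]; [exact: ltW|rewrite !mulrBl; ring].
rewrite avgD; last 3 first.
- exact: ltW.
- apply: cts_ext (ctsM (ctsD cfa (cts_cst (- f w))) ck) => z _; ring.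
- by apply: ctsM => //; exact: cts_cst.
by rewrite e2 avgZ ?ltW // e1 mulr1 add0r.
Qed.
End CauchyFormula.

(** * Taylor expansion and order of vanishing *)

Section Taylor.
Context {R : realType}.
Local Notation C := (Cplx R).
Implicit Types (f g : C -> C) (a b c z w u : C) (O : C -> Prop).
#[local] Hint Resolve ipow_1 ipow_i ipow_N1 ipow_Ni : core.

Lemma holC_diamond (r : R) f : 0 < r -> holC (disc r) f -> cts_on (diamond r) f.
Proof.
move=> /ltW r0 /holC_cts cf z /(diamond_le r0)/andP[_ zr] e /(cf _ zr)[d d0 H].
by exists d => // w /(diamond_le r0)/andP[_ wr]; exact: H.
Qed.

Definition tcoef (r : R) f j : C := avg r (fun z => f z * (z^-1) ^+ j).

(** Cauchy's formula, with z / (z - w) expanded as a geometric series in w / z: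
    on the diamond |z| >= r / 2, so |w / z| <= 2 |w| / r, and
    |z / (z - w)| <= 2. *)
Lemma taylor (r B : R) f : 0 < r -> holC (disc r) f ->
  (forall z, diamond r z -> nr (f z) <= B) ->
  forall k w, nr w <= r / 4 ->
    nr (f w - \sum_(j < k) tcoef r f j * w ^+ j) <= 2 * Kc * B * (2 * nr w / r) ^+ k.
Proof.
rewrite /tcoef => r0 hf fB; have r0' := ltW r0.
have cf := holC_diamond r0 hf.
have cz : cts_on (diamond r) (fun z => z^-1).
  apply: ctsV => [|z /(diamond_le r0')/andP[z1 _]]; first exact: cts_id.
  by rewrite -nr_gt0; lra.
move=> k w wr; have w0 := nr_ge0 w.
have bdw z : diamond r z -> z - w != 0 /\ nr z / 2 <= nr (z - w).
  move=> /(diamond_le r0')/andP[z1 _]; have h := nr_sub_ge z w; split; last lra.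
  by rewrite -nr_gt0; lra.
have bdz z : diamond r z -> z != 0 by move=> /(diamond_le r0')/andP[z1 _]; rewrite -nr_gt0; lra.
have ck : cts_on (diamond r) (fun z => z / (z - w)).
  apply: ctsM; first exact: cts_id.
  by apply: ctsV => [|z /bdw[]//]; apply: ctsD; [exact: cts_id|exact: cts_cst].
have cr j : cts_on (diamond r) (fun z => f z * (w / z) ^+ j * (z / (z - w))).
  apply: ctsM => //; apply: ctsM => //; apply: ctsX; apply: ctsM => //; exact: cts_cst.
have ca j : cts_on (diamond r) (fun z => f z * (z^-1) ^+ j) by apply: ctsM => //; exact: ctsX.
(* z / (z - w) = sum of (w / z)^j for j < k, plus (w / z)^k z / (z - w) *)
have -> : f w - \sum_(j < k) avg r (fun z => f z * z^-1 ^+ j) * w ^+ j =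
    avg r (fun z => f z * (w / z) ^+ k * (z / (z - w))).
  elim: k => [|k IH].
    rewrite big_ord0 subr0 (cauchy_formula hf); last lra.
    by apply: avg_ext => // z _; rewrite expr0 mulr1.
  rewrite big_ord_recr /= opprD addrA IH -mulrN [X in _ + X]mulrC -avgZ // -avgD //.
    apply: avg_ext => // z za; have [zw _] := bdw _ za; have z0 := bdz _ za.
    by rewrite !exprMn [in RHS]exprS [in RHS]exprS; field; rewrite zw z0.
  by apply: ctsM => //; exact: cts_cst.
have B0 : 0 <= B.
  by apply: le_trans (nr_ge0 _) (fB (rc r * 1 * edge 0) _); exists 1, 0; split=> //; lra.
apply: le_trans (avg_le (B := B * (2 * nr w / r) ^+ k * 2) _ _ _) _ => //.
- move=> z za; have [zw zw2] := bdw _ za.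
  have z0 : 0 < nr z by rewrite nr_gt0 bdz.
  rewrite !nrM nrX nrM !nrV; apply: ler_pM.
  - by rewrite mulr_ge0 ?exprn_ge0 ?divr_ge0 ?nr_ge0.
  - by rewrite divr_ge0 ?nr_ge0.
  - apply: ler_pM; rewrite ?nr_ge0 ?exprn_ge0 ?divr_ge0 ?nr_ge0 //; first exact: fB.
    apply: lerXn2r; rewrite ?nnegrE ?divr_ge0 ?mulr_ge0 ?nr_ge0 //.
    move: (diamond_le r0' za) => /andP[z1 _].
    by rewrite ler_pdivrMr // mulrAC ler_pdivlMr //; nra.
  - by rewrite ler_pdivrMr ?nr_gt0 //; lra.
- by rewrite (_ : Kc * _ = 2 * Kc * B * (2 * nr w / r) ^+ k) //; ring.
Qed.

(** Compactness of the diamond for properties with a tolerance: a tolerance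
    that is locally uniform is uniform. *)
Lemma diamond_compact (r : R) (P : C -> R -> Prop) :
  (forall b (d d' : R), 0 < d' -> d' <= d -> P b d -> P b d') ->
  (forall b, diamond r b -> exists2 d : R, 0 < d &
     forall b', diamond r b' -> nr (b' - b) < d -> P b' d) ->
  exists2 d : R, 0 < d & forall b, diamond r b -> P b d.
Proof.
move=> Pmon Ploc.
have side u : ipow u -> exists2 d : R, 0 < d &
    forall t : R, 0 <= t <= 1 -> P (rc r * u * edge t) d.
  move=> hu; have [||d d0 H] := @bisect R (fun s t : R => exists2 d : R, 0 < d &
      forall x : R, 0 <= x <= 1 -> s <= x <= t -> P (rc r * u * edge x) d); last first.
  - by exists d => // t t01; exact: H.
  - move=> t t01; have [d d0 H] := Ploc _ (diamondI r hu t01); have nr0 := normr_ge0 r.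
    exists (d / (2 * `|r| + 1)) => [|a b a0 at_ tb b1]; first by rewrite divr_gt0 //; lra.
    rewrite ltr_pdivlMr; last lra.
    move=> bad; exists d => // x x01 xab; apply: H; first exact: diamondI.
    rewrite -mulrBr !nrM (ipow_nr hu) mulr1 nr_rc.
    have xt : `|x - t| <= b - a by rewrite ler_norml; lra.
    have := edge_lip x t; nra.
  - move=> a b [d d0 H] [d' d'0 H']; exists (Num.min d d') => [|x x01 xab].
      by rewrite lt_min d0.
    have m0 : 0 < Num.min d d' by rewrite lt_min d0.
    have [h|h] := leP x ((a + b) / 2).
      by apply: (Pmon _ d); rewrite ?ge_min ?lexx //; apply: H => //; lra.
    by apply: (Pmon _ d'); rewrite ?ge_min ?lexx ?orbT //; apply: H' => //; lra.
have [d1 p1 H1] := side _ ipow_1; have [d2 p2 H2] := side _ ipow_i.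
have [d3 p3 H3] := side _ ipow_N1; have [d4 p4 H4] := side _ ipow_Ni.
pose d := Num.min (Num.min d1 d2) (Num.min d3 d4).
have d0 : 0 < d by rewrite !lt_min p1 p2 p3.
exists d => // _ [u [t [hu t01 ->]]].
by case: hu => ->; [apply: (Pmon _ d1)|apply: (Pmon _ d2)|apply: (Pmon _ d3)|apply: (Pmon _ d4)];
  rewrite ?ge_min ?lexx ?orbT //; [exact: H1|exact: H2|exact: H3|exact: H4].
Qed.

Lemma diamond_bounded (r : R) f : cts_on (diamond r) f ->
  exists2 B : R, 0 <= B & forall z, diamond r z -> nr (f z) <= B.
Proof.
move=> cf; have [||d d0 H] := @diamond_compact r (fun b d => nr (f b) <= d^-1).
- by move=> b d d' d'0 dd /le_trans; apply; rewrite lef_pV2 // posrE; lra.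
- move=> b hb; have [d d0 H] := cf _ hb _ ltr01; have b0 := nr_ge0 (f b).
  exists (Num.min d (nr (f b) + 1)^-1) => [|b' hb']; first by rewrite lt_min d0 invr_gt0; lra.
  rewrite lt_min => /andP[/(H _ hb') h _]; apply: (@le_trans _ _ (nr (f b) + 1)).
    by have := nr_sub_ge (f b') (f b); lra.
  rewrite -[leLHS]invrK lef_pV2 ?posrE ?lt_min ?d0 ?invr_gt0 ?ge_min ?lexx ?orbT //; lra.
by exists d^-1; rewrite ?invr_ge0 ?ltW.
Qed.

(** The Taylor polynomial of degree one has to be the derivative; this yields at
    once the second-order remainder, the Cauchy estimate for the derivative,
    and its integral formula. *)
Lemma cdiff_first (r B : R) f l : 0 < r -> holC (disc r) f ->
  (forall z, diamond r z -> nr (f z) <= B) -> cdiff (disc r) f 0 l ->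
  [/\ forall w, nr w <= r / 4 -> nr (f w - f 0 - l * w) <= 8 * Kc * B / r ^+ 2 * nr w ^+ 2,
   nr l <= 4 * Kc * B / r & l = tcoef r f 1].
Proof.
move=> r0 hf fB Hl; have := taylor r0 hf fB; set a := tcoef r f => Ha.
have a0 : a 0%N = f 0.
  have := Ha 1%N 0; rewrite nr0 mulr0 mul0r expr1 mulr0 big_ord1 expr0 mulr1 => h.
  by apply/esym/subr0_eq/eqP; rewrite -nr_eq0 eq_le nr_ge0 h //; lra.
have K2 w : nr w <= r / 4 -> nr (f w - f 0 - a 1%N * w) <= 8 * Kc * B / r ^+ 2 * nr w ^+ 2.
  move=> /(Ha 2%N); rewrite big_ord_recl big_ord1 /= expr0 mulr1 expr1 a0 opprD addrA => /le_trans.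
  by apply; rewrite (_ : 2 * Kc * B * _ = 8 * Kc * B / r ^+ 2 * nr w ^+ 2) //; field; rewrite gt_eqF.
have K1 w : nr w <= r / 4 -> nr (f w - f 0) <= 4 * Kc * B / r * nr w.
  move=> /(Ha 1%N); rewrite big_ord1 expr0 mulr1 a0 expr1 => /le_trans.
  by apply; rewrite (_ : 2 * Kc * B * _ = 4 * Kc * B / r * nr w) //; field; rewrite gt_eqF.
set K := 8 * Kc * B / r ^+ 2 in K2 *; set K' := 4 * Kc * B / r in K1 *.
(* a linear map bounded by D + e near 0 for every e has norm at most D *)
have lin (m : C) (D : R) : 0 <= D -> (forall e : R, 0 < e -> exists2 d : R, 0 < d &
   forall w, nr w <= d -> nr (m * w) <= (D + e) * nr w) -> nr m <= D.
  move=> D0 H; rewrite leNgt; apply/negP => lt.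
  have [|d d0 Hd] := H ((nr m - D) / 2); first lra.
  have := Hd (rc d); rewrite nrM nr_rc gtr0_norm // => /(_ (lexx _)).
  by rewrite ler_pM2r //; lra.
have B0 : 0 <= B.
  by apply: le_trans (nr_ge0 _) (fB (rc r * 1 * edge 0) _); exists 1, 0; split=> //; lra.
have Kc0 : 0 < Kc :> R := Kc_gt0.
have r0' := ltW r0.
have Kn : 0 <= K by rewrite /K !mulr_ge0 ?invr_ge0 ?exprn_ge0 ?Kc_ge0 //.
have Kn' : 0 <= K' by rewrite /K' !mulr_ge0 ?invr_ge0 ?Kc_ge0 //.
have D0 : disc r 0 by rewrite /disc nr0 ltW.
have al : a 1%N = l.
  apply/subr0_eq/eqP; rewrite -nr_eq0 eq_le nr_ge0 andbT; apply: lin => // e e0.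
  have e2 : 0 < e / 2 by lra.
  have [d d0 H] := Hl _ e2.
  exists (Num.min (d / 2) (Num.min (r / 4) (e / (2 * (K + 1))))) => [|w].
    by rewrite !lt_min !divr_gt0 //; lra.
  rewrite !le_min => /and3P[h1 h2]; rewrite ler_pdivlMr; last lra.
  have w0 := nr_ge0 w => h3; have := K2 _ h2.
  have := H w; rewrite subr0 => /(_ _ _) Hw.
  have {}Hw : nr (f w - f 0 - l * w) <= e / 2 * nr w by apply: Hw; [rewrite /disc|]; lra.
  rewrite (_ : (a 1%N - l) * w = (f w - f 0 - l * w) - (f w - f 0 - a 1%N * w)); last by ring.
  by have := nrB (f w - f 0 - l * w) (f w - f 0 - a 1%N * w); rewrite expr2; nra.
split; [by rewrite -al| |by rewrite al].
apply: lin => // e e0; have [d d0 H] := Hl _ e0.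
exists (Num.min (d / 2) (r / 4)) => [|w]; first by rewrite !lt_min !divr_gt0.
rewrite !le_min => /andP[h1 h2]; have := K1 _ h2.
have := H w; rewrite subr0 => /(_ _ _) Hw.
have {}Hw : nr (f w - f 0 - l * w) <= e * nr w by apply: Hw; [rewrite /disc|]; lra.
rewrite (_ : l * w = (f w - f 0) - (f w - f 0 - l * w)); last by ring.
by have := nrB (f w - f 0) (f w - f 0 - l * w); lra.
Qed.

(** f vanishes at 0 to the exact order q, with leading term a w^q. *)
Definition lead f q a := a != 0 /\ exists2 d : R, 0 < d & exists2 K : R, 0 <= K &
  forall w, nr w <= d -> nr (f w - a * w ^+ q) <= K * nr w ^+ q.+1.

(** If all Taylor coefficients vanish, then the remainder estimates tend to 0
    geometrically on |w| <= r / 4; otherwise the first nonzero coefficient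
    gives the leading term. *)
Lemma lead_ex (r : R) f : 0 < r -> holC (disc r) f ->
  (forall w, nr w <= r / 4 -> f w = 0) \/ exists q a, lead f q a.
Proof.
move=> r0 hf; have [B B0 fB] := diamond_bounded (holC_diamond r0 hf).
have := taylor r0 hf fB; set a := tcoef r f => Ha; have Kc0 : 0 < Kc :> R := Kc_gt0.
have [[q aq]|na] := pselect (exists q, a q != 0).
  right; have /ex_minnP[m am mmin] : exists q, a q != 0 by exists q.
  exists m, (a m); split=> //; exists (r / 4); first by lra.
  exists (2 * Kc * B * (2 / r) ^+ m.+1) => [|w wr].
    by rewrite !mulr_ge0 ?exprn_ge0 ?divr_ge0 ?Kc_ge0 // ltW.
  have := Ha m.+1 w wr; rewrite big_ord_recr /= big1 ?add0r; last first.
    move=> i _; have [->|/mmin] := eqVneq (a i) 0; first by rewrite mul0r.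
    by rewrite leqNgt ltn_ord.
  move=> /le_trans; apply; rewrite (_ : 2 * nr w / r = 2 / r * nr w); last by field; rewrite gt_eqF.
  by rewrite exprMn mulrA.
left=> w wr; apply: nr_small => e e0.
have [|n Hn] := half_pow_small (e := e / (2 * Kc * B + 1)).
  by rewrite divr_gt0 //; have := mulr_ge0 (ltW Kc0) B0; lra.
have := Ha n w wr; rewrite big1 ?subr0; last first.
  move=> i _; have [->|ai] := eqVneq (a i) 0; first by rewrite mul0r.
  by case: na; exists i.
move=> /le_trans; apply.
have KB : 0 <= 2 * Kc * B by rewrite !mulr_ge0 ?Kc_ge0 //.
have h1 : (2 * nr w / r) ^+ n <= (1 / 2) ^+ n.
  apply: lerXn2r; rewrite ?nnegrE ?divr_ge0 ?mulr_ge0 ?nr_ge0 //; first exact: ltW.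
  by rewrite ler_pdivrMr //; lra.
have h2 : 0 < (1 / 2 : R) ^+ n by rewrite exprn_gt0 //; lra.
by move: Hn; rewrite ltr_pdivlMr; [nra|lra].
Qed.

Lemma lead_nz f q a : lead f q a ->
  exists2 d : R, 0 < d & forall w, 0 < nr w -> nr w <= d -> f w != 0.
Proof.
move=> [a0 [d d0 [K K0 H]]]; have an : 0 < nr a by rewrite nr_gt0.
exists (Num.min d (nr a / (2 * (K + 1)))) => [|w w0].
  by rewrite lt_min d0 divr_gt0 //; lra.
rewrite le_min => /andP[/H h1]; rewrite ler_pdivlMr; last lra.
move=> h2; apply/eqP => fw; move: h1; rewrite fw sub0r nrN nrM nrX exprS.
have wq : 0 < nr w ^+ q by rewrite exprn_gt0.
have : 0 < (nr a - K * nr w) * nr w ^+ q by rewrite mulr_gt0 //; nra.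
lra.
Qed.

Lemma cdiff_aff O O' f (c k z l : C) : (forall w, O' w -> O (c + k * w)) ->
  cdiff O f (c + k * z) l -> cdiff O' (fun w => f (c + k * w)) z (l * k).
Proof.
move=> OO Hf e e0; have k0 := nr_ge0 k.
have [|d d0 H] := Hf (e / (nr k + 1)); first by rewrite divr_gt0 //; lra.
exists (d / (nr k + 1)) => [|w Ow]; first by rewrite divr_gt0 //; lra.
rewrite ltr_pdivlMr; last lra.
move=> wz; have E : c + k * w - (c + k * z) = k * (w - z) by ring.
have := H _ (OO _ Ow); rewrite E nrM mulrA => /(_ _) h.
have s0 := nr_ge0 (w - z).
apply: le_trans (h _) _; first nra.
rewrite mulrA ler_wpM2r // mulrAC ler_pdivrMr; last lra.
by rewrite ler_wpM2l ?ltW //; lra.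
Qed.

Lemma holC_aff O O' f (c k : C) : (forall w, O' w -> O (c + k * w)) ->
  holC O f -> holC O' (fun w => f (c + k * w)).
Proof.
move=> OO hf z Oz; have [l Hl] := hf _ (OO _ Oz); exists (l * k); exact: cdiff_aff Hl.
Qed.

Lemma cdiffX O q z : O z -> cdiff O (fun w => w ^+ q) z (q%:R * z ^+ q.-1).
Proof.
move=> Oz; elim: q => [|q IH].
  by rewrite mul0r => e e0; exists 1 => // w _ _; rewrite !expr0 subrr mul0r subr0 nr0 mulr_ge0 ?nr_ge0 ?ltW.
have i1 : cdiff O (fun w => w) z 1.
  by move=> e e0; exists 1 => // w _ _; rewrite mul1r subrr nr0 mulr_ge0 ?nr_ge0 ?ltW.
have := cdiffM i1 IH.
have -> : 1 * z ^+ q + z * (q%:R * z ^+ q.-1) = q.+1%:R * z ^+ q.+1.-1.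
  by case: q {IH} => [|q] /=; rewrite ?expr0 ?exprS -[in RHS]natr1; ring.
by apply: cdiff_ext => // w _; rewrite exprS.
Qed.

(** The Cauchy estimate for the derivative of f - a w^(q+1) at z, on a disc of
    radius comparable to |z|, loses exactly one order. *)
Lemma lead_deriv (r : R) f f' q a : 0 < r -> (forall z, disc r z -> cdiff (disc r) f z (f' z)) ->
  lead f q.+1 a -> lead f' q (q.+1%:R * a).
Proof.
move=> r0 hf' [a0 [d d0 [K K_ge0 H]]]; split; first by rewrite mulf_neq0 ?pnatr_eq0.
have Kc0 : 0 < Kc :> R := Kc_gt0.
(* Cauchy estimate on the disc of radius h around z *)
have gb z (h : R) : nr z <= d / 2 -> nr z <= r / 2 -> 0 < h -> h <= d / 2 -> h <= r / 2 ->
    nr (f' z - q.+1%:R * a * z ^+ q) <= 4 * Kc * (K * (nr z + h) ^+ q.+2) / h.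
  move=> zd zr h0 hd hr.
  have zh w : disc h w -> nr (z + 1 * w) <= nr z + h.
    by rewrite /disc mul1r => wh; have := nrD z w; lra.
  have zD w : disc h w -> disc r (z + 1 * w) by move=> /zh wh; rewrite /disc; lra.
  pose g w := f w - a * w ^+ q.+1.
  have gd w : disc r w -> cdiff (disc r) g w (f' w - q.+1%:R * a * w ^+ q).
    move=> wD; have c0 : cdiff (disc r) (fun=> - a) w 0.
      by move=> e e0; exists 1 => // y _ _; rewrite subrr mul0r subr0 nr0 mulr_ge0 ?nr_ge0 ?ltW.
    have := cdiffD (hf' w wD) (cdiffM c0 (cdiffX q.+1 wD)).
    have -> : f' w + (0 * w ^+ q.+1 + - a * (q.+1%:R * w ^+ q.+1.-1)) = f' w - q.+1%:R * a * w ^+ q.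
      by rewrite /=; ring.
    by apply: cdiff_ext => // y _; rewrite /g mulNr.
  have z0 : disc h 0 by rewrite /disc nr0 ltW.
  have hg : holC (disc h) (fun w => g (z + 1 * w)).
    apply: (holC_aff (O := disc r)) => // w /gd Hw; exists (f' w - q.+1%:R * a * w ^+ q); exact: Hw.
  have gB w : diamond h w -> nr (g (z + 1 * w)) <= K * (nr z + h) ^+ q.+2.
    move=> /(diamond_le (ltW h0))/andP[_ wh]; have h1 := zh _ wh.
    apply: le_trans (H _ _) _; first lra.
    rewrite ler_wpM2l // lerXn2r // nnegrE ?nr_ge0 // addr_ge0 ?nr_ge0 //; exact: ltW.
  have g0 : cdiff (disc h) (fun w => g (z + 1 * w)) 0 (f' z - q.+1%:R * a * z ^+ q).
    rewrite -[X in cdiff _ _ _ X]mulr1; apply: (cdiff_aff (O := disc r)) => //.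
    rewrite mulr0 addr0; apply: gd; rewrite /disc; have := nr_ge0 z; lra.
  by have [] := cdiff_first h0 hg gB g0.
exists (Num.min (d / 2) (r / 2)); first by rewrite lt_min !divr_gt0.
exists (4 * Kc * (K * 2 ^+ q.+2)) => [|z].
  have p2 : 0 <= 2 ^+ q.+2 :> R by apply: exprn_ge0.
  by apply: mulr_ge0; [rewrite mulr_ge0 ?Kc_ge0|exact: mulr_ge0].
rewrite le_min => /andP[zd zr].
(* h = |z| works for z <> 0; at z = 0 the bound tends to 0 with h *)
have [z0|z0] := eqVneq z 0; last first.
  have zn : 0 < nr z by rewrite nr_gt0.
  apply: le_trans (gb z (nr z) zd zr zn zd zr) _.
  rewrite (_ : nr z + nr z = 2 * nr z); last by ring.
  rewrite exprMn [nr z ^+ q.+2]exprS (_ : _ / nr z = 4 * Kc * (K * 2 ^+ q.+2) * nr z ^+ q.+1) //.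
  by field; rewrite gt_eqF.
have -> : 4 * Kc * (K * 2 ^+ q.+2) * nr z ^+ q.+1 = 0 by rewrite z0 nr0 expr0n mulr0.
rewrite leNgt; apply/negP.
set m := nr (_ - _) => m0.
pose h := Num.min 1 (Num.min (Num.min (d / 2) (r / 2)) (m / (2 * (4 * Kc * K + 1)))).
have KK : 0 <= 4 * Kc * K by rewrite !mulr_ge0 ?Kc_ge0 //.
have h0 : 0 < h by rewrite !lt_min ltr01 !divr_gt0 //; lra.
have h1 : h <= 1 by rewrite ge_min lexx.
have h2 : h <= d / 2 by rewrite !ge_min lexx ?orbT.
have h3 : h <= r / 2 by rewrite !ge_min lexx ?orbT.
have h4 : h * (2 * (4 * Kc * K + 1)) <= m by rewrite -ler_pdivlMr ?ge_min ?lexx ?orbT //; lra.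
have := gb z h zd zr h0 h2 h3; rewrite -/m z0 nr0 add0r 2!exprS.
have -> : 4 * Kc * (K * (h * (h * h ^+ q))) / h = 4 * Kc * K * h * h ^+ q by field; rewrite gt_eqF.
have : h ^+ q <= 1 by rewrite exprn_ile1 // ltW.
have : 0 < h ^+ q by rewrite exprn_gt0.
by set x := h ^+ q; have : 0 <= 4 * Kc * K * h by [rewrite mulr_ge0 // ltW]; nra.
Qed.
End Taylor.

(** * Holomorphic functions of several variables *)

Section SeveralVariables.
Context {R : realType}.
Local Notation C := (Cplx R).
Variable V : normedModType C.
Implicit Types (f g : V -> C) (x y z v w : V) (O : V -> Prop).
#[local] Hint Resolve ipow_1 ipow_i ipow_N1 ipow_Ni : core.

Definition hol_at f z := exists L, fdiff f z L.
Definition holV O f := forall z, O z -> hol_at f z.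
Definition openV O := forall z, O z -> exists2 r : R, 0 < r & forall y, nr (y - z) < r -> O y.

Lemma fdiff_lin f z L : fdiff f z L ->
  L 0 = 0 /\ forall a x, L (a *: x) = a * L x.
Proof.
move=> [Lin _ _]; have L0 : L 0 = 0.
  have := Lin 1 0 0; rewrite scale1r mul1r addr0 => /eqP.
  by rewrite -subr_eq0 opprD addrA subrr sub0r oppr_eq0 => /eqP.
by split=> // a x; rewrite -[a *: x]addr0 Lin L0 addr0.
Qed.

Lemma fdiff_near f g z L (r : R) : 0 < r ->
  (forall y, nr (y - z) < r -> f y = g y) -> fdiff f z L -> fdiff g z L.
Proof.
move=> r0 fg [L1 L2 L3]; split=> // e /L3[d d0 H].
exists (Num.min d r) => [|h]; first by rewrite lt_min d0.
rewrite lt_min => /andP[hd hr]; rewrite -!fg ?subrr ?nr0 //; first exact: H.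
by rewrite addrAC subrr add0r.
Qed.

Lemma fdiff_cts f z L : fdiff f z L -> forall e : R, 0 < e ->
  exists2 d : R, 0 < d & forall y, nr (y - z) < d -> nr (f y - f z) <= e.
Proof.
move=> [_ [K K_ge0 LK] Hf] e e0; have [d d0 H] := Hf 1 ltr01.
exists (Num.min d (e / (K + 1))) => [|y]; first by rewrite lt_min d0 divr_gt0 //; lra.
rewrite lt_min => /andP[/H]; rewrite [z + _]addrC subrK mul1r => h.
rewrite ltr_pdivlMr; last lra.
have := nrD (f y - f z - L (y - z)) (L (y - z)); rewrite subrK.
by have := LK (y - z); lra.
Qed.

Lemma fdiff_slice f z w (c : C) L (O : C -> Prop) : fdiff f (z + c *: w) L ->
  cdiff O (fun b => f (z + b *: w)) c (L w).
Proof.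
move=> HL e e0; have w0 := nr_ge0 w; have [L0 LZ] := fdiff_lin HL; have [_ _ Hf] := HL.
have [|d d0 H] := Hf (e / (nr w + 1)); first by rewrite divr_gt0 //; lra.
exists (d / (nr w + 1)) => [|b _]; first by rewrite divr_gt0 //; lra.
rewrite ltr_pdivlMr; last lra.
move=> bc; have := H ((b - c) *: w); rewrite nrZ LZ.
have -> : z + c *: w + (b - c) *: w = z + b *: w by rewrite -addrA -scalerDl [c + _]addrC subrK.
have s0 := nr_ge0 (b - c).
move=> h; rewrite [L w * _]mulrC; apply: le_trans (h _) _; first nra.
have wn : nr w + 1 != 0 by rewrite gt_eqF //; lra.
rewrite (_ : _ * _ = e * nr (b - c) * (nr w / (nr w + 1))); last by field.
rewrite ler_piMr //; first by rewrite mulr_ge0 // ltW.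
by rewrite ler_pdivrMr; lra.
Qed.

(** The one-variable estimates on each line through z, on a disc of parameters
    that reaches distance p / 2; the resulting constants do not depend on the
    line. *)
Lemma fdiff_second f z L (p B : R) : 0 < p ->
  (forall y, nr (y - z) < p -> hol_at f y /\ nr (f y) <= B) -> fdiff f z L ->
  (forall w, nr w <= p / 8 ->
     nr (f (z + w) - f z - L w) <= 32 * Kc * B / p ^+ 2 * nr w ^+ 2) /\
  (forall w, nr (L w) <= 8 * Kc * B / p * nr w).
Proof.
move=> p0 Hf HL; have [L0 _] := fdiff_lin HL.
have K w : w != 0 -> (nr w <= p / 8 ->
     nr (f (z + w) - f z - L w) <= 32 * Kc * B / p ^+ 2 * nr w ^+ 2) /\
     nr (L w) <= 8 * Kc * B / p * nr w.
  rewrite -nr_gt0 => w0; pose s := p / (2 * nr w).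
  have s0 : 0 < s by rewrite divr_gt0 //; lra.
  have sw : s * nr w = p / 2 by rewrite /s; field; rewrite gt_eqF.
  have dz b : disc s b -> nr (z + b *: w - z) < p.
    move=> bs; rewrite addrAC subrr add0r nrZ.
    by apply: le_lt_trans (_ : s * nr w < p); [rewrite ler_pM2r|lra].
  have hg : holC (disc s) (fun b => f (z + b *: w)).
    by move=> b /dz/Hf[[L' HL'] _]; exists (L' w); exact: fdiff_slice.
  have gB b : diamond s b -> nr (f (z + b *: w)) <= B.
    by move=> /(diamond_le (ltW s0))/andP[_ /dz/Hf[]].
  have gL : cdiff (disc s) (fun b => f (z + b *: w)) 0 (L w).
    by apply: fdiff_slice; rewrite scale0r addr0.
  have [h1 h2 _] := cdiff_first s0 hg gB gL; split.
    move=> wp; have := h1 1; rewrite nr1 scale1r scale0r addr0 mulr1 expr1n mulr1.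
    have -> : 8 * Kc * B / s ^+ 2 = 32 * Kc * B / p ^+ 2 * nr w ^+ 2.
      by rewrite /s; field; rewrite !gt_eqF.
    by apply; rewrite ler_pdivlMr // mul1r /s ler_pdivlMr; lra.
  by rewrite (_ : 8 * Kc * B / p * nr w = 4 * Kc * B / s) // /s; field; rewrite !gt_eqF.
split=> [w wp|w]; have [->|w0] := eqVneq w 0.
- by rewrite addr0 subrr L0 subr0 !nr0 expr0n mulr0.
- by have [h _] := K w w0; exact: h.
- by rewrite L0 !nr0 mulr0.
- by have [] := K w w0.
Qed.

(** Compactness of the contour gives a neighbourhood of uniform width on which f
    is bounded. *)
Lemma tube O f z v (r : R) : openV O -> holV O f ->
  (forall b, diamond r b -> O (z + b *: v)) ->
  exists p B : R, [/\ 0 < p, 0 <= B & forall b, diamond r b -> forall y, nr (y - (z + b *: v)) < p ->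
     O y /\ nr (f y) <= B].
Proof.
move=> oO hf Hb; have v0 := nr_ge0 v.
have [||d d0 H] := @diamond_compact R r (fun b d =>
    forall y, nr (y - (z + b *: v)) < d -> O y /\ nr (f y) <= d^-1).
- move=> b d d' d'0 dd H y yd; have [|Oy fy] := H y; first lra.
  by split=> //; apply: le_trans fy _; rewrite lef_pV2 // posrE; lra.
- move=> b hb; have Oz := Hb _ hb; have [p p0 Hp] := oO _ Oz; have [L HL] := hf _ Oz.
  have [d d0 Hd] := fdiff_cts HL ltr01; have b0 := nr_ge0 (f (z + b *: v)).
  pose q := Num.min p d; have q0 : 0 < q by rewrite lt_min p0.
  have qp : q <= p by rewrite ge_min lexx.
  have qd : q <= d by rewrite ge_min lexx orbT.
  pose m := Num.min (q / (2 * (nr v + 1))) (nr (f (z + b *: v)) + 1)^-1.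
  have m0 : 0 < m by rewrite lt_min invr_gt0; apply/andP; split; [apply: divr_gt0|]; lra.
  have mq : m * (2 * (nr v + 1)) <= q by rewrite -ler_pdivlMr ?ge_min ?lexx //; lra.
  have mf : nr (f (z + b *: v)) + 1 <= m^-1.
    rewrite -[leLHS]invrK lef_pV2 ?posrE ?invr_gt0 ?ge_min ?lexx ?orbT //; lra.
  exists m => // b' _ bb y yd.
  have yq : nr (y - (z + b *: v)) < q.
    have := nr_tri (z + b' *: v) y (z + b *: v).
    rewrite [X in _ <= _ + nr X](_ : _ = (b' - b) *: v); last first.
      by rewrite opprD addrACA subrr add0r -scalerBl.
    by rewrite nrZ; have := nr_ge0 (b' - b); nra.
  split; first by apply: Hp; lra.
  have := Hd y (lt_le_trans yq qd).
  by have := nr_sub_ge (f y) (f (z + b *: v)); lra.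
by exists d, d^-1; split=> //; rewrite invr_ge0 ltW.
Qed.

(** The derivative in the direction w is, uniformly near z, within O(s) of the
    difference quotient with step s ([fdiff_second]), and for fixed s that
    quotient is continuous. *)
Lemma diff_dir_cts O f (df : V -> V -> C) w z : openV O ->
  (forall y, O y -> fdiff f y (df y)) -> O z ->
  forall e : R, 0 < e -> exists2 d : R, 0 < d &
    forall y, nr (y - z) < d -> nr (df y w - df z w) <= e.
Proof.
move=> oO Hdf Oz e e0.
have [p1 p10 Hp1] := oO _ Oz; have [d1 d10 Hd1] := fdiff_cts (Hdf _ Oz) ltr01.
pose p := Num.min p1 d1 / 2.
have p0 : 0 < p by rewrite divr_gt0 // lt_min p10.
pose B := nr (f z) + 1.
have B0 : 0 <= B by rewrite addr_ge0 ?nr_ge0.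
have H y : nr (y - z) < p -> forall w, nr w <= p / 8 ->
    nr (f (y + w) - f y - df y w) <= 32 * Kc * B / p ^+ 2 * nr w ^+ 2.
  move=> yz; have [p2 d2] : p + p <= p1 /\ p + p <= d1.
    have := splitr (Num.min p1 d1); rewrite -/p => <-.
    by rewrite !ge_min !lexx orbT.
  have yO : O y by apply: Hp1; lra.
  have [] // := fdiff_second (B := B) p0 _ (Hdf _ yO).
  move=> x xy; have xz : nr (x - z) < p + p by have := nr_tri y x z; lra.
  split; first by exists (df x); apply: Hdf; apply: Hp1; lra.
  have := Hd1 x (lt_le_trans xz d2); have := nr_sub_ge (f x) (f z); rewrite /B; lra.
set K := 32 * Kc * B / p ^+ 2 in H.
have p0' := ltW p0.
have K_ge0 : 0 <= K by rewrite /K !mulr_ge0 ?invr_ge0 ?exprn_ge0 ?Kc_ge0 //.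
have w0 := nr_ge0 w.
(* the step: K (s |w|)^2 <= s e / 4 *)
pose s := Num.min (p / (8 * (nr w + 1))) (e / (4 * (K * nr w ^+ 2 + 1))).
have Kw : 0 <= K * nr w ^+ 2 by rewrite mulr_ge0 ?exprn_ge0.
have s0 : 0 < s by rewrite lt_min; apply/andP; split; apply: divr_gt0 => //; lra.
have s1 : s * nr w <= p / 8.
  have : s <= p / (8 * (nr w + 1)) by rewrite ge_min lexx.
  by rewrite ler_pdivlMr; [nra|lra].
have s2 : s * (K * nr w ^+ 2) <= e / 4.
  have : s <= e / (4 * (K * nr w ^+ 2 + 1)) by rewrite ge_min lexx orbT.
  by rewrite ler_pdivlMr; [nra|lra].
have nsw : nr (rc s *: w) = s * nr w by rewrite nrZ nr_rc gtr0_norm.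
have Osw : O (z + rc s *: w).
  apply: Hp1; rewrite addrAC subrr add0r nsw.
  have : p + p <= p1 by have := splitr (Num.min p1 d1); rewrite -/p => <-; rewrite ge_min lexx.
  lra.
have es : 0 < s * e / 8 by rewrite divr_gt0 // mulr_gt0.
have [d2 d20 H2] := fdiff_cts (Hdf _ Oz) es; have [d3 d30 H3] := fdiff_cts (Hdf _ Osw) es.
exists (Num.min p (Num.min d2 d3)) => [|y]; first by rewrite !lt_min p0 d20.
rewrite !lt_min => /and3P[yp yd2 yd3].
have e1 : nr (f y - f z) <= s * e / 8 by exact: H2.
have e2 : nr (f (y + rc s *: w) - f (z + rc s *: w)) <= s * e / 8.
  by apply: H3; rewrite opprD addrACA subrr addr0.
have hz : nr (f (z + rc s *: w) - f z - df z (rc s *: w)) <= K * nr (rc s *: w) ^+ 2.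
  by apply: H; rewrite ?subrr ?nr0 // nsw.
have hy : nr (f (y + rc s *: w) - f y - df y (rc s *: w)) <= K * nr (rc s *: w) ^+ 2.
  by apply: H; rewrite // nsw.
have yO : O y.
  apply: Hp1; have : p + p <= p1 by have := splitr (Num.min p1 d1); rewrite -/p => <-; rewrite ge_min lexx.
  lra.
have LZ x : O x -> df x (rc s *: w) = rc s * df x w.
  by move=> /Hdf/fdiff_lin[].
rewrite !LZ // nsw in hz hy.
have : nr (rc s * (df y w - df z w)) <= s * e.
  set P := f (z + _) in e2 hz; set Q := f (y + _) in e2 hy.
  have -> : rc s * (df y w - df z w) = (P - f z - rc s * df z w) - (Q - f y - rc s * df y w) + ((Q - P) - (f y - f z)).
    by ring.
  have := nrD ((P - f z - rc s * df z w) - (Q - f y - rc s * df y w)) ((Q - P) - (f y - f z)).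
  have := nrB (P - f z - rc s * df z w) (Q - f y - rc s * df y w).
  have := nrB (Q - P) (f y - f z).
  have : K * (s * nr w) ^+ 2 <= s * e / 4.
    by rewrite (_ : K * (s * nr w) ^+ 2 = s * (s * (K * nr w ^+ 2))); [nra|ring].
  by have := mulr_gt0 s0 e0; lra.
by rewrite nrM nr_rc gtr0_norm // ler_pM2l.
Qed.
End SeveralVariables.

(** * Averages along a line, and derivatives in a fixed direction *)

Section Averages.
Context {R : realType}.
Local Notation C := (Cplx R).
Variable V : normedModType C.
Implicit Types (f g : V -> C) (x y z v w : V) (O : V -> Prop).
#[local] Hint Resolve ipow_1 ipow_i ipow_N1 ipow_Ni : core.

Lemma diamond_vertex (r : R) : 0 <= r -> diamond r (rc r * 1 * edge 0).
Proof. by move=> r0; exists 1, 0; split=> //; rewrite lexx ler01. Qed.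

Lemma line_cts O (F : V -> C) z v (r : R) :
  (forall b, diamond r b -> O (z + b *: v)) ->
  (forall y, O y -> forall e : R, 0 < e ->
     exists2 d : R, 0 < d & forall x, nr (x - y) < d -> nr (F x - F y) <= e) ->
  cts_on (diamond r) (fun b => F (z + b *: v)).
Proof.
move=> Hb Fc b /Hb/Fc H e /H[d d0 Hd]; have v0 := nr_ge0 v.
exists (d / (nr v + 1)) => [|c _]; first by rewrite divr_gt0 //; lra.
rewrite ltr_pdivlMr; last lra.
move=> cb; apply: Hd; rewrite opprD addrACA subrr add0r -scalerBl nrZ.
by have := nr_ge0 (c - b); nra.
Qed.

Lemma holV_diff O f : holV O f -> exists df : V -> V -> C, forall y, O y -> fdiff f y (df y).
Proof.
move=> hf; have /choice[df Hdf] : forall y, exists L : V -> C, O y -> fdiff f y L.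
  move=> y; have [/hf[L HL]|nO] := pselect (O y); first by exists L.
  by exists (fun=> 0).
by exists df.
Qed.

(** Differentiation under the average: the second-order remainder of f is
    uniform along the contour, and the average of the derivatives is a bounded
    linear map. *)
Lemma avg_fdiff O f (k : C -> C) z v (r : R) : 0 < r -> openV O -> holV O f ->
  cts_on (diamond r) k -> (forall b, diamond r b -> O (z + b *: v)) ->
  hol_at (fun y => avg r (fun b => k b * f (y + b *: v))) z.
Proof.
move=> r0 oO hf ck Hb; have r0' := ltW r0.
have [df Hdf] := holV_diff hf.
have [p [B [p0 B0 HB]]] := tube oO hf Hb.
have [Bk Bk0 HBk] := diamond_bounded ck.
pose K := 32 * Kc * B / p ^+ 2; pose K' := 8 * Kc * B / p.
have p0' := ltW p0.
have K_ge0 : 0 <= K by rewrite /K !mulr_ge0 ?invr_ge0 ?exprn_ge0 ?Kc_ge0 //.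
have K'_ge0 : 0 <= K' by rewrite /K' !mulr_ge0 ?invr_ge0 ?exprn_ge0 ?Kc_ge0 //.
have sec b : diamond r b -> (forall w, nr w <= p / 8 ->
     nr (f (z + b *: v + w) - f (z + b *: v) - df (z + b *: v) w) <= K * nr w ^+ 2) /\
  (forall w, nr (df (z + b *: v) w) <= K' * nr w).
  move=> hb; apply: fdiff_second => // [y /(HB _ hb)[/hf ? ?] //|].
  by apply: Hdf; exact: Hb.
clearbody K K'.
pose L w := avg r (fun b => k b * df (z + b *: v) w).
have cd w : cts_on (diamond r) (fun b => df (z + b *: v) w).
  apply: (line_cts (O := O) (F := fun y => df y w)) => // y Oy.
  exact: (diff_dir_cts w oO Hdf Oy).
have cdf w : cts_on (diamond r) (fun b => k b * df (z + b *: v) w) by exact: ctsM.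
have cf w : nr w < p -> cts_on (diamond r) (fun b => k b * f (z + w + b *: v)).
  move=> wp; apply: ctsM => //; apply: (line_cts (O := O)) => [b hb|y Oy].
    by have [] := HB _ hb (z + w + b *: v); rewrite // opprD addrACA subrr addr0 addrAC subrr add0r.
  exact: fdiff_cts (Hdf _ Oy).
exists L; split.
- move=> a x y; rewrite /L -avgZ // -avgD //; last by apply: ctsM; [exact: cts_cst|exact: cdf].
  apply: avg_ext => // b hb; have [Lin _ _] := Hdf _ (Hb _ hb).
  by rewrite Lin mulrDr mulrCA.
- exists (Kc * (Bk * K')) => [|w]; first by rewrite !mulr_ge0 ?Kc_ge0 //.
  rewrite -!mulrA; apply: avg_le => // b hb; rewrite nrM.
  by apply: ler_pM; rewrite ?nr_ge0 //; [exact: HBk|have [_] := sec _ hb].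
- move=> e e0; pose D := Kc * (Bk * K).
  have D0 : 0 <= D by rewrite /D !mulr_ge0 ?Kc_ge0 //.
  exists (Num.min (p / 8) (e / (D + 1))) => [|w]; first by rewrite lt_min !divr_gt0 //; lra.
  rewrite lt_min => /andP[wp]; rewrite ltr_pdivlMr; last lra.
  move=> we; have w0 := nr_ge0 w; have wp' : nr w < p by lra.
  have -> : avg r (fun b => k b * f (z + w + b *: v)) - avg r (fun b => k b * f (z + b *: v)) - L w =
      avg r (fun b => k b * (f (z + b *: v + w) - f (z + b *: v) - df (z + b *: v) w)).
    have cf0 : cts_on (diamond r) (fun b => k b * f (z + b *: v)).
      by have := cf 0; rewrite nr0 addr0; apply.
    have cfw := cf w wp'; have cdw := cdf w.
    have cn : cts_on (diamond r) (fun b => -1 * (k b * f (z + b *: v))).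
      by apply: ctsM => //; exact: cts_cst.
    have cn' : cts_on (diamond r) (fun b => -1 * (k b * df (z + b *: v) w)).
      by apply: ctsM => //; exact: cts_cst.
    have cs := ctsD cfw cn.
    rewrite /L -mulN1r -[- avg _ _]mulN1r -!avgZ // -!avgD //.
    by apply: avg_ext => // b hb; rewrite [z + w + _]addrAC; ring.
  apply: le_trans (avg_le (B := Bk * (K * nr w ^+ 2)) _ _ _) _ => //.
  + apply: ctsM => //; have cfz : cts_on (diamond r) (fun b => f (z + b *: v)).
      by apply: (line_cts (O := O)) => // y Oy; exact: fdiff_cts (Hdf _ Oy).
    have cfw : cts_on (diamond r) (fun b => f (z + b *: v + w)).
      apply: (cts_ext (f := fun b => f (z + w + b *: v))) => [b _|]; first by rewrite addrAC.
      apply: (line_cts (O := O)) => [b hb|y Oy]; last exact: fdiff_cts (Hdf _ Oy).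
      by have [] := HB _ hb (z + w + b *: v); rewrite // opprD addrACA subrr addr0 addrAC subrr add0r.
    have cn : cts_on (diamond r) (fun b => -1 * f (z + b *: v)) by apply: ctsM => //; exact: cts_cst.
    have cn' : cts_on (diamond r) (fun b => -1 * df (z + b *: v) w) by apply: ctsM; [exact: cts_cst|exact: cd].
    by apply: cts_ext (ctsD (ctsD cfw cn) cn') => b _; rewrite !mulN1r.
  + move=> b hb; rewrite nrM; apply: ler_pM; rewrite ?nr_ge0 //; first exact: HBk.
    by have [h _] := sec _ hb; apply: h; exact: ltW.
  + rewrite (_ : Kc * _ = D * nr w * nr w); last by rewrite /D; ring.
    by apply: ler_wpM2r => //; lra.
Qed.

(** The derivative of f along v, as a total function so that it can be
    iterated; [Dv_avg] shows that it does not depend on the derivative chosen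
    here. *)
Definition Dv v f z : C := xget 0 [set l | exists2 L, fdiff f z L & l = L v].

(** The integral formula for the first Taylor coefficient: it expresses the
    derivative along v as an average of f, which makes it unique, and
    holomorphic by [avg_fdiff]. *)
Lemma Dv_avg v f z (s r : R) : 0 < r -> (forall b : C, disc r b -> hol_at f (z + b *: v)) ->
  [/\ Dv v f z = avg r (fun b => b^-1 * f (z + b *: v)),
      forall O : C -> Prop, cdiff O (fun b => f (z + b *: v)) 0 (Dv v f z) &
      forall L, fdiff f z L -> Dv v f z = L v].
Proof.
move=> r0 hf.
have hg : holC (disc r) (fun b => f (z + b *: v)).
  by move=> b /hf[L HL]; exists (L v); exact: fdiff_slice.
have [B B0 HB] := diamond_bounded (holC_diamond r0 hg).
have [L HL] : hol_at f z by have := hf 0; rewrite scale0r addr0; apply; rewrite /disc nr0 ltW.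
have E L' : fdiff f z L' -> L' v = avg r (fun b => b^-1 * f (z + b *: v)).
  move=> HL'; have := @fdiff_slice _ _ f z v 0 L' (disc r); rewrite scale0r addr0 => /(_ HL') gL.
  have [_ _ ->] := cdiff_first r0 hg HB gL.
  by rewrite /tcoef; apply: avg_ext => [|b _]; [exact: ltW|rewrite expr1 mulrC].
have DE : Dv v f z = avg r (fun b => b^-1 * f (z + b *: v)).
  rewrite /Dv; case: xgetP => [y _ [L' HL' ->]|/(_ (L v)) []]; first exact: E.
  by exists L.
split=> [//|O|L' /E ->//]; rewrite DE -(E L HL).
by apply: fdiff_slice; rewrite scale0r addr0.
Qed.

Lemma Dv_fdiff O v f z L : openV O -> holV O f -> O z -> fdiff f z L -> Dv v f z = L v.
Proof.
move=> oO hf Oz HL; have [p p0 Hp] := oO _ Oz; have v0 := nr_ge0 v.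
pose r := p / (2 * (nr v + 1)).
have r0 : 0 < r by rewrite divr_gt0 //; lra.
have [|_ _ H] := @Dv_avg v f z 1 r r0; last exact: H.
move=> b br; apply/hf/Hp; rewrite addrAC subrr add0r nrZ.
apply: (@le_lt_trans _ _ (p / 2)); last lra.
apply: (@le_trans _ _ (r * nr v)); first by rewrite ler_wpM2r.
by rewrite /r mulrAC ler_pdivrMr; [nra|lra].
Qed.

Lemma Dv_hol O v f : openV O -> holV O f -> holV O (Dv v f).
Proof.
move=> oO hf z Oz; have [p p0 Hp] := oO _ Oz; have v0 := nr_ge0 v.
pose r := p / (4 * (nr v + 1)).
have r0 : 0 < r by rewrite divr_gt0 //; lra.
have rv : r * nr v <= p / 4.
  by rewrite /r mulrAC ler_pdivrMr; [nra|lra].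
have rz y b : nr (y - z) < p / 4 -> nr b <= r -> O (y + b *: v).
  move=> yz br; apply: Hp; rewrite addrAC; have := nrD (y - z) (b *: v); rewrite nrZ.
  have : nr b * nr v <= r * nr v by rewrite ler_wpM2r.
  lra.
have [||L HL] := @avg_fdiff O f (fun b => b^-1) z v r r0 oO hf.
- apply: ctsV => [|b /(diamond_le (ltW r0))/andP[b1 _]]; first exact: cts_id.
  by rewrite -nr_gt0; lra.
- move=> b /(diamond_le (ltW r0))/andP[_ b1]; apply: rz => //.
  by rewrite subrr nr0 divr_gt0.
exists L; apply: (fdiff_near (r := p / 4)) HL; first by rewrite divr_gt0.
by move=> y yz; have [|-> _ _] := @Dv_avg v f y r r r0 => // b br; apply/hf/rz.
Qed.

Definition Dn v f n := iter n (Dv v) f.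

Lemma Dn_hol O v f n : openV O -> holV O f -> holV O (Dn v f n).
Proof. by move=> oO hf; elim: n => [//|n IH]; exact: Dv_hol. Qed.

(** On the line z + C v, the function f is not identically zero, so it has a
    leading term of some order q at z; differentiating q times leaves a nonzero
    constant term. *)
Lemma Dn_neq0 O v f z (r : R) c : openV O -> holV O f -> 0 < r ->
  (forall b, disc r b -> O (z + b *: v)) -> nr c <= r / 4 -> f (z + c *: v) != 0 ->
  exists n, Dn v f n z != 0.
Proof.
move=> oO hf r0 Hb cr fc.
(* consecutive F n are derivatives of one another on the disc *)
pose F n (b : C) := Dn v f n (z + b *: v).
have hF n b : disc r b -> cdiff (disc r) (F n) b (F n.+1 b).
  move=> hb; have [p p0 Hp] := oO _ (Hb _ hb); have v0 := nr_ge0 v.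
  pose s := p / (2 * (nr v + 1)).
  have s0 : 0 < s by rewrite divr_gt0 //; lra.
  have sv : s * nr v < p.
    by apply: le_lt_trans (_ : p / 2 < _); [rewrite /s mulrAC ler_pdivrMr; [nra|lra]|lra].
  have [|_ /(_ (fun=> True)) H _] := @Dv_avg v (Dn v f n) (z + b *: v) s s s0.
    move=> b' b's; apply: (Dn_hol (O := O)) => //; apply: Hp.
    rewrite addrAC subrr add0r nrZ; apply: le_lt_trans sv.
    by rewrite ler_wpM2r.
  have := @cdiff_aff _ (fun=> True) (disc r) (fun b' => Dn v f n (z + b *: v + b' *: v)) (- b) 1 b (F n.+1 b).
  rewrite mul1r addNr mulr1 => /(_ _ H) {}H.
  have {}H := H (fun _ _ => I).
  apply: cdiff_ext H => // b' _; rewrite /F -addrA -scalerDl; congr (Dn _ _ _ (_ + _ *: _)).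
  by ring.
have hF0 : holC (disc r) (F 0%N) by move=> b /(hF 0%N); exists (F 1%N b).
have [H0|[q [a Ha]]] := lead_ex r0 hF0; first by rewrite -[X in X != 0]/(F 0%N c) H0 // eqxx in fc.
have : forall m, (m <= q)%N -> exists a', lead (F m) (q - m) a'.
  elim=> [|m IH] mq; first by exists a; rewrite subn0.
  have [a' Ha'] := IH (ltnW mq); exists ((q - m.+1).+1%:R * a').
  by apply: (lead_deriv r0 (hF m)); rewrite -subSn // subSS.
move=> /(_ q (leqnn q)); rewrite subnn => -[a' [a'0 [d d0 [K K0 H]]]].
exists q; have := H 0; rewrite nr0 expr0 mulr1 expr1 mulr0 => /(_ (ltW d0)) h.
have : nr (F q 0 - a') = 0 by apply/eqP; rewrite eq_le h nr_ge0.
by move=> /eqP; rewrite nr_eq0 subr_eq0 /F scale0r addr0 => /eqP ->.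
Qed.
End Averages.

(** * Absence of isolated zeros in two variables *)

Section Compactness.
Context {R : realType}.
Local Notation C := (Cplx R).
Local Notation ci := (@ci R).
Implicit Types (A B D : C -> Prop).

(** The Heine-Borel theorem for discs, for a property P of sets: P passes to
    subsets and to finite unions, and every point has a neighbourhood with P.
    The proof bisects a square, first vertically within a thin strip, then
    horizontally. *)
Lemma disc_compact (r : R) (P : (C -> Prop) -> Prop) :
  (forall A B, (forall c, A c -> B c) -> P B -> P A) ->
  (forall A B, P A -> P B -> P (fun c => A c \/ B c)) ->
  (forall c, exists2 d : R, 0 < d & P (fun c' => nr (c' - c) < d)) ->
  P (disc r).
Proof.
move=> Pmon PU Ploc.
have [r0|r0] := ltP r 0.
  have [d _ Hd] := Ploc 0; apply: Pmon Hd => c.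
  by rewrite /disc => cr; have := nr_ge0 c; lra.
pose len (t : R) := - r + t * (2 * r).
have lenE (y : R) : `|y| <= r -> exists2 t, 0 <= t <= 1 & len t = y.
  rewrite ler_norml => yr; have [rn|rn] := eqVneq r 0.
    by exists 0; [lra|move: yr; rewrite /len rn; lra].
  have r1 : 0 < 2 * r by rewrite pmulr_rgt0 // lt0r rn.
  exists ((y + r) / (2 * r)); last by rewrite /len; field.
  by rewrite ler_pdivlMr // ler_pdivrMr //; lra.
have lenD s t (d : R) : 0 < d -> `|s - t| < d / (2 * r + 1) -> `|len s - len t| < d.
  move=> d0; rewrite ltr_pdivlMr; last lra.
  rewrite (_ : len s - len t = (s - t) * (2 * r)); last by rewrite /len; ring.
  by rewrite normrM (ger0_norm (_ : 0 <= 2 * r)); [have := normr_ge0 (s - t); nra|lra].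
(* a vertical segment of the square has a thin strip around it with P *)
have strip (x : R) : exists2 d : R, 0 < d & P (fun c => `|cRe c - x| < d /\ `|cIm c| <= r).
  have [||d d0 Hd] := @bisect R (fun s t : R => exists2 d : R, 0 < d &
      P (fun c => `|cRe c - x| < d /\ exists2 a, s <= a <= t & cIm c = len a)); last first.
  - exists d => //; apply: Pmon Hd => c [h1 /lenE[t t01 e]]; split=> //; by exists t.
  - move=> t t01; have [d d0 Hd] := Ploc (rc x + ci * rc (len t)).
    exists (d / 2 / (2 * r + 1)) => [|a b a0 at_ tb b1 bad]; first by rewrite !divr_gt0 //; lra.
    exists (d / 2); first lra.
    apply: Pmon Hd => c [h1 [s sab e]]; apply: le_lt_trans (nr_le_ReIm _) _.
    rewrite cReB cImB e.
    have -> : cRe (rc x + ci * rc (len t)) = x by rewrite /cRe /=; ring.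
    have -> : cIm (rc x + ci * rc (len t)) = len t by rewrite /cIm /=; ring.
    have : `|len s - len t| < d / 2 by apply: lenD; [lra|rewrite ltr_norml; lra].
    lra.
  - move=> a b [d d0 H] [d' d'0 H']; exists (Num.min d d'); first by rewrite lt_min d0.
    apply: Pmon (PU _ _ H H') => c; rewrite lt_min => -[/andP[h1 h2] [s sab e]].
    have [h|h] := leP s ((a + b) / 2); [left|right]; split=> //; exists s => //; lra.
have : P (fun c => (exists2 a, 0 <= a <= 1 & cRe c = len a) /\ `|cIm c| <= r).
  apply: (@bisect R (fun s t : R => P (fun c => (exists2 a, s <= a <= t & cRe c = len a) /\ `|cIm c| <= r))).
    move=> a b H H'; apply: Pmon (PU _ _ H H') => c [[s sab e] h].
    by have [h'|h'] := leP s ((a + b) / 2); [left|right]; split=> //; exists s => //; lra.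
  move=> t t01; have [d d0 Hd] := strip (len t).
  exists (d / (2 * r + 1)) => [|a b a0 at_ tb b1 bad]; first by rewrite divr_gt0 //; lra.
  apply: Pmon Hd => c [[s sab ->] h]; split=> //.
  by apply: lenD => //; rewrite ltr_norml; lra.
apply: Pmon => c cr; split; last exact: le_trans (cIm_le _) cr.
by have [t t01 <-] := lenE (cRe c) (le_trans (cRe_le c) cr); exists t.
Qed.

(** If 0 were the only zero, then |h(a, .)| would be at least some m > 0 on the
    diamond for all small a, and for a <> 0 the function 1 / h(a, .) would be
    holomorphic on the disc; Cauchy's formula bounds it at 0 by Kc / m.  But
    h(a, 0) tends to h(0, 0) = 0. *)
Lemma no_isolated_zero (h : C -> C -> C) (d : R) : 0 < d ->
  (forall a, nr a <= d -> holC (disc d) (h a)) ->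
  (forall t, nr t <= d -> forall e : R, 0 < e -> exists2 q : R, 0 < q &
    forall a t', nr a < q -> nr t' <= d -> nr (t' - t) < q -> nr (h a t' - h 0 t) <= e) ->
  h 0 0 = 0 ->
  ~ (forall a t, nr a <= d -> nr t <= d -> h a t = 0 -> a = 0 /\ t = 0).
Proof.
move=> d0 hh hc h00 hz.
have [||m m0 Hm] := @diamond_compact R d (fun b m => forall a, nr a < m -> m <= nr (h a b)).
- by move=> b m m' m'0 mm H a am; apply: (le_trans mm); apply: H; lra.
- move=> b hb; have /andP[b1 b2] := diamond_le (ltW d0) hb.
  have hb0 : 0 < nr (h 0 b).
    rewrite nr_gt0; apply/eqP => /(hz 0 b)[] //; first by rewrite nr0 ltW.
    by move=> _ b0; move: b1; rewrite b0 nr0; lra.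
  have [|q q0 Hq] := hc b b2 (nr (h 0 b) / 2); first by rewrite divr_gt0.
  exists (Num.min q (nr (h 0 b) / 2)) => [|b' hb']; first by rewrite lt_min q0 divr_gt0.
  rewrite lt_min => /andP[b'q _] a; rewrite lt_min => /andP[aq _].
  have /andP[_ b'2] := diamond_le (ltW d0) hb'.
  have := Hq a b' aq b'2 b'q; have := nr_sub_ge (h 0 b) (h a b').
  rewrite (nrBC (h 0 b)) => h1 h2; rewrite ge_min; apply/orP; right; lra.
(* |h(a, 0)| <= e contradicts |1 / h(a, 0)| <= Kc / m *)
pose e := m / (2 * Kc); have Kc0 : 0 < Kc :> R := Kc_gt0.
have e0 : 0 < e by rewrite divr_gt0 //; lra.
have [|q q0 Hq] := hc 0 _ e e0; first by rewrite nr0 ltW.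
pose a : R := Num.min (Num.min (m / 2) (q / 2)) d.
have a0 : 0 < a by rewrite !lt_min d0 !divr_gt0.
have [am aq ad] : [/\ a <= m / 2, a <= q / 2 & a <= d] by rewrite !ge_min !lexx !orbT.
have na : nr (rc a : C) = a by rewrite nr_rc gtr0_norm.
have rca : rc a != 0 :> C by rewrite rc_eq0 gt_eqF.
have D0 : disc d (0 : C) by rewrite /disc nr0 ltW.
have hn t : disc d t -> h (rc a) t != 0.
  move=> td; apply/eqP => /hz[] //; first by rewrite na.
  by move/eqP; rewrite (negPf rca).
have hV : holC (disc d) (fun t => (h (rc a) t)^-1) by apply: holCV => //; apply: hh; rewrite na.
have := cauchy_formula hV (w := 0); rewrite nr0 => /(_ (divr_gt0 d0 (ltr0Sn _ _))) E.
have : nr (h (rc a) 0)^-1 <= Kc * m^-1.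
  rewrite E; have zz z : diamond d z -> z != 0.
    by move=> /(diamond_le (ltW d0))/andP[z1 _]; rewrite -nr_gt0; lra.
  rewrite (avg_ext (g := fun z => (h (rc a) z)^-1)) ?(ltW d0) //; last first.
    by move=> z /zz z0; rewrite subr0 divff // mulr1.
  apply: avg_le; [exact: ltW|exact: holC_diamond|move=> z hbz].
  rewrite nrV lef_pV2 ?posrE //; first by apply: Hm => //; rewrite na; lra.
  by rewrite nr_gt0 hn // /disc; have /andP[] := diamond_le (ltW d0) hbz.
have h0 : 0 < nr (h (rc a) 0) by rewrite nr_gt0 hn.
have := Hq (rc a) 0; rewrite na subrr nr0 h00 subr0 => /(_ _ (ltW d0) q0) he.
have {}he : nr (h (rc a) 0) <= e by apply: he; lra.
rewrite nrV -[leLHS]mul1r ler_pdivrMr // mulrAC ler_pdivlMr // mul1r => h1.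
have : Kc * nr (h (rc a) 0) <= Kc * e by rewrite ler_wpM2l // ltW.
have -> : Kc * e = m / 2 by rewrite /e; field; rewrite gt_eqF.
lra.
Qed.
End Compactness.

(** * Parallel lines meeting a closed set *)

Section Slices.
Context {R : realType}.
Local Notation C := (Cplx R).
Variable V : normedModType C.
Implicit Types (f g : V -> C) (x y z v w : V) (O K : V -> Prop) (A B D : C -> Prop).

(** Closedness of K relative to O. *)
Definition rclosed O K := forall y, O y -> ~ K y ->
  exists2 d : R, 0 < d & forall y', nr (y' - y) < d -> ~ K y'.

Definition hits K D v z := exists2 c, D c & K (z + c *: v).

Definition full K D v z (d : R) := forall y, nr (y - z) < d -> hits K D v y.

Lemma line_near v (c c' : C) z z' (d e : R) :
  nr (z' - z) < d -> nr (c' - c) * nr v <= e -> nr (z' + c' *: v - (z + c *: v)) < d + e.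
Proof.
move=> zz cc; have -> : z' + c' *: v - (z + c *: v) = (z' - z) + (c' - c) *: v.
  by rewrite opprD addrACA -scalerBl.
by have := nrD (z' - z) ((c' - c) *: v); rewrite nrZ; lra.
Qed.

Lemma small_mul v (d : R) : 0 < d -> exists2 e : R, 0 < e & e * nr v <= d.
Proof.
move=> d0; have v0 := nr_ge0 v; exists (d / (nr v + 1)).
  by rewrite divr_gt0 //; lra.
by rewrite mulrAC ler_pdivrMr; [nra|lra].
Qed.

Definition dclosed D := forall c, ~ D c -> exists2 d : R, 0 < d & forall c', nr (c' - c) < d -> ~ D c'.

(** The projection along v of a set that is proper over the base is closed. *)
Lemma nohits_open O K D v z (r : R) : rclosed O K -> dclosed D -> (forall c, D c -> nr c <= r) ->
  (forall c, D c -> O (z + c *: v)) -> ~ hits K D v z ->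
  exists2 d : R, 0 < d & forall z', nr (z' - z) < d -> ~ hits K D v z'.
Proof.
move=> cK cD Dr HO nh.
have [|||d d0 H] := @disc_compact R r (fun A => exists2 d : R, 0 < d &
    forall z', nr (z' - z) < d -> forall c, A c -> D c -> ~ K (z' + c *: v)).
- by move=> A B AB [d d0 H]; exists d => // z' zz c /AB; exact: H.
- move=> A B [d d0 H] [d' d'0 H']; exists (Num.min d d'); first by rewrite lt_min d0.
  by move=> z'; rewrite lt_min => /andP[h1 h2] c []; [exact: H|exact: H'].
- move=> c; have [Dc|nDc] := pselect (D c); last first.
    by have [d d0 Hd] := cD _ nDc; exists d => //; exists 1 => // z' _ c' /Hd.
  have nK : ~ K (z + c *: v) by move=> Kc'; apply: nh; exists c.
  have [d d0 Hd] := cK _ (HO _ Dc) nK.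
  have [|e e0 He] := @small_mul v (d / 2); first by rewrite divr_gt0.
  exists e => //; exists (d / 2) => [|z' zz c' cc _]; first by rewrite divr_gt0.
  apply: Hd; rewrite [d]splitr; apply: line_near => //.
  by apply: le_trans He; rewrite ler_wpM2r ?nr_ge0 // ltW.
by exists d => // z' zz [c Dc Kc']; apply: (H z' zz c) => //; exact: Dr.
Qed.

(** Baire's argument for finite covers: the base is covered by the closed sets
    of lines that meet K in a given small piece of the disc, so one of these
    sets has interior.  Hence near some parameter c0 arbitrarily small pieces
    still meet K over open sets of lines. *)
Lemma full_local O K v z (d r : R) : 0 < d -> rclosed O K ->
  (forall y, nr (y - z) < d -> forall c, nr c <= r -> O (y + c *: v)) ->
  full K (disc r) v z d ->
  exists2 c0, nr c0 <= r & forall e : R, 0 < e -> exists z2, exists2 d2 : R, 0 < d2 &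
    (forall y, nr (y - z2) < d2 -> nr (y - z) < Num.min d e) /\
    full K (fun c => nr (c - c0) <= e /\ nr c <= r) v z2 d2.
Proof.
move=> d0 cK HO hfull; apply: contrapT => nex.
(* no open set of lines within e of z consists of lines meeting K in A *)
pose bad A (e : R) := forall z2 (d2 : R), 0 < d2 ->
  (forall y, nr (y - z2) < d2 -> nr (y - z) < Num.min d e) -> ~ full K A v z2 d2.
have dr : dclosed (disc r).
  move=> c /negP; rewrite -ltNge => cr; exists (nr c - r); first lra.
  by move=> c' cc; apply/negP; rewrite -ltNge; have := nr_sub_ge c c'; rewrite (nrBC c); lra.
(* pieces are enlarged to closed sets B, for which bad unions are bad *)
have [|||A [AD Ar cA [e e0 He]]] := @disc_compact R r (fun A => exists B,
   [/\ forall c, A c -> disc r c -> B c, forall c, B c -> nr c <= r, dclosed B &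
    exists2 e : R, 0 < e & bad B e]).
- by move=> A B AB [B' [h1 h2 h3 h4]]; exists B'; split=> // c /AB; exact: h1.
- move=> A B [A' [a1 a2 a3 [e e0 He]]] [B' [b1 b2 b3 [e' e'0 He']]].
  exists (fun c => A' c \/ B' c); split.
  + by move=> c [Ac|Bc] cr; [left; exact: a1|right; exact: b1].
  + by move=> c []; [exact: a2|exact: b2].
  + move=> c nAB; have [|d1 d10 H1] := a3 c; first by move=> Ac; apply: nAB; left.
    have [|d2 d20 H2] := b3 c; first by move=> Bc; apply: nAB; right.
    exists (Num.min d1 d2) => [|c']; first by rewrite lt_min d10.
    by rewrite lt_min => /andP[h1 h2] []; [exact: H1|exact: H2].
  + exists (Num.min e e'); first by rewrite lt_min e0.
    move=> z2 d2 d20 Hz2 hf.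
    have m1 y : nr (y - z2) < d2 -> nr (y - z) < Num.min d e.
      by move=> /Hz2; rewrite !lt_min => /and3P[-> ->].
    have m2 y : nr (y - z2) < d2 -> nr (y - z) < Num.min d e'.
      by move=> /Hz2; rewrite !lt_min => /and3P[-> _ ->].
    have /existsNP[y /not_implyP[yz ny]] := He _ _ d20 m1.
    have [|q q0 Hq] := nohits_open cK a3 a2 _ ny.
      by move=> c /a2 cr; apply: HO => //; have := m1 _ yz; rewrite lt_min => /andP[].
    pose q' := Num.min q (d2 - nr (y - z2)).
    have q'0 : 0 < q' by rewrite lt_min q0 subr_gt0.
    have yq x : nr (x - y) < q' -> nr (x - z2) < d2.
      by rewrite lt_min => /andP[_ h]; have := nr_tri y x z2; lra.
    apply: (He' y q' q'0) => [x /yq/m2 //|x xy].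
    have [c [Ac|Bc] Kc'] := hf _ (yq _ xy); last by exists c.
    have xq : nr (x - y) < q by move: xy; rewrite lt_min => /andP[].
    by case: (Hq x xq _); exists c.
- move=> c; have [cr|ncr] := pselect (nr c <= r); last first.
    have [q q0 Hq] := dr c ncr; exists q => //; exists (fun=> False); split=> //.
    + by move=> c' _; exists (1 : R); [exact: ltr01|move=> c'' _ []].
    + exists (1 : R); first exact: ltr01.
      by move=> z2 d2 d20 _ hf; have [|? []] := hf z2; rewrite subrr nr0.
  have [e e0 He] : exists2 e : R, 0 < e & bad (fun c' => nr (c' - c) <= e /\ nr c' <= r) e.
    apply: contrapT => nb; apply: nex; exists c => // e e0; apply: contrapT => nz2.
    by apply: nb; exists e => // z2 d2 d20 H hf; apply: nz2; exists z2, d2.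
  exists e => //; exists (fun c' => nr (c' - c) <= e /\ nr c' <= r); split.
  + by move=> c' /ltW.
  + by move=> c' [].
  + move=> c' /not_andP[/negP|/negP]; rewrite -ltNge => h.
      exists (nr (c' - c) - e); first lra.
      by move=> c'' cc [h' _]; have := nr_tri c'' c' c; rewrite (nrBC c' c''); lra.
    exists (nr c' - r); first lra.
    by move=> c'' cc [_ h']; have := nr_sub_ge c' c''; rewrite (nrBC c'); lra.
  + by exists e.
apply: (He z (Num.min d e)) => //; first by rewrite lt_min d0.
move=> y; rewrite lt_min => /andP[/hfull[c cr Kc'] _]; exists c => //; exact: AD.
Qed.
End Slices.

(** * Implicit function estimates *)

Section Thin.
Context {R : realType}.
Local Notation C := (Cplx R).
Variable V : normedModType C.
Implicit Types (f g : V -> C) (x y z v w : V) (O K : V -> Prop) (A B D : C -> Prop).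

Lemma cdiff_chain f (c : C -> V) (t : C) u L D : fdiff f (c t) L ->
  (forall e : R, 0 < e -> exists2 d : R, 0 < d & forall t', D t' -> nr (t' - t) < d ->
     nr (c t' - c t - (t' - t) *: u) <= e * nr (t' - t)) ->
  cdiff D (fun t => f (c t)) t (L u).
Proof.
move=> HL Hc e e0; have [L0 LZ] := fdiff_lin HL; have [Lin [K K_ge0 LK] Hf] := HL.
have u0 := nr_ge0 u.
have e1 : 0 < e / (2 * (nr u + 1)) by rewrite divr_gt0 //; lra.
have [d d0 Hd] := Hf _ e1.
have e2 : 0 < Num.min 1 (e / (2 * (K + 1))).
  by rewrite lt_min ltr01 divr_gt0 //; lra.
have [d' d'0 Hd'] := Hc _ e2.
exists (Num.min d' (d / (nr u + 1))) => [|t' Dt'].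
  by rewrite lt_min d'0 divr_gt0 //; lra.
rewrite lt_min ltr_pdivlMr; last lra.
move=> /andP[/(Hd' _ Dt') h1 h2].
set s := nr (t' - t) in h1 h2 *; have s0 : 0 <= s := nr_ge0 _.
have m1 : Num.min 1 (e / (2 * (K + 1))) <= 1 by rewrite ge_min lexx.
have m2 : Num.min 1 (e / (2 * (K + 1))) * (2 * (K + 1)) <= e.
  by rewrite -ler_pdivlMr ?ge_min ?lexx ?orbT //; lra.
set m := Num.min _ _ in h1 m1 m2 e2.
have ct : nr (c t' - c t) <= s * (nr u + 1).
  have := nrD (c t' - c t - (t' - t) *: u) ((t' - t) *: u).
  by rewrite subrK nrZ -/s; nra.
have := Hd (c t' - c t); rewrite [c t + _]addrC subrK => /(_ (le_lt_trans ct h2)) h3.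
have E : L (c t' - c t) = L (c t' - c t - (t' - t) *: u) + (t' - t) * L u.
  have LD x y : L (x + y) = L x + L y by have := Lin 1 x y; rewrite scale1r mul1r.
  by rewrite -LZ -LD subrK.
have h4 : nr (L (c t' - c t - (t' - t) *: u)) <= K * (m * s).
  by apply: le_trans (LK _) _; rewrite ler_wpM2l.
have -> : f (c t') - f (c t) - L u * (t' - t) =
   (f (c t') - f (c t) - L (c t' - c t)) + L (c t' - c t - (t' - t) *: u) by rewrite E; ring.
have h5 : e / (2 * (nr u + 1)) * nr (c t' - c t) <= e / 2 * s.
  have -> : e / 2 * s = e / (2 * (nr u + 1)) * (s * (nr u + 1)) by field; rewrite gt_eqF //; lra.
  by rewrite ler_wpM2l // ltW.
have h6 : K * (m * s) <= e / 2 * s by rewrite mulrA ler_wpM2r //; lra.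
have := nrD (f (c t') - f (c t) - L (c t' - c t)) (L (c t' - c t - (t' - t) *: u)); lra.
Qed.

(** The nonlinear step of [graph_est], over R only: there b, w and W are norms,
    v is the norm of the direction, c that of the derivative along it, and X
    that of b times this derivative. *)
Lemma lip_arith (b w v W X c m K1 K2 : R) :
  0 <= b -> 0 <= w -> 0 <= W -> 0 < m -> 0 <= K2 ->
  b * (c / 2) <= X -> X <= K2 * W ^+ 2 + K1 * w -> W <= 2 * m -> W <= w + b * v ->
  2 * m * (K2 * v) <= c / 4 -> 2 * m * K2 <= 1 -> b * c <= 4 * (K1 + 1) * w.
Proof.
move=> b0 w0 W0 m0 K0 hX hX' Wm Ww m1 m2.
have h1 : K2 * W ^+ 2 <= K2 * (2 * m * (w + b * v)).
  rewrite ler_wpM2l // expr2; apply: ler_pM => //.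
have h2 : b * (2 * m * (K2 * v)) <= b * (c / 4) by rewrite ler_wpM2l.
have h3 : 2 * m * K2 * w <= w by rewrite ler_piMl.
lra.
Qed.

(** Two zeros of g near y0 that differ by w + b v satisfy, by the second-order
    expansion, dg(w) + b dg(v) = O(|w + b v|^2).  As dg(v) stays away from 0,
    this gives first b = O(|w|), then b = - dg(w) / dg(v) + O(|w|^2): zeros of g
    form a graph over the complement of v that is Lipschitz and
    differentiable. *)
Lemma graph_est O g (dg : V -> V -> C) y0 v : openV O -> holV O g ->
  (forall y, O y -> fdiff g y (dg y)) -> O y0 -> dg y0 v != 0 ->
  exists p L1 L2 : R, [/\ 0 < p, 0 <= L1, 0 <= L2, forall y, nr (y - y0) < p -> O y &
   forall y w (b : C), nr (y - y0) < p -> nr (y + w + b *: v - y0) < p ->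
     g y = 0 -> g (y + w + b *: v) = 0 ->
     nr b <= L1 * nr w /\ nr (b + dg y w / dg y v) <= L2 * nr w ^+ 2].
Proof.
move=> oO hg Hdg Oy0 c0; have v0 := nr_ge0 v.
have cn : 0 < nr (dg y0 v) by rewrite nr_gt0.
set c := nr (dg y0 v) in cn.
have [p1 p10 Hp1] := oO _ Oy0; have [d1 d10 Hd1] := fdiff_cts (Hdg _ Oy0) ltr01.
have [|d2 d20 Hd2] := diff_dir_cts v oO Hdg Oy0 (e := c / 2); first by rewrite divr_gt0.
(* on the ball of radius 2 q, g is defined and bounded by B *)
pose q := Num.min p1 d1 / 2.
have q0 : 0 < q by rewrite divr_gt0 // lt_min p10.
have [q1 q2] : q + q <= p1 /\ q + q <= d1.
  have := splitr (Num.min p1 d1); rewrite -/q => <-.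
  by rewrite !ge_min !lexx orbT.
pose B := nr (g y0) + 1.
have B0 : 0 <= B by rewrite addr_ge0 ?nr_ge0.
have H y : nr (y - y0) < q -> (forall w, nr w <= q / 8 ->
    nr (g (y + w) - g y - dg y w) <= 32 * Kc * B / q ^+ 2 * nr w ^+ 2) /\
    (forall w, nr (dg y w) <= 8 * Kc * B / q * nr w).
  move=> yz; have yO : O y by apply: Hp1; lra.
  apply: fdiff_second q0 _ (Hdg _ yO).
  move=> x xy; have xz : nr (x - y0) < q + q by have := nr_tri y x y0; lra.
  split; first by exists (dg x); apply: Hdg; apply: Hp1; lra.
  have := Hd1 x (lt_le_trans xz q2); have := nr_sub_ge (g x) (g y0); rewrite /B; lra.
set K2 := 32 * Kc * B / q ^+ 2 in H; set K1 := 8 * Kc * B / q in H.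
have q0' := ltW q0.
have K2_ge0 : 0 <= K2 by rewrite /K2 !mulr_ge0 ?invr_ge0 ?exprn_ge0 ?Kc_ge0 //.
have K1_ge0 : 0 <= K1 by rewrite /K1 !mulr_ge0 ?invr_ge0 ?exprn_ge0 ?Kc_ge0 //.
clearbody K1 K2 B.
pose m := Num.min (c / (8 * (K2 * nr v + 1))) (1 / (2 * (K2 + 1))).
have Kv : 0 <= K2 * nr v by rewrite mulr_ge0.
have m0 : 0 < m by rewrite lt_min; apply/andP; split; apply: divr_gt0; lra.
have m1 : 2 * m * (K2 * nr v) <= c / 4.
  have : m * (8 * (K2 * nr v + 1)) <= c by rewrite -ler_pdivlMr ?ge_min ?lexx //; lra.
  lra.
have m2 : 2 * m * K2 <= 1.
  have : m * (2 * (K2 + 1)) <= 1 by rewrite -ler_pdivlMr ?ge_min ?lexx ?orbT //; lra.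
  lra.
clearbody m.
pose p := Num.min (q / 16) (Num.min d2 m).
have p0 : 0 < p by rewrite lt_min divr_gt0 // lt_min d20 m0.
have [pq pd pm] : [/\ p <= q / 16, p <= d2 & p <= m] by rewrite !ge_min !lexx !orbT.
pose L1 := 4 * (K1 + 1) / c.
have L1_ge0 : 0 <= L1 by rewrite divr_ge0 //; lra.
have Lv : 0 <= L1 * nr v by rewrite mulr_ge0.
pose L2 := K2 * (1 + L1 * nr v) ^+ 2 * (2 / c).
have c2 : 0 <= 2 / c by rewrite divr_ge0 // ltW.
exists p, L1, L2; split=> //.
- by rewrite /L2 mulr_ge0 // mulr_ge0 // exprn_ge0 //; lra.
- by move=> y yp; apply: Hp1; lra.
move=> y w b yp wp gy gw.
have yq : nr (y - y0) < q by lra.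
have [Hs Hl] := H y yq; have yO : O y by apply: Hp1; lra.
have [_ LZ] := fdiff_lin (Hdg _ yO); have [Lin _ _] := Hdg _ yO.
pose W := w + b *: v.
have nW : nr W < 2 * m.
  have -> : W = (y + w + b *: v - y0) - (y - y0) by rewrite opprB subrKA -[y + w + _]addrA addrAC subrr add0r.
  by have := nrB (y + w + b *: v - y0) (y - y0); lra.
have nWq : nr W <= q / 8.
  have -> : W = (y + w + b *: v - y0) - (y - y0) by rewrite opprB subrKA -[y + w + _]addrA addrAC subrr add0r.
  by have := nrB (y + w + b *: v - y0) (y - y0); lra.
have nW' : nr W <= nr w + nr b * nr v by rewrite -nrZ nrD.
have E : dg y W = dg y w + b * dg y v by rewrite /W addrC Lin addrC.
have hW : nr (dg y W) <= K2 * nr W ^+ 2.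
  by have := Hs W nWq; rewrite /W addrA gw gy subrr sub0r nrN.
have cv : c / 2 <= nr (dg y v).
  have := Hd2 y (lt_le_trans yp pd); have := nr_sub_ge (dg y0 v) (dg y v).
  rewrite (nrBC (dg y0 v)) -/c; lra.
have W0 := nr_ge0 W; have w0 := nr_ge0 w; have b0 := nr_ge0 b.
have est1 : nr b <= L1 * nr w.
  have h1 : nr (b * dg y v) <= K2 * nr W ^+ 2 + K1 * nr w.
    have -> : b * dg y v = dg y W - dg y w by rewrite E addrC addKr.
    by have := nrB (dg y W) (dg y w); have := Hl w; lra.
  have h5 : nr b * (c / 2) <= nr (b * dg y v) by rewrite nrM ler_wpM2l.
  rewrite /L1 mulrAC ler_pdivlMr //.
  exact: (lip_arith b0 w0 W0 m0 K2_ge0 h5 h1 (ltW nW) nW' m1 m2).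
split=> //.
have dn : dg y v != 0 by rewrite -nr_gt0; lra.
have -> : b + dg y w / dg y v = dg y W / dg y v by rewrite E; field.
rewrite nrM nrV /L2.
have hWw : nr W <= (1 + L1 * nr v) * nr w.
  by have : nr b * nr v <= L1 * nr w * nr v by [rewrite ler_wpM2r]; lra.
have h1 : nr (dg y W) <= K2 * (1 + L1 * nr v) ^+ 2 * nr w ^+ 2.
  apply: le_trans hW _; rewrite -mulrA -exprMn ler_wpM2l //.
  by rewrite lerXn2r // nnegrE // mulr_ge0 //; lra.
rewrite mulrAC; apply: ler_pM; rewrite ?nr_ge0 ?invr_ge0 ?nr_ge0 //.
rewrite -[2 / c]invrK lef_pV2 ?posrE ?invr_gt0 ?divr_gt0 //; last lra.
by rewrite invf_div.
Qed.
End Thin.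

(** * Sets cut down to points by one equation contain no graph *)

Section ThinSets.
Context {R : realType}.
Local Notation C := (Cplx R).
Variable V : normedModType C.
Implicit Types (f g : V -> C) (x y z v w u : V) (O K Z : V -> Prop) (A B D : C -> Prop).

Definition indep3 (u1 u2 v : V) := forall a b c : C,
  a *: u1 + b *: u2 + c *: v = 0 -> [/\ a = 0, b = 0 & c = 0].

(** The isolated zero of one holomorphic germ h on Z: what is left in a normed
    space of a set of dimension at most one. *)
Definition cut_by_one Z y := exists h (p : R), [/\ 0 < p,
  forall y', nr (y' - y) < p -> hol_at h y', h y = 0 &
  forall y', nr (y' - y) < p -> Z y' -> h y' = 0 -> y' = y].

(** The graph of gam over the plane z + C u1 + C u2 is parametrized by two
    variables, continuously in both, and holomorphically in the second one,
    along which gam has slope s.  Composing h with this parametrization produces a function with an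
    isolated zero, which [no_isolated_zero] excludes; independence of u1, u2, v
    makes the parametrization injective. *)
Lemma no_graph K (gam : V -> C) v u1 u2 z (d L1 L2 : R) (s : V -> C) :
  indep3 u1 u2 v -> 0 < d -> 0 <= L1 -> 0 <= L2 ->
  (forall a t : C, nr a < d -> nr t < d -> let y := z + a *: u1 + t *: u2 in
     nr (y - z) < d -> K (y + gam y *: v)) ->
  (forall y y', nr (y - z) < d -> nr (y' - z) < d ->
     nr (gam y' - gam y) <= L1 * nr (y' - y)) ->
  (forall y, nr (y - z) < d -> forall t : C, nr (y + t *: u2 - z) < d ->
     nr (gam (y + t *: u2) - gam y - s y * t) <= L2 * nr t ^+ 2) ->
  ~ cut_by_one K (z + gam z *: v).
Proof.
move=> ind d0 L1_ge0 L2_ge0 HK Hlip Hdiff [h [p [p0 hh h0 hz]]].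
have z0 : nr (z - z) < d by rewrite subrr nr0.
have v0 := nr_ge0 v; have n1 := nr_ge0 u1; have n2 := nr_ge0 u2.
pose P y := y + gam y *: v.
pose M := 1 + L1 * nr v.
have Lv : 0 <= L1 * nr v by rewrite mulr_ge0.
have M1 : 1 <= M by rewrite /M; lra.
have Plip y y' : nr (y - z) < d -> nr (y' - z) < d -> nr (P y' - P y) <= M * nr (y' - y).
  move=> hy hy'; rewrite /P opprD addrACA -scalerBl.
  have := nrD (y' - y) ((gam y' - gam y) *: v); rewrite nrZ /M.
  have : nr (gam y' - gam y) * nr v <= L1 * nr (y' - y) * nr v by rewrite ler_wpM2r // Hlip.
  lra.
pose U := nr u1 + nr u2 + 1.
have U1 : 1 <= U by rewrite /U; lra.
(* parameters up to q stay in the domain of gam and map to that of h *)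
pose q := Num.min d p / (4 * U * M).
have UM : 0 < 4 * U * M by rewrite !mulr_gt0 //; lra.
have q0 : 0 < q by rewrite divr_gt0 // lt_min d0.
have qd : q * U * M * 4 <= d /\ q * U * M * 4 <= p.
  have : q * (4 * U * M) = Num.min d p by rewrite divfK // gt_eqF.
  rewrite (_ : q * (4 * U * M) = q * U * M * 4); last by ring.
  by move=> ->; rewrite !ge_min !lexx orbT.
have qd' : q < d.
  have : q <= q * U by rewrite ler_peMr // ltW.
  by have : q * U <= q * U * M by [rewrite ler_peMr // mulr_ge0 //; lra]; case: qd; lra.
pose X (a t : C) := z + a *: u1 + t *: u2.
have XE a t : X a t - z = a *: u1 + t *: u2 by rewrite /X -[z + _ + _]addrA addrAC subrr add0r.
have qU : 0 < q * U by rewrite mulr_gt0 //; lra.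
have XB a t : nr a <= q -> nr t <= q -> nr (X a t - z) <= q * U.
  move=> aq tq; rewrite XE; have := nrD (a *: u1) (t *: u2); rewrite !nrZ /U.
  have : nr a * nr u1 <= q * nr u1 by rewrite ler_wpM2r.
  have : nr t * nr u2 <= q * nr u2 by rewrite ler_wpM2r.
  lra.
have qUM : q * U <= q * U * M by rewrite ler_peMr // ltW.
have Xd a t : nr a <= q -> nr t <= q -> nr (X a t - z) < d.
  by move=> aq tq; have := XB a t aq tq; case: qd; lra.
have Xp a t : nr a <= q -> nr t <= q -> nr (P (X a t) - P z) < p.
  move=> aq tq; have := Plip z (X a t) z0 (Xd _ _ aq tq); have := XB a t aq tq.
  have : M * nr (X a t - z) <= M * (q * U) by rewrite ler_wpM2l ?XB //; lra.
  by case: qd => _; rewrite [M * (q * U)]mulrC; lra.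
have q00 : nr (0 : C) <= q by rewrite nr0 ltW.
have X00 : X 0 0 = z by rewrite /X !scale0r !addr0.
apply: (@no_isolated_zero R (fun a t => h (P (X a t))) q q0).
- move=> a aq t tq.
  have [L HL] := hh _ (Xp a t aq tq).
  (* the velocity of the parametrization in t *)
  exists (L (u2 + s (X a t) *: v)).
  apply: (cdiff_chain (c := fun t => P (X a t))) => // e e0.
  exists (e / (L2 * nr v + 1)) => [|t' t'q].
    by rewrite divr_gt0 //; have := mulr_ge0 L2_ge0 v0; lra.
  rewrite ltr_pdivlMr; last by have := mulr_ge0 L2_ge0 v0; lra.
  move=> tt.
  have E : X a t' = X a t + (t' - t) *: u2 by rewrite /X -[RHS]addrA -scalerDl addrCA subrr addr0.
  have -> : P (X a t') - P (X a t) - (t' - t) *: (u2 + s (X a t) *: v) =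
      (gam (X a t') - gam (X a t) - s (X a t) * (t' - t)) *: v.
    rewrite /P [in X in X + _ - _ - _]E opprD addrACA [X a t + _]addrC addrK -scalerBl.
    by rewrite scalerDr opprD addrACA subrr add0r scalerA -scalerBl [s _ * _]mulrC.
  rewrite nrZ; have := Hdiff _ (Xd _ _ aq tq) (t' - t); rewrite -E => /(_ (Xd _ _ aq t'q)) hd.
  have s0 := nr_ge0 (t' - t).
  apply: le_trans (_ : L2 * nr (t' - t) ^+ 2 * nr v <= _); first by rewrite ler_wpM2r.
  rewrite expr2 !mulrA mulrAC ler_wpM2r //; lra.
- move=> t tq e e0.
  have [L HL] := hh _ (Xp 0 t q00 tq).
  have [r r0 Hr] := fdiff_cts HL e0.
  exists (Num.min q (r / (2 * U * M))) => [|a t'].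
    by rewrite lt_min q0 divr_gt0 // !mulr_gt0 //; lra.
  rewrite !lt_min => /andP[aq ar] t'q /andP[_ tr].
  apply: Hr; apply: le_lt_trans (Plip _ _ (Xd _ _ q00 tq) (Xd _ _ (ltW aq) t'q)) _.
  have -> : X a t' - X 0 t = a *: u1 + (t' - t) *: u2.
    by rewrite /X scale0r addr0 -[z + _ + _]addrA opprD addrACA subrr add0r -addrA -scalerBl.
  have UM' : 0 < 2 * U * M by rewrite !mulr_gt0 //; lra.
  move: ar tr; rewrite !ltr_pdivlMr // => ar tr.
  have := nrD (a *: u1) ((t' - t) *: u2); rewrite !nrZ => hn.
  have : nr a * nr u1 <= nr a * U by rewrite ler_wpM2l ?nr_ge0 // /U; lra.
  have : nr (t' - t) * nr u2 <= nr (t' - t) * U by rewrite ler_wpM2l ?nr_ge0 // /U; lra.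
  move=> k1 k2; have : M * nr (a *: u1 + (t' - t) *: u2) <= M * (nr a * U + nr (t' - t) * U).
    by rewrite ler_wpM2l //; lra.
  lra.
- by rewrite X00.
- move=> a t aq tq hX.
  have := hz _ (Xp _ _ aq tq) (HK _ _ (le_lt_trans aq qd') (le_lt_trans tq qd') (Xd _ _ aq tq)) hX.
  move=> /eqP; rewrite -subr_eq0 opprD addrACA XE -scalerBl => /eqP /ind[-> ->].
  by [].
Qed.

Lemma cut_sub K Z y : (forall x, K x -> Z x) -> cut_by_one Z y -> cut_by_one K y.
Proof.
by move=> KZ [h [p [p0 h1 h2 h3]]]; exists h, p; split=> // y' yp /KZ; exact: h3.
Qed.

(** Near a parameter c0 given by [full_local], choose on each line a point of K
    close to c0.  These points are simple zeros of g along v, so by [graph_est]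
    the choice is a differentiable graph in K. *)
Lemma not_full_simple O K g v u1 u2 z (d r : R) : indep3 u1 u2 v ->
  openV O -> holV O g -> rclosed O K -> 0 < d ->
  (forall y, nr (y - z) < d -> forall c, nr c <= r -> O (y + c *: v)) ->
  (forall y, O y -> K y -> cut_by_one K y) ->
  (forall y, nr (y - z) < d -> forall c, nr c <= r -> K (y + c *: v) ->
     g (y + c *: v) = 0 /\ Dv v g (y + c *: v) != 0) ->
  ~ full K (disc r) v z d.
Proof.
move=> ind oO hg cK d0 HO Hcut Hg hfull.
have [dg Hdg] := holV_diff hg.
have [c0 c0r Hc0] := full_local d0 cK HO hfull.
have z0 : nr (z - z) < d by rewrite subrr nr0.
pose y0 := z + c0 *: v; have Oy0 : O y0 by exact: HO.
have v0 := nr_ge0 v.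
(* the small pieces of lines given by full_local are close to y0 *)
have near (q : R) : 0 < q -> exists2 e : R, 0 < e & forall y c, nr (y - z) < Num.min d e ->
    nr (c - c0) <= e -> nr (y + c *: v - y0) < q.
  move=> q0; have [|e e0 He] := @small_mul R V v (q / 2); first by rewrite divr_gt0.
  exists (Num.min e (q / 2)) => [|y c]; first by rewrite lt_min e0 divr_gt0.
  rewrite !lt_min le_min => /and3P[_ _ yz] /andP[cc _].
  rewrite [q]splitr; apply: line_near => //.
  by apply: le_trans He; rewrite ler_wpM2r.
have Ky0 : K y0.
  apply: contrapT => nK; have [q q0 Hq] := cK _ Oy0 nK.
  have [e e0 He] := near q q0; have [z2 [d2 d20 [Hz2 hf]]] := Hc0 e e0.
  have [|c [cc cr] Kc'] := hf z2; first by rewrite subrr nr0.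
  by apply: Hq Kc'; apply: He => //; apply: Hz2; rewrite subrr nr0.
have [_ Dy0] := Hg z z0 c0 c0r Ky0.
have DvE y : O y -> Dv v g y = dg y v by move=> Oy; exact: (Dv_fdiff v oO hg Oy (Hdg _ Oy)).
rewrite (DvE _ Oy0) in Dy0.
have [p [L1 [L2 [p0 L1_ge0 L2_ge0 Op est]]]] := graph_est oO hg Hdg Oy0 Dy0.
have [e e0 He] := near p p0; have [z2 [d2 d20 [Hz2 hf]]] := Hc0 e e0.
have /choice[gam Hgam] : forall y, exists c, nr (y - z2) < d2 ->
    [/\ nr (c - c0) <= e, nr c <= r & K (y + c *: v)].
  move=> y; have [/hf[c [h1 h2] h3]|ny] := pselect (nr (y - z2) < d2); last by exists 0.
  by exists c.
have gP y : nr (y - z2) < d2 -> nr (y + gam y *: v - y0) < p.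
  by move=> yz; have [h1 h2 h3] := Hgam _ yz; apply: He => //; exact: Hz2.
have g0 y : nr (y - z2) < d2 -> g (y + gam y *: v) = 0.
  move=> yz; have [h1 h2 h3] := Hgam _ yz.
  by have := Hz2 _ yz; rewrite lt_min => /andP[yd _]; have [] := Hg y yd _ h2 h3.
have E y y' : y' + gam y' *: v = y + gam y *: v + (y' - y) + (gam y' - gam y) *: v.
  rewrite scalerBl -[RHS]addrA [RHS]addrACA [y + (_ - _)]addrC subrK.
  by rewrite [gam y *: v + _]addrC subrK.
have est' y y' : nr (y - z2) < d2 -> nr (y' - z2) < d2 ->
    nr (gam y' - gam y) <= L1 * nr (y' - y) /\
    nr (gam y' - gam y + dg (y + gam y *: v) (y' - y) / dg (y + gam y *: v) v) <= L2 * nr (y' - y) ^+ 2.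
  move=> hy hy'; apply: est; rewrite -?E; [exact: gP|exact: gP|exact: g0|exact: g0].
have zz2 : nr (z2 - z2) < d2 by rewrite subrr nr0.
apply: (@no_graph K gam v u1 u2 z2 d2 L1 (L2 * nr u2 ^+ 2)
  (fun y => - (dg (y + gam y *: v) u2 / dg (y + gam y *: v) v))) => //.
- by rewrite mulr_ge0 // exprn_ge0 // nr_ge0.
- by move=> a t _ _ y /Hgam[].
- by move=> y y' hy hy'; have [] := est' y y' hy hy'.
- move=> y hy t hyt; have [_] := est' y _ hy hyt.
  have /Hdg/fdiff_lin[_ LZ] := Op _ (gP _ hy).
  rewrite (_ : y + t *: u2 - y = t *: u2); last by rewrite addrAC subrr add0r.
  rewrite LZ nrZ exprMn => h.
  rewrite mulNr opprK (_ : dg _ u2 / _ * t = t * dg (y + gam y *: v) u2 / dg (y + gam y *: v) v); last by rewrite mulrC mulrA.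
  by rewrite (_ : L2 * nr u2 ^+ 2 * nr t ^+ 2 = L2 * (nr t ^+ 2 * nr u2 ^+ 2)) //; ring.
- by apply: Hcut; [exact/Op/gP|have [] := Hgam _ zz2].
Qed.

(** Stratify Z by the order of vanishing of G along v, which is bounded near a
    compact piece of line.  If the lines meeting the points of order > j + 1 do
    not fill an open set of lines, then they miss a smaller one, over which the
    points of order > j are simple zeros of the j-th derivative along v:
    [not_full_simple] applies. *)
Lemma not_full_cut O Z G v u1 u2 z (d r : R) : indep3 u1 u2 v ->
  openV O -> holV O G -> rclosed O Z -> 0 < d ->
  (forall y, nr (y - z) < d -> forall c, nr c <= r -> O (y + c *: v)) ->
  (forall y, O y -> Z y -> cut_by_one Z y) ->
  (forall y, O y -> Z y -> G y = 0) ->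
  (forall y, nr (y - z) < d -> forall c, nr c <= r -> exists n, Dn v G n (y + c *: v) != 0) ->
  ~ full Z (disc r) v z d.
Proof.
move=> ind oO hG cZ d0 HO Hcut HG Hord.
have hD n : holV O (Dn v G n) by exact: Dn_hol.
have cD n y : O y -> forall e : R, 0 < e ->
    exists2 q : R, 0 < q & forall x, nr (x - y) < q -> nr (Dn v G n x - Dn v G n y) <= e.
  by move=> /(hD n)[L HL]; exact: fdiff_cts HL.
have nzD n y : O y -> Dn v G n y != 0 -> exists2 q : R, 0 < q & forall x, nr (x - y) < q -> Dn v G n x != 0.
  move=> Oy D0; have D0' : 0 < nr (Dn v G n y) by rewrite nr_gt0.
  have [|q q0 Hq] := cD n y Oy (nr (Dn v G n y) / 2); first by rewrite divr_gt0.
  exists q => // x /Hq h; rewrite -nr_gt0.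
  by have := nr_sub_ge (Dn v G n y) (Dn v G n x); rewrite (nrBC (Dn v G n y)); lra.
have z0 : nr (z - z) < d by rewrite subrr nr0.
(* the order of vanishing is at most m along all lines near that of z *)
have [|||_ [m [q q0 Hm]]] := @disc_compact R r (fun A => True /\ exists m, exists2 q : R, 0 < q &
    forall y, nr (y - z) < q -> forall c, A c -> disc r c -> exists2 n, (n <= m)%N & Dn v G n (y + c *: v) != 0).
- move=> A B AB [_ [m [q q0 H]]]; split=> //; exists m, q => // y yz c /AB; exact: H.
- move=> A B [_ [m [q q0 H]]] [_ [m' [q' q'0 H']]]; split=> //.
  exists (maxn m m'), (Num.min q q'); first by rewrite lt_min q0.
  move=> y; rewrite lt_min => /andP[h1 h2] c [] hc cr.
    by have [n nm Hn] := H y h1 c hc cr; exists n => //; rewrite leq_max nm.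
  by have [n nm Hn] := H' y h2 c hc cr; exists n => //; rewrite leq_max nm orbT.
- move=> c; have [cr|ncr] := pselect (nr c <= r); last first.
    exists (nr c - r); first by move/negP: ncr; rewrite -ltNge; lra.
    split=> //; exists 0%N, 1; first exact: ltr01.
    move=> y _ c' h1 h2; exfalso; move: h2; rewrite /disc.
    by have := nr_sub_ge c c'; rewrite (nrBC c); lra.
  have [n Hn] := Hord z z0 c cr.
  have [q q0 Hq] := nzD n _ (HO z z0 c cr) Hn.
  have [|e e0 He] := @small_mul R V v (q / 2); first by rewrite divr_gt0.
  exists e => //; split=> //; exists n, (q / 2) => [|y yz c' cc _]; first by rewrite divr_gt0.
  exists n => //; apply: Hq; rewrite [q]splitr; apply: line_near => //.
  by apply: le_trans He; rewrite ler_wpM2r ?nr_ge0 // ltW.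
pose K j y := Z y /\ forall i, (i <= j)%N -> Dn v G i y = 0.
have KZ j y : K j y -> Z y by case.
have cK j : rclosed O (K j).
  move=> y Oy nK; have [Zy|nZ] := pselect (Z y); last first.
    by have [e e0 He] := cZ y Oy nZ; exists e => // y' /He nZ' [].
  have /existsNP[i /not_implyP[ij /eqP Di]] : ~ forall i, (i <= j)%N -> Dn v G i y = 0.
    by move=> H; apply: nK.
  have [e e0 He] := nzD i y Oy Di; exists e => // y' /He /eqP Di' [_ H].
  exact/Di'/H.
have dr : dclosed (disc r).
  move=> c /negP; rewrite -ltNge => cr; exists (nr c - r); first lra.
  by move=> c' cc; apply/negP; rewrite -ltNge; have := nr_sub_ge c c'; rewrite (nrBC c); lra.
(* descending induction on j, as no point of order > m is left *)
have main k : forall j, (j + k = m)%N -> forall z' (d' : R), 0 < d' ->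
    (forall y, nr (y - z') < d' -> nr (y - z) < d /\ nr (y - z) < q) ->
    ~ full (K j) (disc r) v z' d'.
  elim: k => [|k IH] j jk z' d' d'0 Hz' hf.
    have zz' : nr (z' - z') < d' by rewrite subrr nr0.
    have [c cr [_ Kc']] := hf _ zz'; have [_ zq] := Hz' _ zz'.
    have [n nm /eqP] := Hm _ zq c cr cr; apply.
    by apply: Kc'; rewrite -(addn0 j) jk.
  have /existsNP[y /not_implyP[yz nh]] : ~ full (K j.+1) (disc r) v z' d'.
    by apply: IH => //; rewrite addSnnS.
  have [yd _] := Hz' _ yz.
  have [e e0 He] := nohits_open (cK j.+1) dr (fun c h => h) (HO y yd) nh.
  pose e' := Num.min e (d' - nr (y - z')).
  have e'0 : 0 < e' by rewrite lt_min e0 subr_gt0.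
  have ye x : nr (x - y) < e' -> nr (x - y) < e /\ nr (x - z') < d'.
    by rewrite lt_min => /andP[h1 h2]; split=> //; have := nr_tri y x z'; lra.
  apply: (@not_full_simple O (K j) (Dn v G j) v u1 u2 y e' r) => //.
  - by move=> x /ye[_ /Hz'[xd _]]; exact: HO.
  - by move=> x Ox Kx; apply: cut_sub (KZ j) _; apply: Hcut => //; exact: KZ Kx.
  - move=> x /ye[xe _] c cr Kx; split; first by case: Kx => _; apply.
    apply/eqP => D0; apply: (He x xe); exists c => //; case: Kx => Zx Kx; split=> // i.
    by rewrite leq_eqVlt ltnS => /orP[/eqP->|]; [exact: D0|exact: Kx].
  - by move=> x /ye[_ /hf].
move=> hf; apply: (main m 0%N _ z (Num.min d q)) => //.
- by rewrite lt_min d0.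
- by move=> y; rewrite lt_min => /andP[].
- move=> y; rewrite lt_min => /andP[yd _]; have [c cr Zc] := hf _ yd; exists c => //.
  by split=> // i; rewrite leqn0 => /eqP ->; apply: HG => //; exact: HO.
Qed.
End ThinSets.

(** * Local extension in a normed space *)

Section Extension.
Context {R : realType}.
Local Notation C := (Cplx R).
Variable V : normedModType C.
Implicit Types (f g : V -> C) (x y z v w u : V) (O K Z : V -> Prop) (A B D : C -> Prop).

Lemma rclosed_zeros O Z (I : Type) (g : I -> V -> C) : (forall i, holV O (g i)) ->
  (forall y, O y -> (Z y <-> forall i, g i y = 0)) -> openV O -> rclosed O Z.
Proof.
move=> hg HZ oO y Oy nZ.
have /existsNP[i /eqP gi] : ~ forall i, g i y = 0 by move=> H; apply/nZ/HZ.
have gi0 : 0 < nr (g i y) by rewrite nr_gt0.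
have [L HL] := hg i _ Oy; have [q q0 Hq] := oO _ Oy.
have [|d d0 Hd] := fdiff_cts HL (e := nr (g i y) / 2); first by rewrite divr_gt0.
exists (Num.min q d) => [|y']; first by rewrite lt_min q0.
rewrite lt_min => /andP[/Hq Oy' /Hd h] /(HZ _ Oy') /(_ i) gy'.
by move: h; rewrite gy' sub0r nrN; lra.
Qed.

(** If every equation vanished on every line through z in the plane of u1 and
    u2, this plane would be contained in Z near z: the graph of the function 0,
    excluded by [no_graph].  A direction in that plane is completed to three
    independent ones by u3 and by one of u1, u2. *)
Lemma direction O Z (k : nat) (g : 'I_k -> V -> C) u1 u2 u3 z : indep3 u1 u2 u3 ->
  openV O -> (forall i, holV O (g i)) ->
  (forall y, O y -> (Z y <-> forall i, g i y = 0)) ->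
  O z -> Z z -> cut_by_one Z z ->
  exists i v w1 w2, indep3 w1 w2 v /\ exists2 r : R, 0 < r &
    forall b : C, 0 < nr b -> nr b <= r -> g i (z + b *: v) != 0.
Proof.
move=> ind oO hg HZ Oz Zz Hcut; have [q q0 Hq] := oO _ Oz.
have n1 := nr_ge0 u1; have n2 := nr_ge0 u2.
pose U := nr u1 + nr u2 + 1; have U0 : 0 < U by rewrite /U; lra.
pose s := q / (2 * U); have s0 : 0 < s by rewrite divr_gt0 //; lra.
have sU : s * U = q / 2 by rewrite /s; field; rewrite gt_eqF.
pose w (a b : C) := a *: u1 + b *: u2.
have wU a b : nr a <= 1 -> nr b <= 1 -> nr (w a b) <= U.
  move=> a1 b1; have := nrD (a *: u1) (b *: u2); rewrite !nrZ /U.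
  have : nr a * nr u1 <= nr u1 by rewrite ler_piMl.
  have : nr b * nr u2 <= nr u2 by rewrite ler_piMl.
  rewrite /w; lra.
have Ow a b t : nr a <= 1 -> nr b <= 1 -> nr t <= s -> O (z + t *: w a b).
  move=> a1 b1 ts; apply: Hq; rewrite addrAC subrr add0r nrZ.
  have : nr t * nr (w a b) <= s * U by apply: ler_pM; rewrite ?nr_ge0 // wU.
  lra.
have [[a [b [i [a1 b1 [m [c Hl]]]]]]|nex] := pselect (exists a b i,
    [/\ nr a <= 1, nr b <= 1 & exists m c, lead (fun t => g i (z + t *: w a b)) m c]).
  have [r r0 Hr] := lead_nz Hl.
  exists i, (w a b).
  have wn0 : w a b != 0.
    apply/eqP => w0; have := Hr (rc r); rewrite nr_rc gtr0_norm // => /(_ r0 (lexx _)).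
    by rewrite w0 scaler0 addr0; have /(HZ _ Oz) -> := Zz; rewrite eqxx.
  have [a0|a0] := eqVneq a 0.
    exists u1, u3; split; last by exists r.
    have b0 : b != 0 by apply: contraNneq wn0 => b0; rewrite /w a0 b0 !scale0r addr0.
    move=> x y t; rewrite /w a0 scale0r add0r scalerA addrAC => /ind[-> /eqP tb ->].
    by split=> //; apply/eqP; move: tb; rewrite mulf_eq0 (negPf b0) orbF.
  exists u2, u3; split; last by exists r.
  move=> x y t; rewrite /w scalerDr !scalerA => E.
  have [] := ind (t * a) (x + t * b) y.
    by rewrite -E scalerDl addrA -[LHS]addrA [RHS]addrACA; congr (_ + _); exact: addrC.
  move=> /eqP; rewrite mulf_eq0 (negPf a0) orbF => /eqP ->; rewrite mul0r addr0 => -> ->.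
  by [].
exfalso.
(* otherwise all the equations vanish on all these lines *)
have zw a b t : nr a <= 1 -> nr b <= 1 -> nr t <= s / 4 -> Z (z + t *: w a b).
  move=> a1 b1 ts; have ts' : nr t <= s by lra.
  apply/(HZ _ (Ow _ _ _ a1 b1 ts')) => i.
  have hgi : holC (disc s) (fun t => g i (z + t *: w a b)).
    by move=> t' /(Ow _ _ _ a1 b1)/(hg i)[L HL]; exists (L (w a b)); exact: fdiff_slice.
  have [H|[m [c Hl]]] := lead_ex s0 hgi; first exact: H.
  by case: nex; exists a, b, i; split=> //; exists m, c.
apply: (@no_graph R V Z (fun=> 0) u3 u1 u2 z (s / 4) 0 0 (fun=> 0)) => //.
- by rewrite divr_gt0.
- move=> a t a1 t1 /= _; rewrite scale0r addr0.
  have [r rE] : exists r : R, r = s / 4 by eexists.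
  have r_gt0 : 0 < r by rewrite rE divr_gt0.
  rewrite -rE in a1 t1 zw; have r0 : rc r != 0 :> C by rewrite rc_eq0 gt_eqF.
  have nrr : nr (rc r : C) = r by rewrite nr_rc gtr0_norm.
  have H1 c : nr c < r -> nr (c / rc r) <= 1.
    by rewrite nrM nrV nrr => /ltW cr; rewrite ler_pdivrMr // mul1r.
  have := @zw (a / rc r) (t / rc r) (rc r) (H1 _ a1) (H1 _ t1); rewrite nrr => /(_ (lexx _)).
  by rewrite /w scalerDr !scalerA ![rc r * _]mulrC !divfK // addrA.
- by move=> *; rewrite subrr nr0 mul0r.
- by move=> *; rewrite subrr mul0r subr0 nr0 mul0r.
- by rewrite scale0r addr0.
Qed.

(** F(y) is the average of f on the contour y + b v, which misses Z for y near
    z.  It equals f(y) when the disc bounded by the contour misses Z too, and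
    such y are dense; both functions are continuous off Z. *)
Theorem local_extension O Z (k : nat) (g : 'I_k -> V -> C) u1 u2 u3 z : indep3 u1 u2 u3 ->
  openV O -> (forall i, holV O (g i)) ->
  (forall y, O y -> (Z y <-> forall i, g i y = 0)) ->
  (forall y, O y -> Z y -> cut_by_one Z y) ->
  O z -> Z z ->
  exists2 p : R, 0 < p & [/\ forall y, nr (y - z) < p -> O y,
    forall y (e : R), nr (y - z) < p -> 0 < e -> exists2 x, nr (x - y) < e & ~ Z x &
    forall f, holV (fun y => O y /\ ~ Z y) f -> exists2 F,
      holV (fun y => nr (y - z) < p) F & forall y, nr (y - z) < p -> ~ Z y -> F y = f y].
Proof.
move=> ind oO hg HZ Hcut Oz Zz; have [q q0 Hq] := oO _ Oz.
have cZ : rclosed O Z := rclosed_zeros hg HZ oO.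
have [i [v [w1 [w2 [indv [r1 r10 Hr1]]]]]] := direction ind oO hg HZ Oz Zz (Hcut _ Oz Zz).
have v0 := nr_ge0 v.
(* so small that segments with parameters up to 16 r stay in O, which leaves
   room for discs of radius 8 r around points with parameters up to r *)
pose r := Num.min r1 (q / (32 * (nr v + 1))).
have r0 : 0 < r by rewrite lt_min r10 divr_gt0 //; lra.
have rr1 : r <= r1 by rewrite ge_min lexx.
have rq : r * (32 * (nr v + 1)) <= q by rewrite -ler_pdivlMr ?ge_min ?lexx ?orbT //; lra.
clearbody r.
have [||p1 p10 Hp1] := @diamond_compact R r (fun b m => forall y, nr (y - z) < m -> g i (y + b *: v) != 0).
- by move=> b m m' m'0 mm H y ym; apply: H; lra.
- move=> b hb; have /andP[b1 b2] := diamond_le (ltW r0) hb.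
  have gb : g i (z + b *: v) != 0 by apply: Hr1; lra.
  have Ob : O (z + b *: v).
    apply: Hq; rewrite addrAC subrr add0r nrZ.
    by have : nr b * nr v <= r * nr v by [rewrite ler_wpM2r]; lra.
  have [L HL] := hg i _ Ob; have gb0 : 0 < nr (g i (z + b *: v)) by rewrite nr_gt0.
  have [|d d0 Hd] := fdiff_cts HL (e := nr (g i (z + b *: v)) / 2); first by rewrite divr_gt0.
  have [|e e0 He] := @small_mul R V v (d / 2); first by rewrite divr_gt0.
  exists (Num.min e (d / 2)) => [|b' _]; first by rewrite lt_min e0 divr_gt0.
  rewrite lt_min => /andP[bb _] y; rewrite lt_min => /andP[_ yz].
  have yd : nr (y + b' *: v - (z + b *: v)) < d.
    rewrite [d]splitr; apply: line_near => //.
    by apply: le_trans He; rewrite ler_wpM2r // ltW.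
  rewrite -nr_gt0; have := Hd _ yd; have := nr_sub_ge (g i (z + b *: v)) (g i (y + b' *: v)).
  by rewrite (nrBC (g i (z + b *: v))); lra.
pose p := Num.min p1 (q / 4).
have p0 : 0 < p by rewrite lt_min p10 divr_gt0.
have HO y c : nr (y - z) < p -> nr c <= 16 * r -> O (y + c *: v).
  rewrite lt_min => /andP[_ yz] cr; apply: Hq; rewrite addrAC.
  have := nrD (y - z) (c *: v); rewrite nrZ.
  have : nr c * nr v <= 16 * r * nr v by rewrite ler_wpM2r.
  lra.
have Op y : nr (y - z) < p -> O y.
  by move=> yz; have := HO y 0 yz; rewrite nr0 scale0r addr0; apply; rewrite mulr_ge0 // ltW.
have gbd y b : nr (y - z) < p -> diamond r b -> g i (y + b *: v) != 0.
  by rewrite lt_min => /andP[yz _] hb; exact: Hp1.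
(* lines missing Z are dense; Dn_neq0 applies because g is not 0 at b0,
   which is at distance at most 2 r from every c of the disc *)
have thin y (e : R) : nr (y - z) < p -> 0 < e -> exists2 x, nr (x - y) < e /\ nr (x - z) < p &
    ~ hits Z (disc r) v x.
  move=> yz e0; apply: contrapT => nx.
  pose e' := Num.min e (p - nr (y - z)).
  have e'0 : 0 < e' by rewrite lt_min e0 subr_gt0.
  have ball x : nr (x - y) < e' -> nr (x - y) < e /\ nr (x - z) < p.
    by rewrite lt_min => /andP[h1 h2]; split=> //; have := nr_tri y x z; lra.
  apply: (@not_full_cut R V O Z (g i) v w1 w2 y e' r) => //.
  - by move=> x /ball[_ xp] c cr; apply: HO => //; lra.
  - by move=> x Ox /(HZ _ Ox).
  - move=> x /ball[_ xp] c cr.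
    pose b0 : C := rc r * 1 * edge 0; have hb0 : diamond r b0 := diamond_vertex (ltW r0).
    have /andP[_ b2] := diamond_le (ltW r0) hb0.
    apply: (@Dn_neq0 R V O v (g i) (x + c *: v) (8 * r) (b0 - c)) => //.
    + by rewrite mulr_gt0.
    + move=> b br; rewrite -addrA -scalerDl; apply: HO => //.
      by have := nrD c b; move: br; rewrite /disc; lra.
    + by have := nrB b0 c; lra.
    + by rewrite -addrA -scalerDl [c + _]addrC subrK; exact: gbd.
  - move=> x /ball hx; apply: contrapT => nh; apply: nx; exists x => //.
exists p => //; split=> //.
- move=> y e yz e0; have [x [xe xp] nh] := thin y e yz e0; exists x => // Zx.
  by apply: nh; exists 0; rewrite ?scale0r ?addr0 // /disc nr0 ltW.
- move=> f hf; pose Oz' y := O y /\ ~ Z y.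
  have oOz : openV Oz'.
    move=> y [Oy nZ]; have [d d0 Hd] := oO _ Oy; have [d' d'0 Hd'] := cZ _ Oy nZ.
    exists (Num.min d d') => [|x]; first by rewrite lt_min d0.
    by rewrite lt_min => /andP[h1 h2]; split; [exact: Hd|exact: Hd'].
  pose F y := avg r (fun b => 1 * f (y + b *: v)).
  have bdO y b : nr (y - z) < p -> diamond r b -> Oz' (y + b *: v).
    move=> yz hb; have /andP[_ b2] := diamond_le (ltW r0) hb.
    have Ob : O (y + b *: v) by apply: HO => //; lra.
    by split=> // /(HZ _ Ob)/(_ i)/eqP; rewrite (negPf (gbd _ _ yz hb)).
  have hF y : nr (y - z) < p -> hol_at F y.
    by move=> yz; apply: (avg_fdiff (O := Oz')) => //; [exact: cts_cst|move=> b; exact: bdO].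
  exists F => // y yz nZ; apply: subr0_eq; apply: nr_small => e e0.
  have [LF HLF] := hF y yz; have [L HL] := hf y (conj (Op _ yz) nZ).
  have e2 : 0 < e / 2 by rewrite divr_gt0.
  have [d d0 Hd] := fdiff_cts HLF e2; have [d' d'0 Hd'] := fdiff_cts HL e2.
  have [|x [xd xp] nh] := thin y (Num.min d d') yz; first by rewrite lt_min d0.
  move: xd; rewrite lt_min => /andP[/Hd h1 /Hd' h2].
  have E : F x = f x.
    have hx : holC (disc r) (fun b => f (x + b *: v)).
      move=> b br; have Ob : O (x + b *: v).
        by apply: HO => //; move: br; rewrite /disc; lra.
      have [|L' HL'] := hf (x + b *: v).
        by split=> // Zb; apply: nh; exists b.
      by exists (L' v); exact: fdiff_slice.
    have := cauchy_formula hx (w := 0); rewrite nr0 scale0r addr0 => -> //; last by rewrite divr_gt0.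
    apply: avg_ext => [|b hb]; first exact: ltW.
    have /andP[b1 _] := diamond_le (ltW r0) hb.
    rewrite subr0 divff ?mulr1 ?mul1r // -nr_gt0; lra.
  by have := nr_tri (F x) (F y) (f y); rewrite (nrBC (F y) (F x)) {2}E; lra.
Qed.
End Extension.

(** * Local extension on a manifold *)

Section Charts.
Context {R : realType}.
Local Notation C := (Cplx R).

Lemma open_nbhsP (T : topologicalType) (A : set T) : (forall a, A a -> nbhs a A) -> open A.
Proof. by rewrite openE => H a /H. Qed.

Lemma within_nbhs (S T : topologicalType) (A : set S) (p : S -> T) a (B : set T) :
  open A -> {within A, continuous p} -> A a -> nbhs (p a) B -> nbhs a (p @^-1` B).
Proof.
move=> oA; rewrite continuous_open_subspace // => cp Aa nB.
by apply: (cp a _ B nB); rewrite inE.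
Qed.

Section Biholo.
Variables (S T : topologicalType) (hS : set S -> (S -> C) -> Prop) (hT : set T -> (T -> C) -> Prop).
Variables (A : set S) (B : set T) (p : S -> T) (q : T -> S).
Hypothesis pq : forall a, A a -> B (p a) /\ q (p a) = a.
Hypothesis qp : forall b, B b -> A (q b) /\ p (q b) = b.

Lemma image_homeo (U : set S) : U `<=` A -> p @` U = [set b | B b /\ U (q b)].
Proof.
move=> UA; apply/seteqP; split=> b.
  by move=> [a Ua <-] /=; have [Ba ->] := pq (UA _ Ua).
by move=> [Bb Uq]; exists (q b) => //; have [] := qp Bb.
Qed.

Lemma image_homeo_open (U : set S) : open B -> {within B, continuous q} ->
  open U -> U `<=` A -> open (p @` U).
Proof.
move=> oB cq oU UA; rewrite image_homeo //; apply: open_nbhsP => b [Bb Ub].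
apply: filterI; first exact: open_nbhs_nbhs.
by apply: (within_nbhs oB cq Bb); apply: open_nbhs_nbhs.
Qed.

End Biholo.

Lemma open_openV (V : normedModType C) (O : set V) : open O <-> openV O.
Proof. exact: open_nr. Qed.

Lemma holo_holV d (O : set 'rV[C]_d) f : holo O f <-> holV O f.
Proof.
split=> H z Oz; first by exists ('d f z); apply/differentiable_fdiff/H.
by have [L HL] := H z Oz; exact: fdiff_differentiable HL.
Qed.

Lemma delta_indep d (i j k : 'I_d) : i != j -> i != k -> j != k ->
  indep3 (delta_mx 0 i : 'rV[C]_d) (delta_mx 0 j) (delta_mx 0 k).
Proof.
move=> ij ik jk a b c /matrixP E.
have E' l : a * (l == i)%:R + b * (l == j)%:R + c * (l == k)%:R = 0.
  by have := E 0 l; rewrite !mxE eqxx.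
have := E' i; have := E' j; have := E' k.
rewrite !eqxx (negPf ij) (negPf ik) (negPf jk) [j == i]eq_sym [k == i]eq_sym [k == j]eq_sym.
rewrite (negPf ij) (negPf ik) (negPf jk) !mulr0 !mulr1 !add0r !addr0.
by [].
Qed.

Variables (W : fspace R) (d : nat) (Z : set W).
Hypothesis W_manifold : complex_manifold W d.
Hypothesis Z_analytic : analytic_subset Z.
Hypothesis Z_cut : forall z, Z z -> cut_out Z z 1.
Hypothesis Z_closed : closed Z.
Hypothesis d_ge3 : (3 <= d)%N.

Lemma hol_cts (U : set W) f x : open U -> hol U f -> U x ->
  forall e : R, 0 < e -> nbhs x [set y | nr (f y - f x) <= e].
Proof.
move=> oU hf Ux e e0; have [_ /(_ x)[A [D [p [oA Ax oD [q [pq qp cp cq hpq]]]]]]] := W_manifold.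
pose O := U `&` A; have oO : open O by exact: openI.
have OA : O `<=` A by move=> y [].
have hO : hol O f by apply: hol_sub hf => //; move=> y [].
have /holo_holV hq : holo (p @` O) (f \o q) by apply/hpq.
have [L HL] : hol_at (f \o q) (p x) by apply: hq; exists x.
have [r r0 Hr] := fdiff_cts HL e0.
have nP : nbhs (p x) [set b | nr (b - p x) < r] by apply/nbhs_nr; exists r.
have := within_nbhs oA cp Ax nP; apply: filterS2 (open_nbhs_nbhs (conj oA Ax)) => y Ay /Hr /=.
by have [_ ->] := pq y Ay; have [_ ->] := pq x Ax.
Qed.

(** [local_extension] in a chart around x, on which three coordinate directions
    are independent because d >= 3. *)
Lemma local_extension_manifold (U : set W) x : open U -> U x -> Z x ->
  (exists2 y, U y & ~ Z y) /\
  forall f, hol (U `\` Z) f -> exists N F, [/\ open N, N x, N `<=` U, hol N F &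
    forall y, N y -> ~ Z y -> F y = f y].
Proof.
move=> oU Ux Zx; have [_ /(_ x)[A [D [p [oA Ax oD [q [pq qp cp cq hpq]]]]]]] := W_manifold.
have [U1 [k [g [oU1 U1x hg HZ]]]] := Z_analytic x.
pose O' := U `&` (A `&` U1); have oO' : open O' by do 2?[apply: openI => //].
have O'x : O' x by [].
have O'A : O' `<=` A by move=> y [_ []].
pose O := p @` O'.
have img (X : set W) : open X -> X `<=` A -> openV (p @` X).
  by move=> oX XA; apply/open_openV/(image_homeo_open pq qp).
have oO : openV O by exact: img.
have OD b : O b -> D b /\ O' (q b) by rewrite /O (image_homeo pq qp).
have Zq_closed : rclosed O (fun b => Z (q b)).
  move=> b Ob nZ; have [Db Ub] := OD _ Ob.
  have : nbhs b (q @^-1` (~` Z)).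
    by apply: (within_nbhs oD cq Db); apply: open_nbhs_nbhs; split=> //; exact: closed_openC.
  by move=> /nbhs_nr.
have d0 : (0 < d)%N by apply: leq_trans d_ge3.
pose i0 : 'I_d := Ordinal d0.
pose i1 : 'I_d := Ordinal (leq_trans (isT : 1 < 3)%N d_ge3).
pose i2 : 'I_d := Ordinal (leq_trans (isT : 2 < 3)%N d_ge3).
have ind : indep3 (delta_mx 0 i0 : 'rV[C]_d) (delta_mx 0 i1) (delta_mx 0 i2) by exact: delta_indep.
have Op : O (p x) by exists x.
have qpx : q (p x) = x by have [] := pq x Ax.
have [|y Oy|y Oy Zy||r r0 [HO dense ext]] := @local_extension R _ O (fun b => Z (q b)) k (fun i => g i \o q) _ _ _ (p x) ind oO _ _ _ Op.
- move=> i; apply/holo_holV/hpq => //; apply: hol_sub (hg i) => //; by move=> y [_ []].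
- have [_ [_ [_ U1q]]] := OD _ Oy; exact: HZ.
- have [Dy O'y] := OD _ Oy; have [U2 [h [oU2 U2y hh Hh]]] := Z_cut Zy.
  pose X := O' `&` U2; have oX : open X by exact: openI.
  have XA : X `<=` A by move=> z [/O'A].
  have /holo_holV hX : holo (p @` X) (h ord0 \o q).
    by apply/hpq => //; apply: hol_sub (hh ord0) => //; move=> z [].
  have [Aq pqy] := qp _ Dy.
  have Xy : (p @` X) y by exists (q y).
  have [r r0 Hr] := img X oX XA y Xy.
  exists (h ord0 \o q), r; split=> //.
  + by move=> y' /Hr; exact: hX.
  + by have [_ /(_ erefl)[_ [_]]] := Hh (q y); apply.
  + move=> y' /Hr; rewrite (image_homeo pq qp) // => -[Dy' [_ U2y']] Zy' hy'.
    have E : q y' = q y by apply/Hh; split=> //; split=> // i; rewrite (ord1 i).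
    by have [_ <-] := qp _ Dy'; rewrite E.
- by rewrite qpx.
split.
  have [|b br nZ] := dense (p x) r _ r0; first by rewrite subrr nr0.
  by have [_ [Uq _]] := OD _ (HO _ br); exists (q b).
move=> f hf.
have oUZ : open (O' `\` Z) by apply: openI => //; exact: closed_openC.
have fq : holV (fun y => O y /\ ~ Z (q y)) (f \o q).
  have /hpq/holo_holV H : hol (O' `\` Z) f.
    apply: hol_sub hf => //; first by apply: openI => //; exact: closed_openC.
    by move=> y [[Uy _] nZ].
  move=> b [Ob nZ]; apply: H => //; first by move=> y [/O'A].
  by have [Db O'b] := OD _ Ob; exists (q b) => //; have [] := qp _ Db.
have [F hF FE] := ext _ fq.
pose N := [set y | O' y /\ nr (p y - p x) < r].
have oN : open N.
  apply: open_nbhsP => y [Py yr]; apply: filterI; first exact: open_nbhs_nbhs.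
  apply: (within_nbhs oA cp (O'A _ Py) (B := [set b | nr (b - p x) < r])).
  by apply: open_nbhs_nbhs; split=> //; exact: open_nball.
have NA : N `<=` A by move=> y [/O'A].
exists N, (F \o p); split=> //.
- by split=> //=; rewrite subrr nr0.
- by move=> y [[]].
- apply/hpq => //; apply/holo_holV => b Nb.
  have [a [Pa ar] ab] := Nb.
  have [L HL] : hol_at F b by apply: hF; rewrite -ab.
  have [s s0 Hs] := img N oN NA b Nb.
  exists L; apply: fdiff_near s0 _ HL => b' /Hs [a' [/O'A Aa' _] <-] /=.
  by have [_ ->] := pq _ Aa'.
- move=> y [Py yr] nZ /=; have [_ qy] := pq _ (O'A _ Py).
  by rewrite FE //= qy.
Qed.
End Charts.

(** * Extension over Z, and surjectivity of the bidual map *)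

Section Hartogs.
Context {R : realType}.
Local Notation C := (Cplx R).
Variables (W : fspace R) (d : nat) (Z : set W).
Hypothesis W_manifold : complex_manifold W d.
Hypothesis Z_analytic : analytic_subset Z.
Hypothesis Z_cut : forall z, Z z -> cut_out Z z 1.
Hypothesis Z_closed : closed Z.
Hypothesis d_ge3 : (3 <= d)%N.

(** Z has empty interior and f - g is continuous. *)
Lemma hol_eq_off (U : set W) f g : open U -> hol U f -> hol U g ->
  (forall y, U y -> ~ Z y -> f y = g y) -> forall y, U y -> f y = g y.
Proof.
move=> oU hf hg fg y Uy; have [Zy|nZ] := pselect (Z y); last exact: fg.
apply: subr0_eq; apply: nr_small => e e0; have e2 : 0 < e / 2 by rewrite divr_gt0.
have n1 := hol_cts W_manifold oU hf Uy e2; have n2 := hol_cts W_manifold oU hg Uy e2.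
have : nbhs y (U `&` ([set x | nr (f x - f y) <= e / 2] `&` [set x | nr (g x - g y) <= e / 2])).
  by apply: filterI; [exact: open_nbhs_nbhs|exact: filterI].
rewrite nbhsE => -[X [oX Xy] XS].
have [[x Xx nZ] _] := local_extension_manifold W_manifold Z_analytic Z_cut Z_closed d_ge3 oX Xy Zy.
have [Ux [/= h1 h2]] := XS _ Xx.
have := nr_tri (f x) (f y) (g y); have := nr_tri (g x) (f x) (g y).
by rewrite fg // subrr nr0 -(fg x Ux nZ) (nrBC (f y) (f x)); move: h1 h2; rewrite -(fg x Ux nZ); lra.
Qed.

(** The local extensions agree on overlaps by [hol_eq_off], so their values at
    points of Z define one function, holomorphic by gluing. *)
Lemma hol_extend (U : set W) f : open U -> hol (U `\` Z) f ->
  exists2 F, hol U F & forall y, U y -> ~ Z y -> F y = f y.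
Proof.
move=> oU hf.
have oUZ : open (U `\` Z) by apply: openI => //; exact: closed_openC.
(* the value at y of some local extension near y *)
have /choice[v Hv] : forall y, exists c : C, U y -> Z y -> exists N F, [/\ open N, N y, N `<=` U, hol N F &
    (forall x, N x -> ~ Z x -> F x = f x) /\ F y = c].
  move=> y; have [[Uy Zy]|n] := pselect (U y /\ Z y); last by exists 0 => Uy Zy; case: n.
  have [_ /(_ f hf)[N [F [oN Ny NU hF FE]]]] :=
    local_extension_manifold W_manifold Z_analytic Z_cut Z_closed d_ge3 oU Uy Zy.
  by exists (F y) => _ _; exists N, F.
pose e y := if pselect (Z y) then v y else f y.
have eN y : ~ Z y -> e y = f y by rewrite /e; case: pselect.
exists e => [|y _]; last exact: eN.
apply: hol_glue => // y Uy; have [Zy|nZ] := pselect (Z y); last first.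
  exists (U `\` Z); split=> //.
  by apply: hol_ext hf => x [_ nZx]; rewrite eN.
have [N [F [oN Ny NU hF [FE _]]]] := Hv _ Uy Zy.
exists N; split=> //; apply: hol_ext (hF) => x Nx.
rewrite /e; case: pselect => [Zx|nZx]; last exact: FE.
have [N' [F' [oN' N'x N'U hF' [FE' <-]]]] := Hv _ (NU _ Nx) Zx.
have oI : open (N `&` N') by exact: openI.
apply: (@hol_eq_off (N `&` N') F F') => //.
- by apply: hol_sub hF => // z [].
- by apply: hol_sub hF' => // z [].
- by move=> z [Nz N'z] nZ; rewrite FE // FE'.
Qed.
End Hartogs.

Section Surjectivity.
Context {R : realType} {X Y : fspace R}.
Variables (Z : set X) (p : holmap X Y) (F : psmod X).
Implicit Types (U : opens X) (V : opens Y).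

Lemma osec_ext0 (T : fspace R) (U : opens T) (f g : osec U) :
  (forall y, U y -> ext0 f y = ext0 g y) -> f = g.
Proof. by move=> fg; apply: osecP => y; rewrite -!ext0_val fg //; exact: set_valP. Qed.

Hypothesis Z_closed : closed Z.
Hypothesis img_open : forall U : set X, open U -> open (p @` (U `\` Z)).
Hypothesis p_inj : forall y y', ~ Z y -> p y = p y' -> y = y'.

Lemma offZ_subproof U : open ((U : set X) `\` Z).
Proof. by apply: openI; [exact: oset_open|exact: closed_openC]. Qed.

Definition offZ U : opens X := Opens (offZ_subproof U).
(** p(U \ Z), which is open since p is an isomorphism off Z; F over U \ Z and
    p_* F over this set have the same sections. *)
Definition img U : opens Y := Opens (img_open (oset_open U)).

Lemma offZ_sub U : offZ U `<=` U.
Proof. by move=> y []. Qed.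

Lemma offZS U U' : U' `<=` U -> offZ U' `<=` offZ U.
Proof. by move=> UU y [/UU]. Qed.

Lemma offZ_img U : offZ U `<=` opreim p (img U).
Proof. by move=> y Uy; exists y. Qed.

Lemma img_offZ U : opreim p (img U) `<=` offZ U.
Proof. by move=> y [u [Uu nu]] /(p_inj nu) <-. Qed.

Lemma opreim_img U : opreim p (img U) `<=` U.
Proof. by move=> y /img_offZ[]. Qed.

Lemma img_sub U V : U `<=` opreim p V -> img U `<=` V.
Proof. by move=> UV y [u [/UV ? _] <-]. Qed.

Lemma imgS U U' : U' `<=` U -> img U' `<=` img U.
Proof. by move=> UU y [u [/UU ? ?] <-]; exists u. Qed.

(** The structure map O_Y -> p_* O_X is an isomorphism, with inverse [up]. *)
Variable up : forall V, osec (opreim p V) -> osec V.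
Hypothesis opullK : forall V, cancel (@opull R X Y p V) (@up V).
Hypothesis upK : forall V, cancel (@up V) (@opull R X Y p V).
(** Functions extend over Z, in a unique way. *)
Variable ext : forall U, osec (offZ U) -> osec U.
Hypothesis extE : forall U (f : osec (offZ U)), ores (@offZ_sub U) (ext f) = f.
Hypothesis offZ_inj : forall U (f g : osec U),
  ores (@offZ_sub U) f = ores (@offZ_sub U) g -> f = g.

Lemma opull_inj V : injective (@opull R X Y p V).
Proof. exact: can_inj (@opullK V). Qed.

Section Push.
Variables (U : opens X) (psi : dual F U).

(** A functional of F on U, seen on p(U \ Z) as a functional of p_* F. *)
Program Definition push : dual (direct_image p F) (img U) :=
  @DSec R Y (direct_image p F) (img U)
    (fun V VU s => up (dval psi (subset_trans (opreimS VU) (@opreim_img U)) s)) _ _.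
Next Obligation.
move=> V VU a s t; apply: opull_inj.
by rewrite /= [RHS]opullD opullM !upK dval_lin.
Qed.
Next Obligation.
move=> V V' VU V'V V'U s; apply: opull_inj.
rewrite upK opull_res upK.
exact: dval_res.
Qed.
End Push.

Lemma push_lin U (a : osec U) (psi psi' : dual F U) :
  push (a *: psi + psi') = up (ores (@opreim_img U) a) *: push psi + push psi'.
Proof.
apply: dsecP => V VU s; apply: opull_inj.
rewrite /= opullD opullM !upK opull_res upK.
by rewrite (ores_comp _ _ (subset_trans (opreimS VU) (@opreim_img U))).
Qed.

Lemma push_res U U' (UU : U' `<=` U) (psi : dual F U) :
  push (res UU psi) = res (imgS UU) (push psi).
Proof. by apply: dsecP => V VU s /=; congr up; exact: dval_irr. Qed.

Section Hat.
Variables (V : opens Y) (t : dual (dual (direct_image p F)) V).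

(** The value of t on a functional of F is known on U \ Z, where the functional
    is one of p_* F, and it extends to U. *)
Definition hat U (UV : U `<=` opreim p V) (psi : dual F U) : osec U :=
  ext (ores (@offZ_img U) (opull p (dval t (img_sub UV) (push psi)))).

Lemma hat_lin U (UV : U `<=` opreim p V) (a : osec U) (psi psi' : dual F U) :
  hat UV (a *: psi + psi') = a * hat UV psi + hat UV psi'.
Proof.
apply: offZ_inj; rewrite extE oresD oresM !extE push_lin dval_lin opullD opullM upK.
by rewrite oresD oresM (ores_comp _ _ (@offZ_sub U)).
Qed.

Lemma hat_res U U' (UV : U `<=` opreim p V) (UU : U' `<=` U) (UV' : U' `<=` opreim p V)
  (psi : dual F U) : hat UV' (res UU psi) = ores UU (hat UV psi).
Proof.
apply: offZ_inj; rewrite extE push_res (dval_res t (img_sub UV) (imgS UU)) opull_res.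
rewrite (ores_comp _ _ (subset_trans (@offZ_sub U') UU)).
rewrite -(ores_comp (@offZ_sub U) (offZS UU)) extE.
rewrite (ores_comp _ _ (subset_trans (offZS UU) (@offZ_img U))).
by rewrite (ores_comp _ _ (subset_trans (offZS UU) (@offZ_img U))).
Qed.

Definition hat_sec : dual (dual F) (opreim p V) :=
  @DSec R X (dual F) (opreim p V) hat hat_lin hat_res.
End Hat.

Section Pull.
Variables (V : opens Y) (phi : dual (direct_image p F) V).

Lemma offZ_preim U : U `<=` offZ (opreim p V) -> U `<=` opreim p (img U).
Proof. by move=> UV y Uy; have [_ nZ] := UV _ Uy; exists y. Qed.

Lemma img_offZ_sub U : U `<=` offZ (opreim p V) -> img U `<=` V.
Proof. by move=> UV; apply: img_sub => y /UV[]. Qed.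

(** Conversely, a functional of p_* F gives one of F off Z only. *)
Program Definition pull : dual F (offZ (opreim p V)) :=
  @DSec R X F (offZ (opreim p V)) (fun U UV s =>
    ores (offZ_preim UV) (opull p (dval phi (img_offZ_sub UV) (res (@opreim_img U) s)))) _ _.
Next Obligation.
move=> U UV a s s' /=; have E := res_lin (@opreim_img U) a s s'; rewrite E.
have := dval_lin phi (img_offZ_sub UV) (up (ores (@opreim_img U) a)) (res (@opreim_img U) s) (res (@opreim_img U) s').
rewrite {1}/GRing.scale /= /pfscale upK => ->.
by rewrite opullD opullM upK oresD oresM (ores_comp _ _ (@subset_refl _ _)) ores_id.
Qed.
Next Obligation.
move=> U U' UV UU UV' s /=.
have -> : res (@opreim_img U') (res UU s) =
    res (imgS UU) (res (@opreim_img U) s : direct_image p F (img U)).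
  rewrite (res_comp UU _ (subset_trans (@opreim_img U') UU)).
  by rewrite /= /pfres (res_comp _ _ (subset_trans (@opreim_img U') UU)).
rewrite (dval_res phi (img_offZ_sub UV) (imgS UU)) opull_res.
rewrite (ores_comp _ _ (subset_trans UU (offZ_preim UV))).
by rewrite (ores_comp _ _ (subset_trans UU (offZ_preim UV))).
Qed.

Lemma push_pull : push pull = res (img_sub (@offZ_sub (opreim p V))) phi.
Proof.
apply: dsecP => V' V'V s /=; apply: opull_inj; rewrite upK.
have VV : img (opreim p V') `<=` V' by exact: (img_sub (@subset_refl _ _)).
have -> : res (@opreim_img (opreim p V')) (s : F (opreim p V')) =
    res VV (s : direct_image p F V') by rewrite /= /pfres; exact: res_irr.
rewrite (dval_res phi (subset_trans V'V (img_sub (@offZ_sub (opreim p V)))) VV) opull_res.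
by rewrite (ores_comp _ _ (@subset_refl _ _)) ores_id.
Qed.
End Pull.

(** Reflexivity turns [hat_sec t] into a section r.  To compare t with the
    bidual of r on a functional phi over V', it is enough to do so off Z; there
    phi is the push of its own pull, on which t and [hat_sec t] agree. *)
Theorem bidual_direct_image_surj (F_refl : reflexive_sheaf F) V
  (t : dual (dual (direct_image p F)) V) : exists r, bidual_map (direct_image p F) V r = t.
Proof.
have [inv _ K] := F_refl (opreim p V).
exists (inv (hat_sec t)).
have Hr : bidual_map F (opreim p V) (inv (hat_sec t)) = hat_sec t := K _.
move: (inv _) Hr => r Hr.
apply: dsecP => V' V'V phi /=; apply: opull_inj; apply: offZ_inj.
pose U0 := offZ (opreim p V').
have U0V : U0 `<=` opreim p V by move=> y [/V'V].
have E : dval (bidual_map F (opreim p V) r) U0V (pull phi) = hat t U0V (pull phi) by rewrite Hr.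
have VV : img U0 `<=` V' by exact: (img_sub (@offZ_sub _)).
have U0U : U0 `<=` offZ U0 by move=> y [Uy nZ]; split.
have U0V' : U0 `<=` opreim p V' := @offZ_sub _.
have rE : res (@opreim_img U0) (res U0V r) = res VV (res V'V (r : direct_image p F V)).
  rewrite /= /pfres (res_comp U0V _ (subset_trans (@opreim_img U0) U0V)).
  by rewrite (res_comp _ _ (subset_trans (@opreim_img U0) U0V)).
move: E => /(congr1 (ores (@offZ_sub U0)))/(congr1 (ores U0U)).
rewrite /hat extE push_pull.
have -> : dval (bidual_map F (opreim p V) r) U0V (pull phi) = ores U0V' (opull p (dval phi (@subset_refl _ V') (res V'V (r : direct_image p F V)))).
  rewrite /= rE (dval_res phi (@subset_refl _ V') VV) opull_res.
  by rewrite (ores_comp _ _ U0V').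
have -> : dval t (img_sub U0V) (res (img_sub (@offZ_sub (opreim p V'))) phi) = ores VV (dval t V'V phi).
  by rewrite (res_irr _ VV); exact: dval_res.
have H1 : offZ U0 `<=` opreim p V' := subset_trans (@offZ_sub U0) U0V'.
rewrite opull_res (ores_comp _ _ H1) (ores_comp _ _ H1) !(ores_comp _ _ U0V').
by rewrite (Prop_irrelevance (@offZ_sub (opreim p V')) U0V').
Qed.
End Surjectivity.

(** * Vanishing of the cokernel *)

Lemma h0_eq0 (R : realType) (X : fspace R) (G : psmod X) :
  (forall s : G (opensT X), s = 0) -> h0 G = 0%E.
Proof.
move=> G0; rewrite /h0 [X in ereal_sup X](_ : _ = [set 0%E]) ?ereal_sup1 //.
apply/seteqP; split=> [_ [k [s Hs] <-]|_ ->]; last first.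
  exists 0%N => //; exists (fun=> 0) => c _ i; by case: i.
case: k s Hs => [//|k] s Hs; exfalso.
have /eqP : (1 : Cplx R) = 0 by apply: (Hs (fun=> 1) _ ord0); exact: G0.
by rewrite oner_eq0.
Qed.

Lemma coker_surj0 (R : realType) (X : fspace R) (F G : psmod X) (h : psmor F G) :
  (forall V (t : G V), exists r, h V r = t) -> forall U (c : coker h U), c = 0.
Proof.
move=> hs U c; apply: csecP => y Uy /=.
have [V [Vy [t ->]]] := clsP (cval c Uy); have [r rt] := hs V t.
transitivity (cls h Vy 0); last exact: cls0.
apply/cls_eq; exists V, (@subset_refl _ _), (@subset_refl _ _), r; split=> //.
by rewrite res0 subr0 res_id.
Qed.

Theorem lemma5p2 (R : realType) (W W' : fspace R) (d n : nat)
    (Z : set W) (p : holmap W W') (x : W') (F : psmod W)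
    (W_manifold : complex_manifold W d)
    (W_connected : connected [set: W])
    (Z_curve : compact_connected_curve Z)
    (n_ge2 : (2 <= n)%N)
    (Z_codim : codim_in d Z n)
    (p_contraction : contracts_to Z p x)
    (F_coherent : coherent F)
    (F_reflexive : reflexive_sheaf F) :
  h0 (coker (bidual_map (direct_image p F))) = 0%E.
Proof.
have [Zan [z0 Zz0] Zcpt _ Zdim] := Z_curve.
have Zcl : closed Z by apply: compact_closed Zcpt; have [] := W_manifold.
have Zcut z : Z z -> cut_out Z z 1 by move=> /Zdim[].
(* d = e + n, where the local dimension e of Z is 1 *)
have d_ge3 : (3 <= d)%N.
  have [e [ce eleast] ->] := Z_codim _ Zz0; have [c1 least1] := Zdim _ Zz0.
  have -> : e = 1%N by apply/eqP; rewrite eqn_leq eleast // least1.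
  by rewrite add1n ltnS.
have [[[W'_haus _] _] _ pbij pZ [q [pq qp cp cq _]]] := p_contraction.
have pZx y : Z y -> p y = x by move=> Zy; have : (p @` Z) (p y) by [exists y]; rewrite pZ.
have oB : open (~` [set x]).
  exact/closed_openC/accessible_closed_set1/hausdorff_accessible.
have img_open (U : set W) : open U -> open (p @` (U `\` Z)).
  move=> oU; apply: (image_homeo_open pq qp oB cq) => [|y [] //].
  by apply: openI => //; exact: closed_openC.
have p_inj y y' : ~ Z y -> p y = p y' -> y = y'.
  move=> nZ pyy; have [py qy] := pq _ nZ.
  have nZ' : ~ Z y' by move=> /pZx py'; apply: py; rewrite /= pyy.
  by rewrite -qy pyy; have [_ ->] := pq _ nZ'.
have up_ex V : exists g, cancel (@opull R W W' p V) g /\ cancel g (@opull R W W' p V).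
  by have [g gK Kg] := pbij V; exists g.
have ext_ex U (f : osec (offZ Zcl U)) : exists e : osec U, ores (@offZ_sub _ _ _ Zcl U) e = f.
  have [G hG GE] := hol_extend W_manifold Zan Zcut Zcl d_ge3 (oset_open U) (osec_hol f).
  have eP : sigL U G \in holb U.
    by apply/asboolP; apply: hol_ext hG => y Uy; rewrite (ext0E _ Uy).
  exists (OSec eP); apply: osec_ext0 => y [Uy nZ].
  by rewrite ext0_ores // (ext0E _ Uy) /= GE.
have offZ_inj U (f g : osec U) : ores (@offZ_sub _ _ _ Zcl U) f = ores (@offZ_sub _ _ _ Zcl U) g -> f = g.
  move=> fg; apply: osec_ext0 => y Uy.
  apply: (hol_eq_off W_manifold Zan Zcut Zcl d_ge3 (oset_open U) (osec_hol f) (osec_hol g)) => // z Uz nZ.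
  have Oz : offZ Zcl U z by split.
  by rewrite -(ext0_ores (@offZ_sub _ _ _ Zcl U) f Oz) fg ext0_ores.
apply/h0_eq0/coker_surj0 => V t.
pose up V := sval (cid (up_ex V)); pose ext U f := sval (cid (ext_ex U f)).
apply: (bidual_direct_image_surj img_open p_inj (up := up) _ _ (ext := ext)) => //.
- by move=> V'; rewrite /up; case: cid => g [].
- by move=> V'; rewrite /up; case: cid => g [].
- by move=> U f; rewrite /ext; case: cid.
Qed.
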